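(* Let $n\ge 1$, let $\lambda_j,\sigma_j,\tau_j\in\mathbb C$ for $j=1,\dots,n$, and put $\lambda_{n+1}=\sigma_{n+1}=\tau_{n+1}=0$. Assume that $\operatorname{Re}(\lambda_k-\frac{n+k}2)>0$ and $\operatorname{Re}(\sigma_k+\tau_k-\lambda_k-\frac{n-k}2)>0$ for $k=1,\dots,n$. Then, integrating over all pairs $(T,S)$ of real symmetric $n\times n$ matrices with $T$ positive definite, $$\int\prod_{j=1}^n\frac{\det[T]_j^{\lambda_j-\lambda_{j+1}}}{\det[1+T+iS]_j^{\{\sigma_j-\sigma_{j+1}\|\tau_j-\tau_{j+1}\}}}\,\det T^{-(n+1)}\,dT\,dS=\prod_{k=1}^n\frac{2^{2-\sigma_k-\tau_k+n-k}\,\pi^{k}\,\Gamma(\lambda_k-\frac{n+k}2)\,\Gamma(\sigma_k+\tau_k-\lambda_k-\frac{n-k}2)}{\Gamma(\sigma_k-\frac{n-k}2)\,\Gamma(\tau_k-\frac{n-k}2)} .$$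
   Context: $[A]_j$ denotes the left upper $j\times j$ block of $A$; $\det[A]_j^a$ means the power $a$ of $\det[A]_j$. For a complex matrix $R$ with $R+R^*$ positive definite and eigenvalues $\mu_1,\dots,\mu_m$ (which have positive real parts), $\det R^{\{\sigma\|\tau\}}:=\det R^{\sigma}\,\overline{\det R}^{\,\tau}=\exp\{\sigma\sum_j\ln\mu_j+\tau\sum_j\overline{\ln\mu_j}\}$ with the principal logarithm. $dT=\prod_{k\le m}dt_{km}$, $dS=\prod_{k\le m}ds_{km}$. *)

(* Defs.v *)
From HB Require Import structures.
From mathcomp Require Import all_boot all_order all_algebra.
From mathcomp Require Import all_classical all_reals all_analysis.
From mathcomp Require Import complex.

Set Implicit Arguments.
Unset Strict Implicit.
Unset Printing Implicit Defensive.

Import Order.TTheory GRing.Theory Num.Theory.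
Import numFieldNormedType.Exports.

Local Open Scope classical_set_scope.
Local Open Scope complex_scope.
Local Open Scope ring_scope.

Section complex_functions.
Context {R : realType}.

Definition cexp (z : R[i]) : R[i] :=
  (expR (complex.Re z) * cos (complex.Im z)) +i*
  (expR (complex.Re z) * sin (complex.Im z)).

(* The principal argument: for z != 0 it lies in ]-pi, pi]. *)
Definition carg (z : R[i]) : R :=
  let t := acos (complex.Re z / Normc.normc z) in
  if 0 <= complex.Im z then t else - t.

Definition cln (z : R[i]) : R[i] := ln (Normc.normc z) +i* carg z.

(* x ^ a for real x > 0 and complex a. *)
Definition rpowc (x : R) (a : R[i]) : R[i] := cexp (a * (ln x)%:C).

End complex_functions.

Section complex_integral.
Context d {T : measurableType d} {R : realType}.
Variables (mu : {measure set T -> \bar R}) (D : set T).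

Definition cintegrable (f : T -> R[i]) : Prop :=
  mu.-integrable D (fun x => (complex.Re (f x))%:E) /\
  mu.-integrable D (fun x => (complex.Im (f x))%:E).

Definition cintegral (f : T -> R[i]) : R[i] :=
  (\int[mu]_(x in D) complex.Re (f x)) +i* (\int[mu]_(x in D) complex.Im (f x)).

End complex_integral.

Section gamma.
Context {R : realType}.

(* Euler's integral, convergent for Re z > 0. *)
Definition euler_gamma (z : R[i]) : R[i] :=
  cintegral (@lebesgue_measure R) `]0, +oo[
    (fun t : R => rpowc t (z - 1) * (expR (- t))%:C).

(* The Gamma function on the complex plane. For Re z <= 0 the value is
   Gamma(z + m) / (z (z + 1) ... (z + m - 1)) with m least such that
   Re (z + m) > 0. At the poles 0, -1, -2, ... the denominator vanishes and the
   value is 0, so that (cgamma z)^-1 is the entire function 1 / Gamma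
   everywhere. *)
Definition cgamma (z : R[i]) : R[i] :=
  let m := if 0 < complex.Re z then 0%N
           else (Num.truncn (- complex.Re z)).+1 in
  euler_gamma (z + m%:R) / \prod_(j < m) (z + j%:R).

End gamma.

Section tuple_lebesgue.
Context {R : realType}.

Local Notation RT := (measurableTypeR R).

Definition tuple_cons n (p : RT * n.-tuple RT) : n.+1.-tuple RT :=
  [tuple of p.1 :: p.2].

Lemma measurable_tuple_cons n :
  measurable_fun [set: RT * n.-tuple RT] (@tuple_cons n).
Proof. exact: measurable_cons. Qed.

Section step.
Variables (n : nat) (m : {sigma_finite_measure set (n.-tuple RT) -> \bar R}).

Definition tuple_lebesgueS : set (n.+1.-tuple RT) -> \bar R :=
  pushforward (@lebesgue_measure R \x m)%E (@tuple_cons n).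

Let tuple_lebesgueS0 : tuple_lebesgueS set0 = 0%E.
Proof. by rewrite /tuple_lebesgueS /pushforward preimage_set0 measure0. Qed.

Let tuple_lebesgueS_ge0 A : (0 <= tuple_lebesgueS A)%E.
Proof. by rewrite /tuple_lebesgueS /pushforward measure_ge0. Qed.

Let tuple_lebesgueS_sigma_additive : semi_sigma_additive tuple_lebesgueS.
Proof.
move=> F mF tF mUF; rewrite /tuple_lebesgueS /pushforward preimage_bigcup.
have mp A : measurable A -> measurable (@tuple_cons n @^-1` A).
  by move=> mA; rewrite -[X in measurable X]setTI; exact: measurable_tuple_cons.
apply: measure_semi_sigma_additive => [k||]; first exact: mp.
- apply/trivIsetP => /= i j _ _ ij; rewrite -preimage_setI.
  by move/trivIsetP : tF => /(_ _ _ _ _ ij) ->//; rewrite preimage_set0.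
- by rewrite -preimage_bigcup; exact: mp.
Qed.

HB.instance Definition _ := isMeasure.Build _ _ _ tuple_lebesgueS
  tuple_lebesgueS0 tuple_lebesgueS_ge0 tuple_lebesgueS_sigma_additive.

Let tuple_lebesgueS_sigma_finite : sigma_finite setT tuple_lebesgueS.
Proof.
have /sigma_finiteP[F [FT ndF Foo]] := sigma_finiteT (@lebesgue_measure R).
have /sigma_finiteP[G [GT ndG Goo]] := sigma_finiteT m.
pose u (t : n.+1.-tuple RT) := (thead t, [tuple of behead t] : n.-tuple RT).
have mu : measurable_fun setT u.
  apply/measurable_fun_pairP; split.
  - exact: (measurable_tnth ord0).
  - exact: measurable_behead.
have uK p : u (tuple_cons p) = p.
  by case: p => x t; congr pair; apply/val_inj.
exists (fun k => u @^-1` (F k `*` G k)).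
  apply/esym; rewrite -subTset => t _.
  have [k _ Fk] : (\bigcup_i F i) (u t).1 by rewrite -FT.
  have [l _ Gl] : (\bigcup_i G i) (u t).2 by rewrite -GT.
  exists (maxn k l) => //; split => /=.
  - by move/subsetPset: (ndF _ _ (leq_maxl k l)); apply.
  - by move/subsetPset: (ndG _ _ (leq_maxr k l)); apply.
move=> k; have [mF Fk] := Foo k; have [mG Gk] := Goo k; split.
  by rewrite -[X in measurable X]setTI; apply: mu => //; exact: measurableX.
rewrite /tuple_lebesgueS /pushforward (_ : _ @^-1` _ = F k `*` G k).
  by rewrite product_measure1E// lte_mul_pinfty// ge0_fin_numE.
by rewrite -comp_preimage (_ : u \o @tuple_cons n = id)//; exact/funext.
Qed.

HB.instance Definition _ := Measure_isSigmaFinite.Build _ _ _ tuple_lebesgueS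
  tuple_lebesgueS_sigma_finite.

End step.

(* Lebesgue measure on R^n, as the n-fold product of Lebesgue measure on R. *)
Fixpoint tuple_lebesgue n : {sigma_finite_measure set (n.-tuple RT) -> \bar R} :=
  if n isn't k.+1 then \d_ [tuple] else tuple_lebesgueS (tuple_lebesgue k).

Lemma tuple_lebesgue_box n (A : 'I_n -> set RT) :
  (forall i, measurable (A i)) ->
  tuple_lebesgue n [set t | forall i, A i (tnth t i)] =
  (\prod_(i < n) @lebesgue_measure R (A i))%E.
Proof.
elim: n A => [|n IH] A mA.
  rewrite big_ord0 /= diracE mem_set//.
  by case.
rewrite big_ord_recl -IH//= /tuple_lebesgueS /pushforward.
rewrite -product_measure1E//.
- congr ((_ \x _)%E _); apply/seteqP; split=> -[x t] /=.
    move=> H; split=> [|i]; first exact: (H ord0).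
    by have := H (lift ord0 i); rewrite tnthS.
  move=> [Hx Ht] i; case: (unliftP ord0 i) => [j ->|->]//.
  by rewrite tnthS.
- rewrite (_ : mkset _ = \bigcap_(i in [set: 'I_n])
      ((fun t => tnth t i) @^-1` A (lift ord0 i))).
    apply: fin_bigcap_measurable => // i _.
    by rewrite -[X in measurable X]setTI; exact: measurable_tnth.
  by apply/seteqP; split=> [t H i _|t H i]; [exact: H|exact: H].
Qed.

End tuple_lebesgue.

Section matrices.
Context {R : realType}.

(* The coordinates t_(k,m), k <= m, of a real symmetric matrix are listed column
   by column: with indices counted from 0, column m of the upper triangle
   occupies the positions 'C(m + 1, 2), ..., 'C(m + 1, 2) + m. *)
Definition symmx n (t : 'C(n.+1, 2).-tuple (measurableTypeR R)) : 'M[R]_n :=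
  \matrix_(i, j) nth (0 : R) t ('C((maxn i j).+1, 2) + minn i j).

Definition posdefmx n (A : 'M[R]_n) : Prop :=
  forall x : 'cV[R]_n, x != 0 -> 0 < (x^T *m A *m x) 0 0.

(* The left upper block of size j + 1. *)
Definition lead_block (K : Type) n (A : 'M[K]_n) (j : 'I_n) : 'M[K]_j.+1 :=
  mxsub (widen_ord (ltn_ord j)) (widen_ord (ltn_ord j)) A.

(* The eigenvalues, repeated according to their algebraic multiplicity. *)
Definition eigenvals n (A : 'M[R[i]]_n) : seq R[i] :=
  sval (closed_field_poly_normal (char_poly A)).

(* det A ^ {s || t}, meant for A + A^* positive definite, where every eigenvalue
   has positive real part. *)
Definition detpow n (A : 'M[R[i]]_n) (s t : R[i]) : R[i] :=
  cexp (s * (\sum_(mu <- eigenvals A) cln mu) +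
        t * (\sum_(mu <- eigenvals A) (cln mu)^*)).

Definition one_plus n (T S : 'M[R]_n) : 'M[R[i]]_n :=
  map_mx (real_complex R) (1%:M + T) + 'i *: map_mx (real_complex R) S.

End matrices.

(* Main.v *)
Require Import Defs.
From HB Require Import structures.
From mathcomp Require Import all_boot all_order all_algebra.
From mathcomp Require Import all_classical all_reals all_analysis.
From mathcomp Require Import measurable_realfun complex ring lra.

Set Implicit Arguments.
Unset Strict Implicit.
Unset Printing Implicit Defensive.

Import Order.TTheory GRing.Theory Num.Theory.
Import numFieldNormedType.Exports.

Local Open Scope classical_set_scope.
Local Open Scope complex_scope.
Local Open Scope ring_scope.

Local Notation Re := complex.Re.
Local Notation Im := complex.Im.
Local Notation normc := Normc.normc.

(** The minors enter only through pivots. Write t_j for the ratio of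
    consecutive leading minors of T and z_j for that of Z = 1 + T + iS. Then T
    is positive definite exactly when all t_j are positive (posdef_leadP), and
    Re z_j > 0 follows (accretive_leadP). The power of det [Z]_j, defined
    through the eigenvalues, is the product of the principal powers of z_0,
    ..., z_(j-1) (detpow_lead): the sum of the logarithms of the eigenvalues
    and that of the logarithms of the pivots are logarithms of one determinant
    all along the segment from 1 to Z, so their difference is a continuous
    multiple of 2 pi i which vanishes at the start (sum_hln_segment). By Abel
    summation the integrand is the product of t_j ^ (lambda_j - n - 1) / z_j ^
    {sigma_j || tau_j} (integrand_pivots).

    The integral of such a product is computed by induction on n
    (pivot_integral). Fix the blocks P and K of T and S of size n - 1, and let
    q, r and l, m be the last column of T and S, with diagonal entries r and
    m. Put A = 1 + P, Z = A + iK and z = q + il. The last pivots are r - q^T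
    P^-1 q and 1 + r + im - z^T Z^-1 z, and the earlier ones are those of P
    and Z (last_pivots, pivot_add_columns). The integral over m is that of (1
    + ix) ^ (- s) (1 - ix) ^ (- t) up to translation and scaling (vintE), the
    integral over r is a beta integral (bker_cint), and what remains is a
    power of 1 + Q with Q = q^T (P^-1 - A^-1) q + k^T N k, where k = l - K
    A^-1 q and N = Re Z^-1 (Re_form_inv). Euler's integral turns powers of 1 +
    Q into Gaussian integrals (cint_radial, cint_gaussian), and their
    determinants combine to sqrt (det P) abs (det Z) (column_determinants),
    which is the product of the sqrt (t_j) abs (z_j). So the integrand of size
    n - 1 reappears with all exponents moved by 1/2 (pivot_product_half), and
    the factors already found keep their form.

    For vintE, a first order differential equation shows that the Fourier
    transform of (1 + ix) ^ (- s) is c (s) v ^ (s - 1) e ^ (- v) for v > 0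
    (fint_gker). By Fubini's theorem Gamma (t) I (s, t) = c (s) 2 ^ (1 - s -
    t) Gamma (s + t - 1) for the wanted integral I (s, t) (vint_fcst). Since I
    is symmetric, c (s) Gamma (s) is constant; an integration by parts extends
    the formula to Re (s + t) > 1, and I (1, 1) = pi gives the constant.
    Dividing by Gamma is justified by gint_neq0.

    Absolute convergence at each stage comes from a bound of the integral of
    the modulus, which cintb carries along with the value of the integral. *)

(** * Complex exponential, powers and logarithm *)

Section complex_exponential.
Context {R : realType}.
Implicit Types (z w a b : R[i]) (x y : R).

Lemma ReD z w : Re (z + w) = Re z + Re w. Proof. by case: z; case: w. Qed.
Lemma ImD z w : Im (z + w) = Im z + Im w. Proof. by case: z; case: w. Qed.
Lemma ReN z : Re (- z) = - Re z. Proof. by case: z. Qed.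
Lemma ImN z : Im (- z) = - Im z. Proof. by case: z. Qed.
Lemma ReB z w : Re (z - w) = Re z - Re w. Proof. by rewrite ReD ReN. Qed.
Lemma ImB z w : Im (z - w) = Im z - Im w. Proof. by rewrite ImD ImN. Qed.
Lemma ReM z w : Re (z * w) = Re z * Re w - Im z * Im w.
Proof. by case: z; case: w. Qed.
Lemma ImM z w : Im (z * w) = Re z * Im w + Im z * Re w.
Proof. by case: z; case: w. Qed.
Lemma ReV z : Re z^-1 = Re z / (Re z ^+ 2 + Im z ^+ 2). Proof. by case: z. Qed.
Lemma ImV z : Im z^-1 = - (Im z / (Re z ^+ 2 + Im z ^+ 2)). Proof. by case: z. Qed.
Lemma ReJ z : Re z^* = Re z. Proof. by case: z. Qed.
Lemma ImJ z : Im z^* = - Im z. Proof. by case: z. Qed.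
Lemma Renat (n : nat) : Re (n%:R : R[i]) = n%:R.
Proof. by rewrite -(rmorph_nat (real_complex R)). Qed.
Lemma Imnat (n : nat) : Im (n%:R : R[i]) = 0.
Proof. by rewrite -(rmorph_nat (real_complex R)). Qed.
Lemma Re1 : Re (1 : R[i]) = 1. Proof. by []. Qed.
Lemma Im1 : Im (1 : R[i]) = 0. Proof. by []. Qed.
Lemma ReC x : Re x%:C = x. Proof. by []. Qed.
Lemma ImC x : Im x%:C = 0. Proof. by []. Qed.
Lemma Rehalf : Re (2%:R^-1 : R[i]) = 2%:R^-1.
Proof. by rewrite ReV Renat Imnat expr0n addr0; field. Qed.
Lemma Imhalf : Im (2%:R^-1 : R[i]) = 0.
Proof. by rewrite ImV Imnat mul0r oppr0. Qed.

Definition ReImE := (ReD, ImD, ReN, ImN, ReM, ImM, ReJ, ImJ, ReC, ImC, Re1, Im1,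
  Renat, Imnat, Rehalf, Imhalf).

Lemma complex_eqP z w : Re z = Re w -> Im z = Im w -> z = w.
Proof. by case: z; case: w => a b c d /= -> ->. Qed.

Lemma Re_cexp z : Re (cexp z) = expR (Re z) * cos (Im z). Proof. by []. Qed.
Lemma Im_cexp z : Im (cexp z) = expR (Re z) * sin (Im z). Proof. by []. Qed.

Lemma cexpD z w : cexp (z + w) = cexp z * cexp w.
Proof.
by apply: complex_eqP; rewrite !(ReImE, Re_cexp, Im_cexp) expRD ?cosD ?sinD; ring.
Qed.

Lemma cexp0 : cexp 0 = 1 :> R[i].
Proof. by rewrite /cexp /= expR0 cos0 sin0 mulr1 mulr0. Qed.

Lemma cexp_neq0 z : cexp z != 0.
Proof.
apply/eqP => e; have : cexp z * cexp (- z) = 1 by rewrite -cexpD subrr cexp0.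
by rewrite e mul0r => /esym/eqP; rewrite oner_eq0.
Qed.

Lemma cexpN z : cexp (- z) = (cexp z)^-1.
Proof.
by apply: (mulfI (cexp_neq0 z)); rewrite -cexpD subrr cexp0 divff// cexp_neq0.
Qed.

Lemma cexp_sum (I : Type) (r : seq I) (F : I -> R[i]) :
  cexp (\sum_(i <- r) F i) = \prod_(i <- r) cexp (F i).
Proof. by apply: (big_morph cexp cexpD cexp0). Qed.

Lemma cexpMn z n : cexp (z *+ n) = cexp z ^+ n.
Proof. by elim: n => [|n IH]; rewrite ?mulr0n ?cexp0 ?expr0// mulrS exprS cexpD IH. Qed.

Lemma normc_cexp z : normc (cexp z) = expR (Re z).
Proof.
by rewrite /cexp /= !exprMn -mulrDr cos2Dsin2 mulr1 sqrtr_sqr ger0_norm// expR_ge0.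
Qed.

Lemma cexp_real x : cexp x%:C = (expR x)%:C.
Proof. by rewrite /cexp /= cos0 sin0 mulr1 mulr0. Qed.

Lemma normc_ge0 z : 0 <= normc z. Proof. by case: z => a b; exact: sqrtr_ge0. Qed.
Lemma normc_gt0 z : z != 0 -> 0 < normc z.
Proof.
move=> z0; rewrite lt_neqAle normc_ge0 andbT; apply: contra z0 => /eqP/esym.
by move/Normc.eq0_normc ->.
Qed.
Lemma normcC x : normc x%:C = `|x|.
Proof. by rewrite /= expr0n addr0 sqrtr_sqr. Qed.
Lemma normRe z : `|Re z| <= normc z.
Proof.
by case: z => a b /=; rewrite -sqrtr_sqr ler_sqrt ?addr_ge0 ?sqr_ge0// lerDl sqr_ge0.
Qed.
Lemma normIm z : `|Im z| <= normc z.
Proof.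
by case: z => a b /=; rewrite -sqrtr_sqr ler_sqrt ?addr_ge0 ?sqr_ge0// lerDr sqr_ge0.
Qed.
Lemma normc_le z : normc z <= `|Re z| + `|Im z|.
Proof.
case: z => a b; have -> : a +i* b = a%:C + 'i * b%:C by apply: complex_eqP; simpc.
apply: (le_trans (le_normcD _ _)); rewrite Normc.normcM !normcC; simpc => /=.
by rewrite expr0n/= expr1n add0r sqrtr1 mul1r.
Qed.
Lemma sqr_normcE z : normc z ^+ 2 = Re z ^+ 2 + Im z ^+ 2.
Proof. by case: z => a b /=; rewrite sqr_sqrtr ?addr_ge0 ?sqr_ge0. Qed.
Lemma normcJE z : normc z^* = normc z.
Proof. by case: z => a b /=; rewrite sqrrN. Qed.
Lemma real_complexM x y : x%:C * y%:C = (x * y)%:C :> R[i].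
Proof. by rewrite rmorphM. Qed.
Lemma conjCr x : (x%:C)^* = x%:C.
Proof. by apply: complex_eqP; rewrite !ReImE ?oppr0. Qed.
Lemma mulJc z : z * z^* = (normc z ^+ 2)%:C.
Proof. by apply: complex_eqP; rewrite sqr_normcE !ReImE; ring. Qed.

Lemma rpowcD x a b : rpowc x (a + b) = rpowc x a * rpowc x b.
Proof. by rewrite /rpowc mulrDl cexpD. Qed.
Lemma rpowcN x a : rpowc x (- a) = (rpowc x a)^-1.
Proof. by rewrite /rpowc mulNr cexpN. Qed.

Lemma rpowc_neq0 x a : rpowc x a != 0. Proof. exact: cexp_neq0. Qed.
Lemma rpowc1 x : 0 < x -> rpowc x 1 = x%:C.
Proof. by move=> x0; rewrite /rpowc mul1r cexp_real lnK. Qed.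
Lemma rpow1c a : rpowc (1 : R) a = 1. Proof. by rewrite /rpowc ln1 mulr0 cexp0. Qed.
Lemma rpowcMn x a n : rpowc x (a *+ n) = rpowc x a ^+ n.
Proof. by rewrite /rpowc mulrnAl cexpMn. Qed.
Lemma rpowcn x n : 0 < x -> rpowc x n%:R = (x ^+ n)%:C.
Proof. by move=> x0; rewrite rpowcMn rpowc1// rmorphXn. Qed.
Lemma rpowcM x y a : 0 < x -> 0 < y -> rpowc (x * y) a = rpowc x a * rpowc y a.
Proof. by move=> x0 y0; rewrite /rpowc lnM// rmorphD/= mulrDr cexpD. Qed.
Lemma rpowcV x a : 0 < x -> rpowc x^-1 a = (rpowc x a)^-1.
Proof. by move=> x0; rewrite /rpowc lnV// rmorphN/= mulrN cexpN. Qed.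
Lemma normc_rpowc x a : 0 < x -> normc (rpowc x a) = x `^ Re a.
Proof.
move=> x0; rewrite normc_cexp !ReImE mulr0 subr0 /powR gt_eqF//.
Qed.
Lemma rpowc_real x y : 0 < x -> rpowc x y%:C = (x `^ y)%:C.
Proof.
by move=> x0; rewrite /rpowc -rmorphM/= cexp_real /powR gt_eqF.
Qed.
Lemma rpowc_half x : 0 < x -> rpowc x 2%:R^-1 = (Num.sqrt x)%:C.
Proof.
move=> x0; rewrite (_ : 2%:R^-1 = (2%:R^-1)%:C); last first.
  by apply: complex_eqP; rewrite !ReImE.
by rewrite rpowc_real// powR12_sqrt// ltW.
Qed.

(** The principal logarithm on the right half plane; unlike the formula with
    acos it is visibly measurable and continuous. *)
Definition hln z : R[i] := ln (normc z) +i* atan (Im z / Re z).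

Lemma Re_hln z : Re (hln z) = ln (normc z). Proof. by []. Qed.
Lemma Im_hln z : Im (hln z) = atan (Im z / Re z). Proof. by []. Qed.

Lemma normc_cos_atan z : 0 < Re z -> normc z * cos (atan (Im z / Re z)) = Re z.
Proof.
case: z => a b /= a0; rewrite cos_atan.
have -> : 1 + (b / a) ^+ 2 = (a ^+ 2 + b ^+ 2) / a ^+ 2 by field; lra.
have h : 0 < a ^+ 2 + b ^+ 2 by rewrite ltr_pwDl ?sqr_ge0// exprn_gt0.
rewrite sqrtrM ?ltW// sqrtrV ?sqr_ge0// sqrtr_sqr gtr0_norm//.
have : Num.sqrt (a ^+ 2 + b ^+ 2) != 0 by rewrite gt_eqF// sqrtr_gt0.
by move=> h2; field; rewrite h2 lt0r_neq0.
Qed.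

Lemma normc_sin_atan z : 0 < Re z -> normc z * sin (atan (Im z / Re z)) = Im z.
Proof.
move=> z0; have c := normc_cos_atan z0.
have cn : cos (atan (Im z / Re z)) != 0.
  by apply/eqP => e; move: c; rewrite e mulr0 => c; rewrite -c ltxx in z0.
have := atanK (Im z / Re z); rewrite /tan => /(canRL (mulfVK cn)) ->.
by rewrite mulrCA c divfK// gt_eqF.
Qed.

Lemma Re_gt0_neq0 z : 0 < Re z -> z != 0.
Proof. by move=> h; apply: contraTneq h => ->; rewrite ltxx. Qed.

Lemma carg_hln z : 0 < Re z -> carg z = atan (Im z / Re z).
Proof.
move=> z0; rewrite /carg; have nz := normc_gt0 (Re_gt0_neq0 z0).
have e : Re z / normc z = cos (atan (Im z / Re z)).
  by rewrite -{1}(normc_cos_atan z0) mulrAC divff ?mul1r// gt_eqF.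
have lb := atan_gtNpi2 (Im z / Re z); have ub := atan_ltpi2 (Im z / Re z).
have p0 := pi_gt0 R.
rewrite e; case: ifPn => hi.
  rewrite cosK// in_itv/=.
  have h : 0 <= atan (Im z / Re z) by rewrite -atan0 le_atan// divr_ge0// ltW.
  by rewrite h; lra.
have h : atan (Im z / Re z) <= 0.
  by rewrite -atan0 le_atan// mulr_le0_ge0 ?invr_ge0 ?ltW// ltNge.
rewrite cosKN ?opprK//; apply/andP; split; lra.
Qed.

Lemma cln_hln z : 0 < Re z -> cln z = hln z.
Proof. by move=> z0; rewrite /cln carg_hln. Qed.

Lemma cexp_hln z : 0 < Re z -> cexp (hln z) = z.
Proof.
move=> z0; rewrite /cexp /= lnK; last by rewrite posrE normc_gt0// Re_gt0_neq0.
by rewrite normc_cos_atan// normc_sin_atan//; case: (z).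
Qed.

Lemma hln_real x : 0 < x -> hln x%:C = (ln x)%:C.
Proof.
by move=> x0; rewrite /hln normcC gtr0_norm//= mul0r atan0.
Qed.

Lemma hlnMr x z : 0 < x -> 0 < Re z -> hln (x%:C * z) = (ln x)%:C + hln z.
Proof.
move=> x0 z0; apply: complex_eqP; rewrite !(ReImE, Re_hln, Im_hln).
  by rewrite Normc.normcM normcC gtr0_norm// lnM// posrE normc_gt0// Re_gt0_neq0.
by rewrite !mul0r subr0 addr0 add0r; congr atan; field; rewrite !gt_eqF.
Qed.

Lemma hlnJ z : hln z^* = (hln z)^*.
Proof. by apply: complex_eqP; rewrite !ReImE /hln /= ?normcJE// !ReImE mulNr atanN. Qed.

(** z ^ {a || b} for z in the right half plane. *)
Definition hpow z a b : R[i] := cexp (a * hln z + b * (hln z)^*).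

Lemma hpowD z a b a' b' : hpow z (a + a') (b + b') = hpow z a b * hpow z a' b'.
Proof. by rewrite /hpow -cexpD; congr cexp; ring. Qed.
Lemma hpowN z a b : hpow z (- a) (- b) = (hpow z a b)^-1.
Proof. by rewrite /hpow -cexpN; congr cexp; ring. Qed.
Lemma hpow_real x a b : 0 < x -> hpow x%:C a b = rpowc x (a + b).
Proof. by move=> x0; rewrite /hpow hln_real// conjCr -mulrDl. Qed.
Lemma hpowMr x z a b : 0 < x -> 0 < Re z ->
  hpow (x%:C * z) a b = rpowc x (a + b) * hpow z a b.
Proof.
move=> x0 z0; rewrite /hpow hlnMr// /rpowc -cexpD; congr cexp.
by rewrite rmorphD/= conjCr; ring.
Qed.
Lemma hpow10 z : 0 < Re z -> hpow z 1 0 = z.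
Proof. by move=> z0; rewrite /hpow mul1r mul0r addr0 cexp_hln. Qed.

Lemma hpow_half z : 0 < Re z -> hpow z 2%:R^-1 2%:R^-1 = (normc z)%:C.
Proof.
move=> z0; rewrite /hpow -mulrDr -[RHS]rpowc1 ?normc_gt0 ?Re_gt0_neq0// /rpowc mul1r.
by congr cexp; apply: complex_eqP; rewrite !(ReImE, Re_hln, Im_hln); field.
Qed.
Lemma hpowJ z a b : hpow z^* a b = hpow z b a.
Proof. by rewrite /hpow hlnJ conjCK addrC. Qed.

Lemma normc_hpow_le z a b : 0 < Re z ->
  normc (hpow z a b) <= expR (pi * `|Im a - Im b|) * normc z `^ Re (a + b).
Proof.
move=> z0; have nz := normc_gt0 (Re_gt0_neq0 z0).
rewrite normc_cexp /powR gt_eqF// -expRD ler_expR !ReImE /=.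
set t := atan _; set L := ln _.
have lb := atan_gtNpi2 (Im z / Re z); have ub := atan_ltpi2 (Im z / Re z).
have p0 := pi_gt0 R.
have -> : Re a * L - Im a * t + (Re b * L - Im b * - t) =
          (Im b - Im a) * t + (Re a + Re b) * L by ring.
rewrite lerD2r; apply: (le_trans (ler_norm _)); rewrite normrM mulrC distrC.
apply: ler_pM => //; rewrite -/t in lb ub; rewrite ler_norml; apply/andP; split; lra.
Qed.

End complex_exponential.

(** * Limits of complex functions *)

Section complex_limits.
Context {R : realType} {T : Type} (F : set_system T) {FF : Filter F}.
Implicit Types (f g : T -> R[i]) (z w : R[i]).

(** Convergence of the components, so that no topology on R[i] is involved. *)
Definition ccvg f z := (Re (f x) @[x --> F] --> Re z) /\ (Im (f x) @[x --> F] --> Im z).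

Lemma ccvg_cst z : ccvg (fun=> z) z. Proof. by split; exact: cvg_cst. Qed.

Lemma eq_ccvg f g z : (forall x, f x = g x) -> ccvg g z -> ccvg f z.
Proof. by move=> /funext ->. Qed.

Lemma ccvgD f g z w : ccvg f z -> ccvg g w -> ccvg (fun x => f x + g x) (z + w).
Proof.
move=> [? ?] [? ?]; split; rewrite ReImE; under eq_fun do rewrite ReImE; exact: cvgD.
Qed.

Lemma ccvgN f z : ccvg f z -> ccvg (fun x => - f x) (- z).
Proof.
move=> [? ?]; split; rewrite ReImE; under eq_fun do rewrite ReImE; exact: cvgN.
Qed.

Lemma ccvgB f g z w : ccvg f z -> ccvg g w -> ccvg (fun x => f x - g x) (z - w).
Proof. by move=> ? ?; apply: ccvgD => //; exact: ccvgN. Qed.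

Lemma ccvgM f g z w : ccvg f z -> ccvg g w -> ccvg (fun x => f x * g x) (z * w).
Proof.
move=> [? ?] [? ?]; split; rewrite ReImE; under eq_fun do rewrite ReImE.
  by apply: cvgB; exact: cvgM.
by apply: cvgD; exact: cvgM.
Qed.

Lemma ccvgC (f : T -> R) (x : R) : f @ F --> x -> ccvg (fun y => (f y)%:C) x%:C.
Proof. by move=> fx; split => //; exact: cvg_cst. Qed.

Lemma ccvgV f z : z != 0 -> ccvg f z -> ccvg (fun x => (f x)^-1) z^-1.
Proof.
move=> z0 [fr fi]; have n0 : Re z ^+ 2 + Im z ^+ 2 != 0.
  by rewrite -sqr_normcE sqrf_eq0 gt_eqF// normc_gt0.
have fn : Re (f x) ^+ 2 + Im (f x) ^+ 2 @[x --> F] --> Re z ^+ 2 + Im z ^+ 2.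
  by apply: cvgD; rewrite !expr2; under eq_fun do rewrite expr2; exact: cvgM.
have nV : (Re (f x) ^+ 2 + Im (f x) ^+ 2)^-1 @[x --> F] --> (Re z ^+ 2 + Im z ^+ 2)^-1.
  by apply: cvgV.
split.
  by rewrite ReV; under eq_fun do rewrite ReV; exact: cvgM.
by rewrite ImV; under eq_fun do rewrite ImV; apply: cvgN; exact: cvgM.
Qed.

Lemma ccvg_prod (I : Type) (r : seq I) (h : I -> T -> R[i]) (l : I -> R[i]) :
  (forall i, ccvg (h i) (l i)) ->
  ccvg (fun x => \prod_(i <- r) h i x) (\prod_(i <- r) l i).
Proof.
move=> H; elim: r => [|i r IH].
  by rewrite big_nil; apply: eq_ccvg (ccvg_cst _) => x; rewrite big_nil.
by rewrite big_cons; apply: eq_ccvg (ccvgM (H i) IH) => x; rewrite big_cons.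
Qed.

Lemma ccvg_normc f z : ccvg f z -> normc (f x) @[x --> F] --> normc z.
Proof.
move=> [fr fi].
have nE y : normc y = Num.sqrt (Re y ^+ 2 + Im y ^+ 2) by case: y.
rewrite nE; under eq_fun do rewrite nE.
have fn : Re (f x) ^+ 2 + Im (f x) ^+ 2 @[x --> F] --> Re z ^+ 2 + Im z ^+ 2.
  by apply: cvgD; rewrite !expr2; under eq_fun do rewrite expr2; exact: cvgM.
by apply: continuous_cvg => //; exact: sqrt_continuous.
Qed.

Lemma ccvg_normc0 f : normc (f x) @[x --> F] --> (0 : R) -> ccvg f 0.
Proof.
move=> H; split; apply/norm_cvg0P;
  apply: (@squeeze_cvgr _ _ _ _ (fun=> 0) (fun x => normc (f x))) => //;
  by [exact: cvg_cst | apply: nearW => x; rewrite normr_ge0 ?normRe ?normIm].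
Qed.

Lemma ccvg_cexp f z : ccvg f z -> ccvg (fun x => cexp (f x)) (cexp z).
Proof.
move=> [fr fi]; split; rewrite ?Re_cexp ?Im_cexp; under eq_fun do rewrite ?Re_cexp ?Im_cexp.
  apply: cvgM; first by apply: continuous_cvg => //; exact: continuous_expR.
  by apply: continuous_cvg => //; exact: continuous_cos.
apply: cvgM; first by apply: continuous_cvg => //; exact: continuous_expR.
by apply: continuous_cvg => //; exact: continuous_sin.
Qed.

Lemma ccvg_hln f z : 0 < Re z -> ccvg f z -> ccvg (fun x => hln (f x)) (hln z).
Proof.
move=> z0 fz; have fn := ccvg_normc fz; move: fz => [fr fi]; split.
  rewrite Re_hln; under eq_fun do rewrite Re_hln.
  by apply: continuous_cvg => //; apply: continuous_ln; rewrite normc_gt0// Re_gt0_neq0.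
rewrite Im_hln; under eq_fun do rewrite Im_hln.
have h : Im (f x) / Re (f x) @[x --> F] --> Im z / Re z.
  by apply: cvgM => //; apply: cvgV => //; rewrite gt_eqF.
by apply: continuous_cvg => //; exact: continuous_atan.
Qed.

End complex_limits.

(** * Pivots and positive definite matrices *)

Section schur.
Context {K : fieldType}.

Lemma block_mx_lu n1 n2 (A : 'M[K]_n1) (B : 'M[K]_(n1, n2))
    (C : 'M[K]_(n2, n1)) (D : 'M[K]_n2) : A \in unitmx ->
  block_mx A B C D = block_mx A 0 C 1%:M *m
    block_mx 1%:M (invmx A *m B) 0 (D - C *m invmx A *m B).
Proof.
move=> uA; rewrite mulmx_block !mulmx1 !mulmx0 !mul0mx !mul1mx !addr0.
by rewrite mulKVmx// mulmxA addrC subrK.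
Qed.

Lemma det_schur n1 n2 (A : 'M[K]_n1) (B : 'M[K]_(n1, n2))
    (C : 'M[K]_(n2, n1)) (D : 'M[K]_n2) : A \in unitmx ->
  \det (block_mx A B C D) = \det A * \det (D - C *m invmx A *m B).
Proof.
by move=> uA; rewrite block_mx_lu// det_mulmx det_lblock det_ublock !det1 mulr1 mul1r.
Qed.

(** Blocks of one infinite matrix, so that nested blocks belong to one object. *)
Definition lead (f : nat -> nat -> K) k : 'M[K]_k := \matrix_(i, j) f i j.

Definition leadcol (f : nat -> nat -> K) k : 'cV[K]_k := \col_i f i k.

Lemma lead_block_mx (f : nat -> nat -> K) k :
  (forall i j, f i j = f j i) ->
  lead f (k + 1) = block_mx (lead f k) (leadcol f k) (leadcol f k)^T (f k k)%:M.
Proof.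
move=> fC; apply/matrixP => i j.
case: (split_ordP i) => i' ->; case: (split_ordP j) => j' ->.
- by rewrite block_mxEul !mxE.
- by rewrite block_mxEur !mxE /= (ord1 j') addn0.
- by rewrite block_mxEdl !mxE /= (ord1 i') addn0 fC.
- by rewrite block_mxEdr !mxE /= (ord1 i') (ord1 j') addn0 eqxx mulr1n.
Qed.

(** The last pivot of Gaussian elimination on a block of size k + 1. *)
Definition pivot (f : nat -> nat -> K) k := \det (lead f k.+1) / \det (lead f k).

(** The pivot is the Schur complement of the last diagonal entry. *)
Lemma pivotE (f : nat -> nat -> K) k : (forall i j, f i j = f j i) ->
  lead f k \in unitmx ->
  pivot f k = f k k - ((leadcol f k)^T *m invmx (lead f k) *m leadcol f k) 0 0.
Proof.
move=> fC u; rewrite /pivot -addn1 lead_block_mx// det_schur// mulrC mulKf; last first.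
  by move: u; rewrite unitmxE unitfE.
by rewrite det_mx11 !mxE mulr1n.
Qed.

Lemma det_lead0 (f : nat -> nat -> K) : \det (lead f 0) = 1.
Proof. exact: det_mx00. Qed.

Lemma prod_pivot (f : nat -> nat -> K) k :
  (forall j, (j < k)%N -> \det (lead f j) != 0) ->
  \prod_(j < k) pivot f j = \det (lead f k).
Proof.
elim: k => [|k IH] H; first by rewrite big_ord0 det_lead0.
rewrite big_ord_recr /= IH; last by move=> j jk; apply: H; exact: ltnW.
by rewrite /pivot mulrC divfK// H.
Qed.

Lemma lead_blockE (f : nat -> nat -> K) n (j : 'I_n) :
  lead_block (lead f n) j = lead f j.+1.
Proof. by apply/matrixP => a b; rewrite !mxE. Qed.

End schur.

Section positive_definite.
Context {R : realType}.

Definition qform n (A : 'M[R]_n) (x : 'cV[R]_n) : R := (x^T *m A *m x) 0 0.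

Lemma qform0 n (A : 'M[R]_n) : qform A 0 = 0.
Proof. by rewrite /qform mulmx0 mxE. Qed.

Lemma posdef_ge0 n (A : 'M[R]_n) x : posdefmx A -> 0 <= qform A x.
Proof.
move=> pA; have [->|x0] := eqVneq x 0; first by rewrite qform0.
by apply/ltW/pA.
Qed.

Lemma posdef_unit n (A : 'M[R]_n) : posdefmx A -> A \in unitmx.
Proof.
move=> pA; rewrite unitmxE unitfE; apply/negP => /det0P[v v0 vA].
by have := pA v^T; rewrite trmxK vA mul0mx mxE ltxx trmx_eq0 => /(_ v0).
Qed.

(** Completing the square in the first block of variables. *)
Lemma qform_block n1 n2 (A : 'M[R]_n1) (B : 'M[R]_(n1, n2)) (D : 'M[R]_n2) x y :
  A^T = A -> A \in unitmx ->
  qform (block_mx A B B^T D) (col_mx x y) =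
  qform A (x + invmx A *m B *m y) + qform (D - B^T *m invmx A *m B) y.
Proof.
move=> sA uA; have sAi : (invmx A)^T = invmx A by rewrite trmx_inv sA.
rewrite /qform tr_col_mx mul_row_block mul_row_col !mulmxDl.
set w := invmx A *m B *m y.
have e1 : w^T *m A = y^T *m B^T by rewrite /w !trmx_mul sAi mulmxA mulmxKV.
have e2 : x^T *m B *m y = x^T *m A *m w by rewrite /w -!mulmxA mulKVmx.
rewrite e2 mulmxBr mulmxBl -!(mulmxA _ _ y) -/w [(x + w)^T]linearD /= !mulmxDl !mulmxDr.
rewrite !mulmxA e1 (_ : y^T *m B^T *m invmx A *m B *m y = y^T *m B^T *m w); last first.
  by rewrite /w !mulmxA.
have mE (u v : 'M[R]_1) : (u + v) 0 0 = u 0 0 + v 0 0 by rewrite mxE.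
have mN (u : 'M[R]_1) : (- u) 0 0 = - u 0 0 by rewrite !mxE.
by rewrite !mE mN; ring.
Qed.

Lemma posdef_block n1 n2 (A : 'M[R]_n1) (B : 'M[R]_(n1, n2)) (D : 'M[R]_n2) :
  A^T = A ->
  posdefmx (block_mx A B B^T D) <->
  posdefmx A /\ posdefmx (D - B^T *m invmx A *m B).
Proof.
move=> sA; split=> [pM|[pA pS]].
  have pA : posdefmx A.
    move=> x x0; have := pM (col_mx x 0).
    rewrite col_mx_eq0 negb_and x0 /= tr_col_mx mul_row_block mul_row_col.
    by rewrite trmx0 !mul0mx !addr0 mulmx0 addr0; exact.
  split=> // y y0; have := pM (col_mx (- (invmx A *m B *m y)) y).
  rewrite col_mx_eq0 negb_and y0 orbT => /(_ isT).
  by rewrite -/(qform _ _) qform_block ?posdef_unit// addNr qform0 add0r.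
move=> x; rewrite -[x]vsubmxK => x0; rewrite -/(qform _ _) qform_block ?posdef_unit//.
have [y0|y0] := eqVneq (dsubmx x) 0.
  rewrite y0 mulmx0 addr0 qform0 addr0; apply: pA.
  by move: x0; rewrite y0 col_mx_eq0 eqxx andbT.
by apply: ltr_wpDl; [exact: posdef_ge0|exact: pS].
Qed.

Lemma posdef11 (x : R) : posdefmx (x%:M : 'M[R]_1) <-> 0 < x.
Proof.
split=> [|x0] => [/(_ 1%:M)|v v0].
  by rewrite trmx1 mul1mx mulmx1 mxE mulr1n; apply; rewrite oner_eq0.
rewrite mul_mx_scalar -scalemxAl mxE pmulr_rgt0// mxE big_ord1 mxE -expr2.
rewrite exprn_even_gt0//=; apply: contra v0 => /eqP e; apply/eqP/matrixP => i j.
by rewrite !ord1 e mxE.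
Qed.

Lemma tr_lead (f : nat -> nat -> R) k : (forall i j, f i j = f j i) ->
  (lead f k)^T = lead f k.
Proof. by move=> fC; apply/matrixP => i j; rewrite !mxE. Qed.

Lemma posdef_leadS (f : nat -> nat -> R) k : (forall i j, f i j = f j i) ->
  posdefmx (lead f k.+1) <-> posdefmx (lead f k) /\ 0 < pivot f k.
Proof.
move=> fC; rewrite -addn1 lead_block_mx// posdef_block ?tr_lead//.
by split=> -[pA pS]; split => //; move: pS; rewrite pivotE ?posdef_unit//;
  rewrite [_ - _ *m _ *m _ : 'M[R]_1]mx11_scalar posdef11 !mxE eqxx mulr1n.
Qed.

(** Sylvester's criterion. *)
Lemma posdef_leadP (f : nat -> nat -> R) k : (forall i j, f i j = f j i) ->
  posdefmx (lead f k) <-> (forall j : 'I_k, 0 < pivot f j).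
Proof.
move=> fC; elim: k => [|k IH].
  by split=> [_ []//|_ x]; rewrite flatmx0 eqxx.
rewrite posdef_leadS// IH; split=> [[H1 H2] j|H].
  by case: (unliftP ord_max j) => [i ->|->//]; rewrite lift_max.
by split=> [j|]; [have := H (lift ord_max j); rewrite lift_max|exact: (H ord_max)].
Qed.

Lemma posdef_inv n (A : 'M[R]_n) : A^T = A -> posdefmx A -> posdefmx (invmx A).
Proof.
move=> sA pA x x0; have uA := posdef_unit pA.
have sAi : (invmx A)^T = invmx A by rewrite trmx_inv sA.
have := pA (invmx A *m x); rewrite trmx_mul sAi mulmxKV// mulmxA.
by apply; apply: contra x0 => /eqP e; rewrite -[x](mulKVmx uA) e mulmx0.
Qed.

Lemma posdef_add1 n (P : 'M[R]_n) : posdefmx P -> posdefmx (1%:M + P).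
Proof.
move=> pP x x0; rewrite mulmxDr mulmxDl mxE mulmx1 addr_gt0 ?pP//.
rewrite mxE; under eq_bigr do rewrite mxE -expr2.
have [i xi] : exists i, x i 0 != 0.
  apply/existsP; apply: contraR x0; rewrite negb_exists => /forallP H.
  by apply/eqP/matrixP => i j; rewrite !ord1 mxE; apply/eqP; rewrite -[_ == _]negbK.
rewrite (bigD1 i)//= ltr_pwDl//; first by rewrite exprn_even_gt0.
by apply: sumr_ge0 => j _; exact: sqr_ge0.
Qed.

(** P^-1 - (1 + P)^-1, evaluated at (1 + P) y, is the form P^-1 + 1 at y. *)
Lemma posdef_inv_sub n (P : 'M[R]_n) : P^T = P -> posdefmx P ->
  posdefmx (invmx P - invmx (1%:M + P)).
Proof.
move=> sP pP; have pA := posdef_add1 pP; have uA := posdef_unit pA.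
have uP := posdef_unit pP.
set A := 1%:M + P in pA uA *; have sA : A^T = A by rewrite /A linearD /= trmx1 sP.
move=> x x0; pose y := invmx A *m x; have xE : x = A *m y by rewrite mulKVmx.
have y0 : y != 0 by apply: contra x0 => /eqP e; rewrite xE e mulmx0.
have -> : x^T *m (invmx P - invmx A) *m x =
          y^T *m A *m invmx P *m A *m y - y^T *m A *m y.
  by rewrite xE trmx_mul sA mulmxBr mulmxBl (mulmxK uA) !mulmxA.
have -> : y^T *m A *m invmx P *m A *m y - y^T *m A *m y =
          y^T *m (1%:M + invmx P) *m y.
  rewrite -mulmxBl -[in X in (_ - X) *m _](mulmxKV uP (y^T *m A)) -mulmxBr.
  rewrite (_ : A - P = 1%:M) ?addrK// mulmx1 -mulmxA; congr (_ *m _ *m _).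
  by rewrite /A mulmxDl mul1mx mulmxV// addrC.
by apply: posdef_add1 => //; exact: posdef_inv.
Qed.

(** With A = 1 + P one has P (P^-1 - A^-1) A = A - P = 1. *)
Lemma det_inv_sub n (P : 'M[R]_n) : P^T = P -> posdefmx P ->
  \det (invmx P - invmx (1%:M + P)) = (\det P * \det (1%:M + P))^-1.
Proof.
move=> sP pP; have pA := posdef_add1 pP; have uA := posdef_unit pA.
have uP := posdef_unit pP; set A := 1%:M + P in pA uA *.
have : P *m (invmx P - invmx A) *m A = 1%:M.
  by rewrite mulmxBr mulmxBl mulmxV// mul1mx mulmxKV// addrK.
move/(congr1 determinant); rewrite !det_mulmx det1 => H.
have h : \det P * \det A != 0 by rewrite mulf_neq0// -unitfE -unitmxE.
by apply: (mulfI h); rewrite divff// -H mulrAC.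
Qed.

Lemma posdef_det_gt0 n (A : 'M[R]_n) : A^T = A -> posdefmx A -> 0 < \det A.
Proof.
elim: n A => [|n IH] A sA pA; first by rewrite det_mx00.
rewrite -[n.+1]/(1 + n)%N in A sA pA *.
move: sA pA; rewrite -[A]submxK; set a := ulsubmx A; set b := ursubmx A.
set c := dlsubmx A; set d := drsubmx A => sA.
have [_ bc cb dd] : [/\ a^T = a, c^T = b, b^T = c & d^T = d].
  by apply: eq_block_mx; rewrite -tr_block_mx.
rewrite -cb => /posdef_block[|pa ps].
  by apply/matrixP => i j; rewrite !mxE !ord1.
rewrite det_schur ?posdef_unit// mulr_gt0//; last first.
  apply: IH => //; rewrite linearB /= dd !trmx_mul trmxK trmx_inv mulmxA.
  by congr (_ - _ *m invmx _ *m _); apply/matrixP => i j; rewrite !mxE !ord1.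
by rewrite [a]mx11_scalar in pa *; rewrite det_scalar expr1; exact/posdef11.
Qed.

End positive_definite.

(** * Accretive matrices *)

Section accretive.
Context {R : realType}.
Implicit Types (n : nat).

Definition conjmx m n (A : 'M[R[i]]_(m, n)) := map_mx (fun z => z^*) A.

(** Z + Z^* is positive definite; row vectors are used as the left kernel and
    left eigenvectors of Z are made of them. *)
Definition accretive n (Z : 'M[R[i]]_n) : Prop :=
  forall v : 'rV[R[i]]_n, v != 0 -> 0 < Re ((v *m Z *m (conjmx v)^T) 0 0).

Lemma accretive_det_neq0 n (Z : 'M[R[i]]_n) : accretive Z -> \det Z != 0.
Proof.
move=> aZ; apply/negP => /det0P[v v0 vZ].
by have := aZ v v0; rewrite vZ mul0mx mxE ltxx.
Qed.

Lemma accretive_unit n (Z : 'M[R[i]]_n) : accretive Z -> Z \in unitmx.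
Proof. by move=> aZ; rewrite unitmxE unitfE accretive_det_neq0. Qed.

Lemma rowJ_gt0 n (v : 'rV[R[i]]_n) : v != 0 ->
  exists2 x : R, 0 < x & (v *m (conjmx v)^T) 0 0 = x%:C.
Proof.
move=> v0; exists (\sum_j normc (v 0 j) ^+ 2); last first.
  by rewrite mxE rmorph_sum; apply: eq_bigr => j _; rewrite !mxE mulJc.
have [j vj] : exists j, v 0 j != 0.
  apply/existsP; apply: contraR v0; rewrite negb_exists => /forallP H.
  by apply/eqP/matrixP => i j; rewrite !ord1 mxE; apply/eqP; rewrite -[_ == _]negbK.
rewrite (bigD1 j)//= ltr_pwDl//; first by rewrite exprn_gt0// normc_gt0.
by apply: sumr_ge0 => k _; exact: sqr_ge0.
Qed.

(** An eigenvalue times a squared norm is a value of the form. *)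
Lemma accretive_eigen n (Z : 'M[R[i]]_n) mu :
  accretive Z -> root (char_poly Z) mu -> 0 < Re mu.
Proof.
move=> aZ; rewrite -eigenvalue_root_char => /eigenvalueP[v vZ v0].
have := aZ v v0; have [x x0 xE] := rowJ_gt0 v0.
by rewrite vZ -scalemxAl mxE xE !ReImE mulr0 subr0 pmulr_lgt0.
Qed.

(** The two terms of the form are nonnegative, and one of them is positive. *)
Lemma accretive_segment n (Z : 'M[R[i]]_n) (u : R) : 0 <= u <= 1 ->
  accretive Z -> accretive ((1 - u)%:C%:M + u%:C *: Z).
Proof.
move=> /andP[u0 u1] aZ v v0; have [x x0 xE] := rowJ_gt0 v0.
have -> : (v *m ((1 - u)%:C%:M + u%:C *: Z) *m (conjmx v)^T) 0 0 =
    (1 - u)%:C * x%:C + u%:C * (v *m Z *m (conjmx v)^T) 0 0.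
  by rewrite mulmxDr mulmxDl mul_mx_scalar -scalemxAr -!scalemxAl -xE !mxE.
rewrite !ReImE !mul0r !subr0; have h := aZ v v0.
have [->|u0'] := eqVneq u 0; first by rewrite subr0 mul1r mul0r addr0.
by rewrite ltr_wpDl ?mulr_ge0 ?subr_ge0 ?(ltW x0)// mulr_gt0// lt_neqAle eq_sym u0'.
Qed.

Lemma Re_sum (I : Type) (r : seq I) (F : I -> R[i]) :
  Re (\sum_(i <- r) F i) = \sum_(i <- r) Re (F i).
Proof. by apply: (big_morph _ (@ReD R)). Qed.

Lemma Im_sum (I : Type) (r : seq I) (F : I -> R[i]) :
  Im (\sum_(i <- r) F i) = \sum_(i <- r) Im (F i).
Proof. by apply: (big_morph _ (@ImD R)). Qed.

Definition cplx_mx m n (A K : 'M[R]_(m, n)) : 'M[R[i]]_(m, n) :=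
  map_mx (real_complex R) A + 'i *: map_mx (real_complex R) K.

Lemma cplx_mxE m n (A K : 'M[R]_(m, n)) i j : cplx_mx A K i j = A i j +i* K i j.
Proof. by rewrite !mxE; simpc. Qed.

Lemma Re_cplx_mx m n (A K : 'M[R]_(m, n)) i j : Re (cplx_mx A K i j) = A i j.
Proof. by rewrite cplx_mxE. Qed.

Lemma Im_cplx_mx m n (A K : 'M[R]_(m, n)) i j : Im (cplx_mx A K i j) = K i j.
Proof. by rewrite cplx_mxE. Qed.

(** The antisymmetric part K (a, b) - K (b, a) of the real part vanishes. *)
Lemma accretive_cplx n (A K : 'M[R]_n) : A^T = A -> K^T = K ->
  posdefmx A -> accretive (cplx_mx A K).
Proof.
move=> sA sK pA v v0.
pose a := map_mx (@complex.Re R) v; pose b := map_mx (@complex.Im R) v.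
have -> : Re ((v *m cplx_mx A K *m (conjmx v)^T) 0 0) =
    (a *m A *m a^T) 0 0 + (b *m A *m b^T) 0 0 +
    ((a *m K *m b^T) 0 0 - (b *m K *m a^T) 0 0).
  rewrite !mxE Re_sum -sumrB -!big_split /=; apply: eq_bigr => j _.
  rewrite !mxE !ReImE Re_sum Im_sum !mulr_suml -sumrB.
  rewrite -[_ - _ in RHS]sumrB -!big_split /=.
  by apply: eq_bigr => i _; rewrite !(ReImE, Re_cplx_mx, Im_cplx_mx) !mxE; ring.
have -> : (b *m K *m a^T) 0 0 = (a *m K *m b^T) 0 0.
  by rewrite -[in LHS](trmxK (b *m K *m a^T)) mxE !trmx_mul trmxK sK mulmxA.
rewrite subrr addr0.
have qa (x : 'rV[R]_n) : x != 0 -> 0 < (x *m A *m x^T) 0 0.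
  by move=> x0; have := pA x^T; rewrite trmxK trmx_eq0; apply.
have qa0 (x : 'rV[R]_n) : 0 <= (x *m A *m x^T) 0 0.
  by have [->|/qa/ltW//] := eqVneq x 0; rewrite !mul0mx mxE.
have [a0|a0] := eqVneq a 0; last by rewrite ltr_pwDl// qa.
rewrite ltr_wpDl// qa//; apply: contra v0 => /eqP b0; apply/eqP/matrixP => i j.
move/matrixP/(_ i j) : a0; move/matrixP/(_ i j) : b0; rewrite !mxE => vi vr.
exact: complex_eqP.
Qed.

(** On the row vector (- w^T Z^-1, 1), with w the new column, the form takes
    the value of the last pivot. *)
Lemma accretive_leadS (f : nat -> nat -> R[i]) k : (forall i j, f i j = f j i) ->
  accretive (lead f k.+1) -> accretive (lead f k) /\ 0 < Re (pivot f k).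
Proof.
move=> fC; rewrite -addn1 lead_block_mx//; set w := leadcol f k => aM.
have aZ : accretive (lead f k).
  move=> v v0; have := aM (row_mx v 0).
  rewrite row_mx_eq0 negb_and v0 => /(_ isT).
  rewrite mul_row_block mul0mx addr0 /conjmx map_row_mx -/(conjmx _) tr_row_mx.
  by rewrite mul_row_col map_mx0 trmx0 mulmx0 addr0.
split=> //; have uZ := accretive_unit aZ.
have := aM (row_mx (- (w^T *m invmx (lead f k))) 1%:M).
rewrite row_mx_eq0 negb_and oner_eq0 orbT => /(_ isT).
rewrite mul_row_block mulNmx mulmxKV// !mul1mx addNr /conjmx map_row_mx tr_row_mx.
rewrite mul_row_col mul0mx add0r map_mx1 trmx1 mulmx1 mulNmx pivotE// addrC.
by rewrite !mxE eqxx mulr1n.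
Qed.

Lemma accretive_leadP (f : nat -> nat -> R[i]) k j : (forall i j, f i j = f j i) ->
  accretive (lead f k) -> (j < k)%N -> accretive (lead f j) /\ 0 < Re (pivot f j).
Proof.
move=> fC; elim: k => // k IH /(accretive_leadS fC)[a p].
by rewrite ltnS leq_eqVlt => /orP[/eqP ->//|]; exact: IH.
Qed.

Lemma char_poly_eigenvals n (Z : 'M[R[i]]_n) :
  char_poly Z = \prod_(mu <- eigenvals Z) ('X - mu%:P).
Proof.
rewrite /eigenvals; case: closed_field_poly_normal => s /= {1}->.
by rewrite (monicP (char_poly_monic Z)) scale1r.
Qed.

Lemma size_eigenvals n (Z : 'M[R[i]]_n) : size (eigenvals Z) = n.
Proof.
have := size_char_poly Z.
by rewrite char_poly_eigenvals size_prod_XsubC => -[].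
Qed.

Lemma eigenvals_gt0 n (Z : 'M[R[i]]_n) mu :
  accretive Z -> mu \in eigenvals Z -> 0 < Re mu.
Proof.
move=> aZ mE; apply: (accretive_eigen aZ).
by rewrite char_poly_eigenvals root_prod_XsubC.
Qed.

(** Up to the factor (- y) ^ n this is the characteristic polynomial at - x /
    y. *)
Lemma det_segment n (Z : 'M[R[i]]_n) (x y : R[i]) :
  \det (x%:M + y *: Z) = \prod_(mu <- eigenvals Z) (x + y * mu).
Proof.
have [->|y0] := eqVneq y 0.
  rewrite scale0r addr0 det_scalar; under eq_bigr do rewrite mul0r addr0.
  by rewrite big_const_seq count_predT size_eigenvals iter_mulr_1.
pose c := - x / y.
have -> : x%:M + y *: Z = (- y) *: (c%:M - Z).
  by rewrite scalerBr scale_scalar_mx /c mulrA mulrNN mulrAC divff// mul1r scaleNr opprK.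
rewrite detZ.
have -> : \det (c%:M - Z) = (char_poly Z).[c].
  rewrite -horner_evalE /char_poly -det_map_mx; congr (\det _).
  by apply/matrixP => i j; rewrite !mxE /= /horner_eval hornerD hornerN hornerC hornerMn hornerX.
rewrite char_poly_eigenvals -{1}(size_eigenvals Z).
elim: (eigenvals Z) => [|mu r IH]; first by rewrite !big_nil hornerC mulr1.
rewrite !big_cons -IH hornerM /= exprS hornerD hornerN hornerX hornerC /c.
by field.
Qed.

End accretive.

(** * Powers of determinants as products of powers of pivots *)

Section detpow_pivots.
Context {R : realType}.

(** Replace each member mu by 1 - u + u mu. Both sides are then logarithms of
    the product over s1, so their difference is a continuous function of u
    whose values are multiples of 2 pi i, and it vanishes at u = 0. *)
Lemma sum_hln_segment (s1 s2 : seq R[i]) :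
  (forall mu, mu \in s1 -> 0 < Re mu) -> (forall mu, mu \in s2 -> 0 < Re mu) ->
  let P (s : seq R[i]) (u : R) := \prod_(mu <- s) ((1 - u)%:C + u%:C * mu) in
  (forall u, 0 <= u <= 1 -> 0 < Re (P s1 u / P s2 u)) ->
  \sum_(mu <- s1) hln mu = \sum_(mu <- s2) hln mu + hln (P s1 1 / P s2 1).
Proof.
move=> s1p s2p P Pp.
pose e (mu : R[i]) (u : R) := (1 - u)%:C + u%:C * mu.
have ep mu u : 0 <= u <= 1 -> 0 < Re mu -> 0 < Re (e mu u).
  move=> /andP[u0 u1] m0; rewrite /e !ReImE mul0r subr0.
  have [->|u0'] := eqVneq u 0; first by rewrite mul0r addr0 subr0.
  by rewrite ltr_wpDl ?subr_ge0// mulr_gt0// lt_neqAle eq_sym u0'.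
pose S (s : seq R[i]) u := \sum_(mu <- s) hln (e mu u).
pose th u := S s1 u - S s2 u - hln (P s1 u / P s2 u).
have P0 s u : 0 <= u <= 1 -> (forall mu, mu \in s -> 0 < Re mu) -> P s u != 0.
  move=> u01 sp; rewrite /P big_seq; apply: (big_ind (fun x => x != 0)).
  - exact: oner_neq0.
  - by move=> x y; exact: mulf_neq0.
  - by move=> mu /sp /(ep _ _ u01) /Re_gt0_neq0.
have expS s u : 0 <= u <= 1 -> (forall mu, mu \in s -> 0 < Re mu) ->
    cexp (S s u) = P s u.
  move=> u01 sp; rewrite /S cexp_sum big_seq [RHS]big_seq; apply: eq_bigr => mu ms.
  by rewrite cexp_hln// ep// sp.
have expth u : 0 <= u <= 1 -> cexp (th u) = 1.
  move=> u01; rewrite /th !cexpD !cexpN !expS// cexp_hln ?Pp//.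
  by rewrite divff// mulf_neq0 ?invr_eq0 ?P0.
have ce mu (u : R) : ccvg (nbhs u) (e mu) (e mu u).
  apply: ccvgD; first by apply: ccvgC; apply: cvgB; [exact: cvg_cst|exact: cvg_id].
  by apply: ccvgM; [apply: ccvgC; exact: cvg_id|exact: ccvg_cst].
have cP s (u : R) : ccvg (nbhs u) (P s) (P s u).
  by apply: ccvg_prod => mu; exact: ce.
have cS s (u : R) : 0 <= u <= 1 -> (forall mu, mu \in s -> 0 < Re mu) ->
    ccvg (nbhs u) (S s) (S s u).
  move=> u01; elim: s => [|mu s IH] sp.
    rewrite /S big_nil; apply: (@eq_ccvg _ _ _ _ (fun=> 0)); last exact: ccvg_cst.
    by move=> x; rewrite big_nil.
  rewrite /S big_cons.
  apply: (@eq_ccvg _ _ _ _ (fun x => hln (e mu x) + S s x)).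
    by move=> x; rewrite /S big_cons.
  apply: ccvgD; first by apply: ccvg_hln => //; apply: ep => //; apply: sp; rewrite mem_head.
  by apply: IH => nu ns; apply: sp; rewrite in_cons ns orbT.
have cth (u : R) : 0 <= u <= 1 -> ccvg (nbhs u) th (th u).
  move=> u01; apply: ccvgB; first by apply: ccvgB; exact: cS.
  apply: ccvg_hln; first exact: Pp.
  by apply: ccvgM => //; apply: ccvgV => //; exact: P0.
have e0 mu : e mu 0 = 1 by rewrite /e subr0 mul0r addr0.
have th0 : th 0 = 0.
  have S0 s : S s 0 = 0.
    by rewrite /S big1// => mu _; rewrite e0 hln_real ?ln1.
  have P0' s : P s 0 = 1 by rewrite /P big1// => mu _; exact: e0.
  by rewrite /th !S0 !P0' divr1 hln_real// ln1 !subr0.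
have cos1 u : 0 <= u <= 1 -> cos (Im (th u)) = 1 /\ Re (th u) = 0.
  move=> /expth h; have := normc_cexp (th u); rewrite h Normc.normc1 -expR0.
  move=> /expR_inj r0; split=> //; have := congr1 (@complex.Re R) h.
  by rewrite Re_cexp -r0 expR0 mul1r.
have u11 : 0 <= (1 : R) <= 1 by rewrite ler01 lexx.
have th1 : th 1 = 0.
  apply: complex_eqP; first by have [] := cos1 1 u11.
  apply/eqP/negP => /negP i1.
  have cont : {within `[0, 1], continuous (fun u => Im (th u))}.
    apply: continuous_in_subspaceT => u; rewrite inE/= in_itv/= => u01.
    by have [_] := cth u u01.
  have p0 := pi_gt0 R.
  have no v : `|v| <= `|Im (th 1)| -> 0 <= v * Im (th 1) -> cos v = 1.
    move=> v1 v2; have [] := @IVT _ (fun u => Im (th u)) 0 1 v ler01 cont.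
      rewrite th0 /= ; case: (ltrgt0P (Im (th 1))) i1 v1 v2 => // h _.
        rewrite pmulr_lge0// => v1 v0; rewrite ger0_norm// in v1.
        by rewrite v0 v1.
      rewrite nmulr_lge0// => v1 v0; rewrite ler0_norm// lerN2 in v1.
      by rewrite v0 v1.
    by move=> u; rewrite in_itv/= => u01 <-; have [] := cos1 u u01.
  pose c := Num.min `|Im (th 1)| (pi / 2).
  have c0 : 0 < c by rewrite lt_min normr_gt0 i1 divr_gt0.
  have cpi : c < pi.
    by apply: (@le_lt_trans _ _ (pi / 2)); [rewrite ge_min lexx orbT|lra].
  have ct : c <= `|Im (th 1)| by rewrite ge_min lexx.
  have : cos c = 1.
    have [i0|i0|i0] := ltrgt0P (Im (th 1)); last by rewrite i0 eqxx in i1.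
      by apply: no; [rewrite gtr0_norm|rewrite mulr_ge0// ltW].
    by rewrite -cosN; apply: no; [rewrite normrN gtr0_norm|rewrite mulNr -mulrN mulr_ge0// ltW// oppr_gt0].
  have := cos2Dsin2 c => /[swap] ->; rewrite expr1n => /eqP.
  rewrite -subr_eq0 addrAC subrr add0r sqrf_eq0 gt_eqF// sin_gt0_pi// c0 cpi.
  by [].
have S1 s : S s 1 = \sum_(mu <- s) hln mu.
  by apply: eq_bigr => mu _; rewrite /e subrr add0r mul1r.
have := th1; rewrite /th !S1 => /eqP; rewrite subr_eq0 => /eqP <-.
by rewrite addrC subrK.
Qed.

(** The eigenvalues of a block are not related to those of the next one, but
    the ratio of the two determinants is a pivot, and it stays in the right
    half plane along the segment from the identity. *)
Lemma sum_hln_eigenvals (f : nat -> nat -> R[i]) k : (forall i j, f i j = f j i) ->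
  accretive (lead f k.+1) ->
  \sum_(mu <- eigenvals (lead f k.+1)) hln mu =
  \sum_(mu <- eigenvals (lead f k)) hln mu + hln (pivot f k).
Proof.
move=> fC aS; have [aZ _] := accretive_leadS fC aS.
pose g (u : R) i j := (1 - u)%:C * (i == j)%:R + u%:C * f i j.
have gC u i j : g u i j = g u j i by rewrite /g eq_sym fC.
have gE u n : lead (g u) n = (1 - u)%:C%:M + u%:C *: lead f n.
  by apply/matrixP => i j; rewrite !mxE /g mulr_natr.
rewrite (@sum_hln_segment (eigenvals (lead f k.+1)) (eigenvals (lead f k))).
- under eq_bigr do rewrite subrr add0r mul1r.
  have d n : \det (lead f n) = \prod_(mu <- eigenvals (lead f n)) mu.
    have := det_segment (lead f n) 0 1; rewrite scale1r raddf0 add0r => ->.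
    by under eq_bigr do rewrite add0r mul1r.
  congr (_ + hln (_ / _)); first by rewrite -d.
  by under eq_bigr do rewrite subrr add0r mul1r; rewrite -d.
- by move=> mu; exact: eigenvals_gt0.
- by move=> mu; exact: eigenvals_gt0.
- move=> u u01; rewrite -!det_segment -!gE -/(pivot _ _).
  by apply: (proj2 (accretive_leadS (gC u) _)); rewrite gE; exact: accretive_segment.
Qed.

Lemma sum_cln_eigenvals (f : nat -> nat -> R[i]) k : (forall i j, f i j = f j i) ->
  accretive (lead f k) ->
  \sum_(mu <- eigenvals (lead f k)) cln mu = \sum_(j < k) hln (pivot f j).
Proof.
move=> fC aZ; rewrite big_seq.
under eq_bigr => mu m do rewrite cln_hln ?(eigenvals_gt0 aZ m)//.
rewrite -big_seq; elim: k aZ => [|k IH] aZ.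
  rewrite big_ord0; have := size_eigenvals (lead f 0).
  by move/eqP; rewrite size_eq0 => /eqP ->; rewrite big_nil.
by rewrite sum_hln_eigenvals// big_ord_recr /= IH//; have [] := accretive_leadS fC aZ.
Qed.

Lemma detpow_lead (f : nat -> nat -> R[i]) k s t : (forall i j, f i j = f j i) ->
  accretive (lead f k) ->
  detpow (lead f k) s t = \prod_(j < k) hpow (pivot f j) s t.
Proof.
move=> fC aZ; rewrite /detpow -rmorph_sum/= sum_cln_eigenvals// rmorph_sum/= !mulr_sumr.
by rewrite -big_split /= cexp_sum.
Qed.

End detpow_pivots.

(** * Complex measurable functions and their integrals *)

Section product_sigma_finite.
Local Open Scope ereal_scope.
Context d1 d2 (T1 : measurableType d1) (T2 : measurableType d2) (R : realType).
Variable m1 : {sigma_finite_measure set T1 -> \bar R}.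
Variable m2 : {sigma_finite_measure set T2 -> \bar R}.

Lemma product_sigma_finite : sigma_finite setT (m1 \x m2).
Proof.
have /sigma_finiteP[F [FT ndF Foo]] := sigma_finiteT m1.
have /sigma_finiteP[G [GT ndG Goo]] := sigma_finiteT m2.
exists (fun k => F k `*` G k).
  apply/esym; rewrite -subTset => -[x y] _.
  have [k _ Fk] : (\bigcup_i F i) x by rewrite -FT.
  have [l _ Gl] : (\bigcup_i G i) y by rewrite -GT.
  exists (maxn k l) => //; split => /=.
  - by move/subsetPset: (ndF _ _ (leq_maxl k l)); apply.
  - by move/subsetPset: (ndG _ _ (leq_maxr k l)); apply.
move=> k; have [mF Fk] := Foo k; have [mG Gk] := Goo k; split.
  exact: measurableX.
by rewrite product_measure1E// lte_mul_pinfty// ge0_fin_numE.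
Qed.

(** The product measure, packaged so that products can be nested. *)
Definition prodm : {sigma_finite_measure set (T1 * T2)%type -> \bar R} :=
  HB.pack_for {sigma_finite_measure set (T1 * T2)%type -> \bar R}
    (product_measure1 m1 m2)
    (Measure_isSigmaFinite.Build _ _ _ (m1 \x m2) product_sigma_finite).

End product_sigma_finite.

Section complex_measurable.
Context d (T : measurableType d) (R : realType).
Implicit Types (f g : T -> R[i]) (z : R[i]).

Definition cmeas f := measurable_fun [set: T] (fun x => Re (f x)) /\
  measurable_fun [set: T] (fun x => Im (f x)).

Lemma eq_cmeas f g : (forall x, f x = g x) -> cmeas f -> cmeas g.
Proof. by move=> /funext ->. Qed.

Lemma cmeas_cst z : cmeas (fun=> z).
Proof. by split; exact: measurable_cst. Qed.

Lemma cmeasC (f : T -> R) : measurable_fun setT f -> cmeas (fun x => (f x)%:C).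
Proof. by move=> mf; split => //; exact: measurable_cst. Qed.

Lemma cmeasD f g : cmeas f -> cmeas g -> cmeas (fun x => f x + g x).
Proof.
move=> [? ?] [? ?]; split; under eq_fun do rewrite ReImE; exact: measurable_funD.
Qed.

Lemma cmeasN f : cmeas f -> cmeas (fun x => - f x).
Proof.
by move=> [? ?]; split; under eq_fun do rewrite ReImE; exact: measurableT_comp.
Qed.

Lemma cmeasB f g : cmeas f -> cmeas g -> cmeas (fun x => f x - g x).
Proof. by move=> mf mg; apply: cmeasD => //; exact: cmeasN. Qed.

Lemma cmeasM f g : cmeas f -> cmeas g -> cmeas (fun x => f x * g x).
Proof.
move=> [? ?] [? ?]; split; under eq_fun do rewrite ReImE.
  by apply: measurable_funB; exact: measurable_funM.
by apply: measurable_funD; exact: measurable_funM.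
Qed.

Lemma measurable_invr (f : T -> R) :
  measurable_fun setT f -> measurable_fun setT (fun x => (f x)^-1).
Proof.
(* The product has the value 0 of the inverse also at 0. *)
move=> mf; rewrite (_ : (fun _ => _) = (fun x => f x * expR (- ln (f x ^+ 2)))).
  apply: measurable_funM => //; apply: measurableT_comp => //.
  by apply: measurableT_comp => //; apply: measurableT_comp => //; exact: measurable_funX.
apply/funext => x; have [->|f0] := eqVneq (f x) 0; first by rewrite invr0 mul0r.
rewrite expRN lnK ?posrE ?exprn_even_gt0//; by field.
Qed.

Lemma cmeasJ f : cmeas f -> cmeas (fun x => (f x)^*).
Proof.
move=> [? mi]; split; first by under eq_fun do rewrite ReJ.
by under eq_fun do rewrite ImJ; exact: measurableT_comp.
Qed.

Lemma measurable_normc f : cmeas f -> measurable_fun setT (fun x => normc (f x)).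
Proof.
move=> [? ?].
have nE (y : R[i]) : normc y = Num.sqrt (Re y ^+ 2 + Im y ^+ 2) by case: y.
under eq_fun do rewrite nE.
apply: (measurableT_comp (@continuous_measurable_fun _ _ (@sqrt_continuous R))).
by apply: measurable_funD; exact: measurable_funX.
Qed.

Lemma cmeasV f : cmeas f -> cmeas (fun x => (f x)^-1).
Proof.
move=> mf; have mn : measurable_fun setT (fun x => ((Re (f x)) ^+ 2 + (Im (f x)) ^+ 2)^-1).
  case: mf => ? ?; apply: measurable_invr.
  by apply: measurable_funD; exact: measurable_funX.
case: mf => ? ?; split.
  by under eq_fun do rewrite ReV; exact: measurable_funM.
by under eq_fun do rewrite ImV; apply: measurableT_comp => //; exact: measurable_funM.
Qed.

Lemma cmeas_cexp f : cmeas f -> cmeas (fun x => cexp (f x)).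
Proof.
move=> [? ?]; split; apply: measurable_funM; apply: measurableT_comp => //.
- by apply: continuous_measurable_fun => x; exact: continuous_cos.
- by apply: continuous_measurable_fun => x; exact: continuous_sin.
Qed.

Lemma cmeas_hln f : cmeas f -> cmeas (fun x => hln (f x)).
Proof.
move=> mf; have mn := measurable_normc mf; case: mf => mr mi; split.
  by apply: measurableT_comp => //; exact: measurable_ln.
apply: measurableT_comp.
  by apply: continuous_measurable_fun => x; exact: continuous_atan.
by apply: measurable_funM => //; exact: measurable_invr.
Qed.

Lemma cmeas_hpow f a b : cmeas f -> cmeas (fun x => hpow (f x) a b).
Proof.
move=> mf; have mh := cmeas_hln mf; apply: cmeas_cexp.
apply: cmeasD; apply: cmeasM; [exact: cmeas_cst|exact: mh|exact: cmeas_cst|exact: cmeasJ].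
Qed.

Lemma cmeas_rpowc (f : T -> R) a :
  measurable_fun setT f -> cmeas (fun x => rpowc (f x) a).
Proof.
move=> mf; apply: cmeas_cexp; apply: cmeasM; first exact: cmeas_cst.
by apply: cmeasC; apply: measurableT_comp => //; exact: measurable_ln.
Qed.

Lemma cmeas_prod (I : Type) (r : seq I) (h : I -> T -> R[i]) :
  (forall i, cmeas (h i)) -> cmeas (fun x => \prod_(i <- r) h i x).
Proof.
move=> H; elim: r => [|i r IH].
  by apply: eq_cmeas (cmeas_cst 1) => x; rewrite big_nil.
by apply: eq_cmeas (cmeasM (H i) IH) => x; rewrite big_cons.
Qed.

Lemma cmeas_sum (I : Type) (r : seq I) (h : I -> T -> R[i]) :
  (forall i, cmeas (h i)) -> cmeas (fun x => \sum_(i <- r) h i x).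
Proof.
move=> H; elim: r => [|i r IH].
  by apply: eq_cmeas (cmeas_cst 0) => x; rewrite big_nil.
by apply: eq_cmeas (cmeasD (H i) IH) => x; rewrite big_cons.
Qed.

Lemma cmeas_if (b : T -> bool) f g : measurable_fun setT b ->
  cmeas f -> cmeas g -> cmeas (fun x => if b x then f x else g x).
Proof.
move=> mb [? ?] [? ?]; split.
  rewrite (_ : (fun _ => _) = (fun x => if b x then Re (f x) else Re (g x))).
    by apply: measurable_fun_ifT.
  by apply/funext => x; case: ifP.
rewrite (_ : (fun _ => _) = (fun x => if b x then Im (f x) else Im (g x))).
  by apply: measurable_fun_ifT.
by apply/funext => x; case: ifP.
Qed.

End complex_measurable.

Lemma cmeas_comp d d' (T : measurableType d) (T' : measurableType d') (R : realType)
  (f : T' -> R[i]) (phi : T -> T') :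
  cmeas f -> measurable_fun setT phi -> cmeas (fun x => f (phi x)).
Proof. by move=> [? ?] ?; split; exact: (measurableT_comp (f := _ \o f)). Qed.

Lemma measurable_pos d (T : measurableType d) (R : realType) (f : T -> R) :
  measurable_fun setT f -> measurable_fun setT (fun x => 0 < f x).
Proof. by move=> mf; apply: measurable_fun_ltr. Qed.

Section complex_integral.
Context d (T : measurableType d) (R : realType).
Variable mu : {measure set T -> \bar R}.
Implicit Types (f g : T -> R[i]) (v w z : R[i]).

(** Value together with integrability, since every rule for the value needs
    it. *)
Definition cint f v := cintegrable mu setT f /\ cintegral mu setT f = v.

(** The integral of the modulus, extended real so that it can be computed
    before integrability is known. *)
Definition nint f : \bar R := (\int[mu]_x (normc (f x))%:E)%E.

Lemma eq_cint f g v : (forall x, f x = g x) -> cint f v -> cint g v.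
Proof. by move=> /funext ->. Qed.

Lemma cint_eqv f v w : cint f v -> v = w -> cint f w.
Proof. by move=> ? <-. Qed.

Lemma cintegrable_cmeas f : cintegrable mu setT f -> cmeas f.
Proof.
by move=> [ir ii]; split; apply/measurable_EFinP;
  [have := measurable_int _ ir|have := measurable_int _ ii].
Qed.

Lemma cintegrable_cint f : cintegrable mu setT f -> cint f (cintegral mu setT f).
Proof. by []. Qed.

Lemma cint_cmeas f v : cint f v -> cmeas f.
Proof. by move=> [/cintegrable_cmeas]. Qed.

Lemma Re_cintegral f v : cint f v -> \int[mu]_x Re (f x) = Re v.
Proof. by move=> [_ <-]. Qed.

Lemma cint_unique f v w : cint f v -> cint f w -> v = w.
Proof. by move=> [_ <-] [_ <-]. Qed.

Lemma measurable_nint f : cmeas f -> measurable_fun setT (fun x => (normc (f x))%:E).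
Proof. by move=> mf; apply/measurable_EFinP; exact: measurable_normc. Qed.

Lemma cintegrable_dom f (g : T -> R) : cmeas f -> mu.-integrable setT (EFin \o g) ->
  (forall x, normc (f x) <= g x) -> cintegrable mu setT f.
Proof.
move=> [mr mi] ig fg; split; apply: (le_integrable measurableT _ _ ig).
- exact/measurable_EFinP.
- move=> x _ /=; rewrite lee_fin; apply: (le_trans (normRe _)).
  by apply: (le_trans (fg x)); exact: ler_norm.
- exact/measurable_EFinP.
- move=> x _ /=; rewrite lee_fin; apply: (le_trans (normIm _)).
  by apply: (le_trans (fg x)); exact: ler_norm.
Qed.

Lemma integrable_normc f : cintegrable mu setT f ->
  mu.-integrable setT (EFin \o (fun x => normc (f x))).
Proof.
move=> fi; have mf := cintegrable_cmeas fi; case: fi => ir ii.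
have h : mu.-integrable setT (EFin \o (fun x => `|Re (f x)| + `|Im (f x)|)).
  have := integrableD measurableT (integrable_norm ir) (integrable_norm ii).
  by apply: eq_integrable.
apply: (le_integrable measurableT _ _ h); first exact: measurable_nint.
move=> x _ /=; rewrite lee_fin ger0_norm ?normc_ge0//.
by apply: (le_trans (normc_le _)); exact: ler_norm.
Qed.

Lemma cintegrableP f : cmeas f -> (nint f < +oo)%E -> cintegrable mu setT f.
Proof.
move=> mf fo; apply: (@cintegrable_dom _ (fun x => normc (f x))) => //.
apply/integrableP; split; first exact: measurable_nint.
by under eq_integral do rewrite /= ger0_norm ?normc_ge0//.
Qed.

Lemma nint_lty f : cintegrable mu setT f -> (nint f < +oo)%E.
Proof. by move/integrable_normc/integrable_lty => /(_ measurableT). Qed.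

Lemma nint_ge0 f : (0 <= nint f)%E.
Proof. by apply: integral_ge0 => x _; rewrite lee_fin normc_ge0. Qed.

Lemma nintZ c f : cmeas f -> nint (fun x => c * f x) = ((normc c)%:E * nint f)%E.
Proof.
move=> mf; rewrite /nint -ge0_integralZl//.
- by apply: eq_integral => x _; rewrite Normc.normcM EFinM.
- exact: measurable_nint.
- by move=> x _; rewrite lee_fin normc_ge0.
- by rewrite lee_fin normc_ge0.
Qed.

Lemma cintD f g v w : cint f v -> cint g w -> cint (fun x => f x + g x) (v + w).
Proof.
move=> [[fr fi] <-] [[gr gi] <-]; split; last first.
  apply: complex_eqP; rewrite ReImE /=.
    by rewrite -RintegralD//; apply: eq_Rintegral => x _; rewrite ReD.
  by rewrite -RintegralD//; apply: eq_Rintegral => x _; rewrite ImD.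
split; [have := integrableD measurableT fr gr|have := integrableD measurableT fi gi];
  by apply: eq_integrable => // x _ /=; rewrite ReImE.
Qed.

Lemma cintZ c f v : cint f v -> cint (fun x => c * f x) (c * v).
Proof.
move=> [[fr fi] <-]; have Z (a : R) h : mu.-integrable setT (EFin \o h) ->
    mu.-integrable setT (EFin \o (fun x => a * h x)).
  move=> ih; have := integrableZl measurableT a ih.
  by apply: eq_integrable.
have I1 := integrableB measurableT (Z (Re c) _ fr) (Z (Im c) _ fi).
have I2 := integrableD measurableT (Z (Re c) _ fi) (Z (Im c) _ fr).
split; last first.
  apply: complex_eqP; rewrite ?(ReM, ImM) /=.
    rewrite -!(RintegralZl _ measurableT)// -RintegralB//; try exact: Z.
    by apply: eq_Rintegral => x _; rewrite ReM.
  rewrite -!(RintegralZl _ measurableT)// -RintegralD//; try exact: Z.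
  by apply: eq_Rintegral => x _; rewrite ImM.
split; [apply: eq_integrable I1|apply: eq_integrable I2] => // x _ /=.
  by rewrite ReM.
by rewrite ImM.
Qed.

Lemma cintN f v : cint f v -> cint (fun x => - f x) (- v).
Proof.
move=> /(cintZ (-1)); rewrite mulN1r; apply: eq_cint => x; exact: mulN1r.
Qed.

Lemma cintB f g v w : cint f v -> cint g w -> cint (fun x => f x - g x) (v - w).
Proof. by move=> ? ?; apply: cintD => //; exact: cintN. Qed.

Lemma cintC (f : T -> R) (v : R) : mu.-integrable setT (EFin \o f) ->
  \int[mu]_x f x = v -> cint (fun x => (f x)%:C) v%:C.
Proof.
move=> fi <-; split; first by split=> //; exact: integrable0.
by apply: complex_eqP => //=; rewrite Rintegral_cst// mul0r.
Qed.

Lemma cint0 : cint (fun=> 0) 0.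
Proof. by apply: (cintC (f := fun=> 0)); [exact: integrable0|rewrite Rintegral_cst// mul0r]. Qed.

Lemma cint_ge0 (f : T -> R) (v : R) : measurable_fun setT f -> (forall x, 0 <= f x) ->
  (\int[mu]_x (f x)%:E = v%:E)%E -> cint (fun x => (f x)%:C) v%:C.
Proof.
move=> mf f0 fv; apply: cintC; last by rewrite /Rintegral fv.
apply/integrableP; split; first exact/measurable_EFinP.
under eq_integral do rewrite /= ger0_norm//.
by rewrite fv ltry.
Qed.

Lemma cint_nint f : cintegrable mu setT f ->
  cint (fun x => (normc (f x))%:C) (fine (nint f))%:C.
Proof. by move=> fi; apply: cintC => //; exact: integrable_normc. Qed.

Lemma nint_cint f v : cmeas f -> cint (fun x => (normc (f x))%:C) v ->
  nint f = (Re v)%:E.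
Proof.
move=> mf h; have [hi _] := h.
have fi : cintegrable mu setT f.
  apply: cintegrableP => //; have := nint_lty hi; congr (_ < _)%E.
  by apply: eq_integral => x _; rewrite normcC ger0_norm ?normc_ge0.
rewrite (cint_unique h (cint_nint fi)) ReC fineK// ge0_fin_numE ?nint_ge0//.
exact: nint_lty.
Qed.

Lemma cint_mkcond (D : set T) f g v : measurable D ->
  (forall x, D x -> g x = f x) -> (forall x, ~ D x -> g x = 0) ->
  cint g v <-> cintegrable mu D f /\ cintegral mu D f = v.
Proof.
move=> mD gf g0.
have E (h : R[i] -> R) : h 0 = 0 -> (fun x => h (g x)) = (fun x => h (f x)) \_ D.
  move=> h0; apply/funext => x; rewrite patchE; case: ifPn => [/set_mem Dx|/negP Dx].
    by rewrite gf.
  by rewrite g0 ?h0// => /mem_set.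
rewrite /cint /cintegrable /cintegral.
rewrite !(E (@complex.Re R))// !(E (@complex.Im R))// -!Rintegral_mkcond.
have I (h : R[i] -> R) : h 0 = 0 -> mu.-integrable setT (fun x => (h (g x))%:E) <->
    mu.-integrable D (fun x => (h (f x))%:E).
  move=> h0; rewrite [X in _ <-> X]integrable_mkcond// restrict_EFin -E//.
by rewrite !I.
Qed.

End complex_integral.

(** * Fubini's theorem and measure preserving maps *)

Section fubini.
Context d1 d2 (T1 : measurableType d1) (T2 : measurableType d2) (R : realType).
Variable m1 : {sigma_finite_measure set T1 -> \bar R}.
Variable m2 : {sigma_finite_measure set T2 -> \bar R}.
Implicit Types (f : T1 * T2 -> R[i]).

Local Notation m12 := (prodm m1 m2).

Lemma nint_fubini f : cmeas f ->
  nint m12 f = (\int[m1]_x nint m2 (fun y => f (x, y)))%E.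
Proof.
move=> mf; rewrite /nint fubini_tonelli1//; first exact: measurable_nint.
by move=> x; rewrite lee_fin normc_ge0.
Qed.

Lemma cintegrable_prod f (G : T1 -> R) : cmeas f ->
  m1.-integrable setT (EFin \o G) ->
  (forall x, (nint m2 (fun y => f (x, y)) <= (G x)%:E)%E) ->
  cintegrable m12 setT f.
Proof.
move=> mf iG fG; apply: cintegrableP => //; rewrite nint_fubini//.
apply: le_lt_trans (integrable_lty measurableT iG).
apply: ge0_le_integral => //.
- by move=> x _; exact: nint_ge0.
- apply: (@measurable_fun_fubini_tonelli_F _ _ _ _ _ _ (fun z => (normc (f z))%:E)).
    exact: measurable_nint.
  by move=> x; rewrite lee_fin normc_ge0.
- exact: measurable_int iG.
Qed.

Lemma cint_fubini1 f (g : T1 -> R[i]) v : cint m12 f v ->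
  (forall x, cint m2 (fun y => f (x, y)) (g x)) -> cint m1 g v.
Proof.
move=> [[fr fi] <-] fg.
have gr : (fun x => (Re (g x))%:E) = (fun x => \int[m2]_y (Re (f (x, y)))%:E)%E.
  apply/funext => x; have [[ir ii] <-] := fg x.
  by rewrite /cintegral /= /Rintegral fineK// integrable_fin_num.
have gi : (fun x => (Im (g x))%:E) = (fun x => \int[m2]_y (Im (f (x, y)))%:E)%E.
  apply/funext => x; have [[ir ii] <-] := fg x.
  by rewrite /cintegral /= /Rintegral fineK// integrable_fin_num.
split; first split.
- by rewrite gr; exact: (integrable_fubini_F fr).
- by rewrite gi; exact: integrable_fubini_F fi.
apply: complex_eqP; rewrite /= /Rintegral ?gr ?gi; congr fine.
  exact: (integral12_prod_meas1 fr).
exact: (integral12_prod_meas1 fi).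
Qed.

(** Fubini's theorem, with integrability from a bound of the inner integrals
    of the modulus. *)
Lemma cint_prod f (g : T1 -> R[i]) (G : T1 -> R) v : cmeas f ->
  (forall x, cint m2 (fun y => f (x, y)) (g x)) ->
  m1.-integrable setT (EFin \o G) ->
  (forall x, (nint m2 (fun y => f (x, y)) <= (G x)%:E)%E) ->
  cint m1 g v -> cint m12 f v.
Proof.
move=> mf fg iG fG gv; have fi := cintegrable_prod mf iG fG.
by rewrite (cint_unique gv (cint_fubini1 (cintegrable_cint fi) fg)).
Qed.

End fubini.

Section measure_preserving.
Context (R : realType).

Definition mpres d1 d2 (T1 : measurableType d1) (T2 : measurableType d2)
    (m1 : {measure set T1 -> \bar R}) (m2 : {measure set T2 -> \bar R})
    (phi : T1 -> T2) : Prop :=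
  measurable_fun setT phi /\ (forall A, measurable A -> m1 (phi @^-1` A) = m2 A).

Section basic.
Context d1 d2 (T1 : measurableType d1) (T2 : measurableType d2).
Variables (m1 : {measure set T1 -> \bar R}) (m2 : {measure set T2 -> \bar R}).
Variable phi : T1 -> T2.
Hypothesis phiP : mpres m1 m2 phi.

Lemma mpres_ge0_integral (f : T2 -> \bar R) : measurable_fun setT f ->
  (forall x, 0 <= f x)%E -> (\int[m1]_x f (phi x) = \int[m2]_y f y)%E.
Proof.
have [mphi phiE] := phiP; move=> mf f0.
have := ge0_integral_pushforward mphi m1 measurableT mf.
rewrite preimage_setT => <- //.
by apply: eq_measure_integral => A mA _; exact: phiE.
Qed.

Lemma mpres_integrable (f : T2 -> \bar R) : measurable_fun setT f ->
  m1.-integrable setT (f \o phi) -> m2.-integrable setT f.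
Proof.
move=> mf /integrableP[_ h]; apply/integrableP; split=> //.
rewrite -mpres_ge0_integral//; exact: measurableT_comp.
Qed.

Lemma mpres_integral (f : T2 -> \bar R) : measurable_fun setT f ->
  m1.-integrable setT (f \o phi) -> (\int[m1]_x f (phi x) = \int[m2]_y f y)%E.
Proof.
move=> mf fi; rewrite integralE [RHS]integralE; congr (_ - _)%E.
  rewrite -[RHS](mpres_ge0_integral (measurable_funepos mf))//.
  by apply: eq_integral => x _; rewrite !funeposE.
rewrite -[RHS](mpres_ge0_integral (measurable_funeneg mf))//.
by apply: eq_integral => x _; rewrite !funenegE.
Qed.

Lemma mpres_cint (f : T2 -> R[i]) v : cmeas f ->
  cint m1 (fun x => f (phi x)) v -> cint m2 f v.
Proof.
move=> [/measurable_EFinP mr /measurable_EFinP mi] [[ir ii] <-]; split; first split.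
- exact: (mpres_integrable mr).
- exact: (mpres_integrable mi).
apply: complex_eqP; rewrite /= /Rintegral; congr fine.
  by rewrite -(mpres_integral mr).
by rewrite -(mpres_integral mi).
Qed.

Lemma mpres_nint (f : T2 -> R[i]) : cmeas f ->
  nint m1 (fun x => f (phi x)) = nint m2 f.
Proof.
move=> mf; rewrite /nint -mpres_ge0_integral//; first exact: measurable_nint.
by move=> x; rewrite lee_fin normc_ge0.
Qed.

End basic.

Lemma mpres_id d (T : measurableType d) (m : {measure set T -> \bar R}) :
  mpres m m id.
Proof. by split. Qed.

Lemma mpres_comp d1 d2 d3 (T1 : measurableType d1) (T2 : measurableType d2)
    (T3 : measurableType d3) (m1 : {measure set T1 -> \bar R})
    (m2 : {measure set T2 -> \bar R}) (m3 : {measure set T3 -> \bar R}) f g :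
  mpres m1 m2 f -> mpres m2 m3 g -> mpres m1 m3 (g \o f).
Proof.
move=> [mf fE] [mg gE]; split; first exact: measurableT_comp.
move=> A mA; rewrite comp_preimage fE ?gE//.
by rewrite -[X in measurable X]setTI; exact: mg.
Qed.

(** Tonelli's theorem on sections: a fibrewise measure preserving map over a
    measure preserving map of the base preserves the product measure. *)
Lemma mpres_skew d1 d2 d3 d4 (T1 : measurableType d1) (T2 : measurableType d2)
    (T3 : measurableType d3) (T4 : measurableType d4)
    (m1 : {sigma_finite_measure set T1 -> \bar R})
    (m2 : {sigma_finite_measure set T2 -> \bar R})
    (m3 : {sigma_finite_measure set T3 -> \bar R})
    (m4 : {sigma_finite_measure set T4 -> \bar R})
    (f : T1 -> T3) (g : T1 -> T2 -> T4) :
  mpres m1 m3 f -> (forall x, mpres m2 m4 (g x)) ->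
  measurable_fun setT (fun p : T1 * T2 => g p.1 p.2) ->
  mpres (prodm m1 m2) (prodm m3 m4) (fun p => (f p.1, g p.1 p.2)).
Proof.
move=> fP gP mg; have [mf fE] := fP.
split.
  apply: measurable_fun_pair => //; exact: measurableT_comp.
move=> A mA; have mxs := measurable_fun_xsection m4 mA.
rewrite /= /product_measure1 -(mpres_ge0_integral fP)//.
apply: eq_integral => x _ /=; have [mgx gxE] := gP x.
rewrite -gxE; last exact: measurable_xsection.
congr (m2 _); apply/seteqP; split => y /=; by rewrite /xsection /= !inE.
Qed.

Lemma mpres_prod d1 d2 d3 d4 (T1 : measurableType d1) (T2 : measurableType d2)
    (T3 : measurableType d3) (T4 : measurableType d4)
    (m1 : {sigma_finite_measure set T1 -> \bar R})
    (m2 : {sigma_finite_measure set T2 -> \bar R})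
    (m3 : {sigma_finite_measure set T3 -> \bar R})
    (m4 : {sigma_finite_measure set T4 -> \bar R}) f g :
  mpres m1 m3 f -> mpres m2 m4 g ->
  mpres (prodm m1 m2) (prodm m3 m4) (fun p => (f p.1, g p.2)).
Proof.
move=> fP gP; apply: (mpres_skew fP (g := fun=> g)) => //.
by apply: measurableT_comp => //; have [] := gP.
Qed.

Lemma mpres_assoc d1 d2 d3 (T1 : measurableType d1) (T2 : measurableType d2)
    (T3 : measurableType d3)
    (m1 : {sigma_finite_measure set T1 -> \bar R})
    (m2 : {sigma_finite_measure set T2 -> \bar R})
    (m3 : {sigma_finite_measure set T3 -> \bar R}) :
  mpres (prodm m1 (prodm m2 m3)) (prodm (prodm m1 m2) m3)
    (fun p => ((p.1, p.2.1), p.2.2)).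
Proof.
have mphi : measurable_fun setT (fun p : T1 * (T2 * T3) => ((p.1, p.2.1), p.2.2)).
  apply: measurable_fun_pair; last exact: measurableT_comp.
  by apply: measurable_fun_pair => //; exact: measurableT_comp.
split=> // A mA; rewrite /= [RHS]/product_measure1.
rewrite [RHS]fubini_tonelli1; [|exact: measurable_fun_xsection|by []].
apply: eq_integral => x _ /=; rewrite /product_measure1.
apply: eq_integral => y _ /=; congr (m3 _).
by apply/seteqP; split => z /=; rewrite /xsection /= !inE /= /xsection /= !inE.
Qed.

Lemma mpres_swap d1 d2 (T1 : measurableType d1) (T2 : measurableType d2)
    (m1 : {sigma_finite_measure set T1 -> \bar R})
    (m2 : {sigma_finite_measure set T2 -> \bar R}) :
  mpres (prodm m1 m2) (prodm m2 m1) (fun p => (p.2, p.1)).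
Proof.
have mphi : measurable_fun setT (fun p : T1 * T2 => (p.2, p.1)).
  exact: measurable_fun_pair.
split=> // A mA.
rewrite [LHS](product_measure_unique (m1 := m1) (m2 := m2) (m' := m1 \x^ m2)%E)//; last first.
- by rewrite -[X in measurable X]setTI; exact: mphi.
- by move=> B C mB mC; exact: product_measure2E.
Qed.

End measure_preserving.

Lemma cint_fubini2 d1 d2 (T1 : measurableType d1) (T2 : measurableType d2)
    (R : realType) (m1 : {sigma_finite_measure set T1 -> \bar R})
    (m2 : {sigma_finite_measure set T2 -> \bar R})
    (f : T1 * T2 -> R[i]) (g : T2 -> R[i]) v : cint (prodm m1 m2) f v ->
  (forall y, cint m1 (fun x => f (x, y)) (g y)) -> cint m2 g v.
Proof.
move=> fv fg; apply: (@cint_fubini1 _ _ _ _ _ m2 m1 (fun p => f (p.2, p.1))) => //.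
apply: (mpres_cint (mpres_swap m1 m2)).
  apply: (cmeas_comp (cint_cmeas fv)); exact: measurable_fun_pair.
by apply: eq_cint fv => -[].
Qed.

(** * Changes of variable and antiderivatives on the real line *)

Section one_dimensional_changes.
Context {R : realType}.
Local Notation leb := (@lebesgue_measure R).
Local Notation RT := (measurableTypeR R).

(** A measure that agrees with Lebesgue measure on half-open intervals is
    equal to it. *)
Lemma mpres_translation (c : R) : mpres leb leb (fun x : RT => (x + c : RT)).
Proof.
have mt : measurable_fun setT (fun x : RT => (x + c : RT)).
  by apply: measurable_funD.
split=> // A mA.
pose mt_mixin := isMeasurableFun.Build _ _ _ _ _ mt.
pose mt_pack : {mfun RT >-> RT} := HB.pack (fun x : RT => (x + c : RT)) mt_mixin.
apply/esym; apply: (@lebesgue_measure_unique R (pushforward leb mt_pack)) => // _ [[a b]] _ <-.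
change (leb `]a, b]%classic = leb ((fun x : RT => x + c) @^-1` `]a, b]%classic)).
rewrite (_ : (fun x : RT => x + c) @^-1` _ = `]a - c, b - c]%classic); last first.
  by apply/seteqP; split => x /=; rewrite !in_itv/= ltrBlDr lerBrDr.
rewrite !lebesgue_measure_itv/= !lte_fin ltrD2r; case: ifP => // _.
by rewrite -!EFinD; congr EFin; ring.
Qed.

Lemma lebesgue_scaling (k : R) (A : set RT) : 0 < k -> measurable A ->
  (k%:E * leb ((fun x => k * x)%R @^-1` A) = leb A)%E.
Proof.
move=> k0 mA.
have mt : measurable_fun setT (fun x : RT => (k * x : RT)) by apply: measurable_funM.
pose mt_mixin := isMeasurableFun.Build _ _ _ _ _ mt.
pose mt_pack : {mfun RT >-> RT} := HB.pack (fun x : RT => (k * x : RT)) mt_mixin.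
pose kk : {nonneg R} := NngNum (ltW k0).
apply/esym; apply: (@lebesgue_measure_unique R (mscale kk (pushforward leb mt_pack))) => //.
move=> _ [[a b]] _ <-.
change (leb `]a, b]%classic = k%:E * leb ((fun x : RT => k * x)%R @^-1` `]a, b]%classic))%E.
rewrite (_ : (fun x : RT => k * x) @^-1` _ = `]a / k, b / k]%classic); last first.
  by apply/seteqP; split => x /=; rewrite !in_itv/= ltr_pdivrMr// ler_pdivlMr// mulrC.
rewrite !lebesgue_measure_itv/= !lte_fin ltr_pM2r ?invr_gt0//; case: ifP => _; last by rewrite mule0.
by rewrite -!EFinD -EFinM; congr EFin; field; rewrite gt_eqF.
Qed.

Lemma mpres_scaling (k : R) (k0 : 0 < k) :
  mpres (mscale (NngNum (ltW k0)) leb) leb (fun x : RT => (k * x : RT)).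
Proof.
split; first by apply: measurable_funM.
by move=> A mA; exact: lebesgue_scaling.
Qed.

(** Scaling a measure scales the integrals of the positive and negative parts. *)
Lemma cint_mscale d (T : measurableType d) (m : {measure set T -> \bar R})
    (k : {nonneg R}) (f : T -> R[i]) v :
  cint m f v -> cint (mscale k m) f (k%:num%:C * v).
Proof.
move=> [[fr fi] <-].
have I (h : T -> R) : m.-integrable setT (EFin \o h) ->
    (mscale k m).-integrable setT (EFin \o h) /\
    \int[mscale k m]_x h x = k%:num * \int[m]_x h x.
  move=> ih; have mh := measurable_int _ ih; split.
    apply/integrableP; split=> //; rewrite ge0_integral_mscale//; last first.
      exact: measurableT_comp.
    by apply: lte_mul_pinfty => //; have /integrableP[] := ih.
  have E : (\int[mscale k m]_x (EFin \o h) x = k%:num%:E * \int[m]_x (EFin \o h) x)%E.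
    have P : (\int[mscale k m]_x (EFin \o h)^\+ x = k%:num%:E * \int[m]_x (EFin \o h)^\+ x)%E.
      by apply: ge0_integral_mscale => //; exact: measurable_funepos.
    have N : (\int[mscale k m]_x (EFin \o h)^\- x = k%:num%:E * \int[m]_x (EFin \o h)^\- x)%E.
      by apply: ge0_integral_mscale => //; exact: measurable_funeneg.
    transitivity (k%:num%:E * \int[m]_x (EFin \o h)^\+ x - k%:num%:E * \int[m]_x (EFin \o h)^\- x)%E.
      by rewrite [LHS]integralE; congr (_ - _)%E; [exact: P|exact: N].
    rewrite [X in (_ = _ * X)%E]integralE.
    have pf := integrable_pos_fin_num measurableT ih.
    have nf := integrable_neg_fin_num measurableT ih.
    have kB (p q : \bar R) : p \is a fin_num -> q \is a fin_num ->
        (k%:num%:E * p - k%:num%:E * q = k%:num%:E * (p - q))%E.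
      case: p q => [p||] [q||]// _ _.
      by rewrite -EFinB -!EFinM mulrBr.
    exact: kB.
  by rewrite /Rintegral -[in LHS]/(EFin \o h) E fineM//; exact: integrable_fin_num.
have [r1 r2] := I _ fr; have [i1 i2] := I _ fi; split=> //.
by apply: complex_eqP; rewrite ?(ReM, ImM) /= ?r2 ?i2; ring.
Qed.

Lemma cint_scale (f : R -> R[i]) v (k : R) : 0 < k -> cint leb f v ->
  cint leb (fun x => f (k * x)) (k^-1%:C * v).
Proof.
move=> k0 fv; have k'0 : 0 < k^-1 by rewrite invr_gt0.
apply: (mpres_cint (mpres_scaling k'0)).
  by apply: (cmeas_comp (cint_cmeas fv)); apply: measurable_funM.
apply: eq_cint (cint_mscale (NngNum (ltW k'0)) fv) => x.
by rewrite mulrA divff ?mul1r// gt_eqF.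
Qed.

Lemma cint_translate (f : R -> R[i]) v (c : R) : cint leb f v ->
  cint leb (fun x => f (x + c)) v.
Proof.
move=> fv; apply: (mpres_cint (mpres_translation (- c))).
  by apply: (cmeas_comp (cint_cmeas fv)); apply: measurable_funD.
by apply: eq_cint fv => x; rewrite subrK.
Qed.

End one_dimensional_changes.

Section antiderivative.
Context {R : realType}.
Local Notation leb := (@lebesgue_measure R).
Local Notation RT := (measurableTypeR R).
Variables (D : set R) (F f g : R -> R).
Hypothesis dF : forall x, D x -> is_derive x 1 F (f x).
Hypothesis cf : forall x, D x -> {for x, continuous f}.
Hypothesis gf : forall x, D x -> g x = f x.
Hypothesis g0 : forall x, ~ D x -> g x = 0.

Lemma integral_restrict_itv (a b : R) : a < b -> (forall x, a <= x <= b -> D x) ->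
  (\int[leb]_x ((g \_ `[a, b]%classic) x)%:E = (F b - F a)%:E)%E.
Proof.
move=> ab abD.
have -> : (fun x => ((g \_ `[a, b]%classic) x)%:E) = (EFin \o g) \_ `[a, b]%classic.
  by rewrite restrict_EFin.
rewrite -integral_mkcond.
transitivity (\int[leb]_(x in `[a, b]) (f x)%:E)%E.
  by apply: eq_integral => x; rewrite inE /= in_itv/= => /abD Dx; rewrite gf.
have dI x : a <= x <= b -> derivable F x 1 by move=> /abD/dF[].
apply: (@continuous_FTC2 R f F) => //.
- apply: continuous_in_subspaceT => x; rewrite inE /= in_itv/= => /abD; exact: cf.
- split.
  + by move=> x; rewrite in_itv/= => /andP[ax xb]; apply: dI; rewrite !ltW.
  + apply: cvg_at_right_filter; apply/differentiable_continuous/derivable1_diffP.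
    by apply: dI; rewrite lexx ltW.
  + apply: cvg_at_left_filter; apply/differentiable_continuous/derivable1_diffP.
    by apply: dI; rewrite lexx ltW.
- move=> x; rewrite in_itv/= => /andP[ax xb]; rewrite derive1E.
  by have [] := dF (abD x _); rewrite ?(ltW ax) ?(ltW xb).
Qed.

Variables a b : R^nat.
Hypothesis ab : forall n, a n < b n.
Hypothesis abD : forall n x, a n <= x <= b n -> D x.
Hypothesis Dab : forall x, D x -> \forall n \near \oo, a n <= x <= b n.

Lemma cvg_restrict_itv x : ((g \_ `[a n, b n]%classic) x)%:E @[n --> \oo] --> (g x)%:E.
Proof.
apply: cvg_near_cst; have [Dx|Dx] := pselect (D x); last first.
  by apply: nearW => n; rewrite patchE /= g0//; case: ifP.
have := Dab Dx; apply: filterS => n anx.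
have Ix : x \in `[a n, b n]%classic by rewrite inE /= in_itv.
by rewrite patchE Ix.
Qed.

Lemma measurable_restrict_itv n : measurable_fun setT (g : RT -> RT) ->
  measurable_fun setT (fun x : RT => ((g \_ `[a n, b n]%classic) x)%:E).
Proof.
move=> mg; apply/measurable_EFinP; apply/(measurable_restrictT _ _).1.
  exact: measurable_itv.
exact: measurable_funTS.
Qed.

(** Dominated convergence along the intervals. *)
Lemma Rintegral_derivative la lb : leb.-integrable setT (EFin \o g) ->
  F (b n) @[n --> \oo] --> lb -> F (a n) @[n --> \oo] --> la ->
  \int[leb]_x g x = lb - la.
Proof.
move=> ig Fb Fa; have mg := measurable_int _ ig.
suff h1 : (F (b n) - F (a n))%:E @[n --> \oo] --> (\int[leb]_x (g x)%:E)%E.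
  have h2 : (F (b n) - F (a n))%:E @[n --> \oo] --> (lb - la)%:E.
    by apply: cvg_EFin; [exact: nearW|exact: cvgB].
  by rewrite /Rintegral (cvg_unique _ h1 h2).
have ftc n := integral_restrict_itv (ab n) (@abD n).
under eq_fun do rewrite -ftc.
have m1 n := measurable_restrict_itv n ((measurable_EFinP _ _).1 mg).
have c1 : {ae leb, forall x : RT, setT x ->
    ((g \_ `[a n, b n]%classic) x)%:E @[n --> \oo] --> (EFin \o g) x}.
  by apply: aeW => x _; exact: cvg_restrict_itv.
have d1 : {ae leb, forall (x : RT) (n : nat), setT x ->
    (`|((g \_ `[a n, b n]%classic) x)%:E| <= (`|g x|%R)%:E)%E}.
  apply: aeW => x n _; rewrite lee_fin patchE; case: ifP => // _.
  by rewrite normr0.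
have i1 : leb.-integrable setT (fun x : RT => (`|g x|%R)%:E) by exact: integrable_norm ig.
by have [] := @dominated_convergence _ RT R leb setT measurableT
  (fun n x => ((g \_ `[a n, b n]%classic) x)%:E) (EFin \o g) _ m1 mg c1 i1 d1.
Qed.

(** Monotone convergence along the intervals: a nonnegative derivative of a
    function with bounded increments is integrable. *)
Lemma integrable_derivative (M : R) :
  (forall n m, (n <= m)%N -> a m <= a n) -> (forall n m, (n <= m)%N -> b n <= b m) ->
  measurable_fun setT (g : RT -> RT) -> (forall x, 0 <= g x) ->
  (forall n, F (b n) - F (a n) <= M) -> leb.-integrable setT (EFin \o g).
Proof.
move=> na nb mg gp FM.
have c1 (x : RT) := @cvg_restrict_itv x.
have ftc n := integral_restrict_itv (ab n) (@abD n).
have p1 n (x : RT) : setT x -> (0 <= ((g \_ `[a n, b n]%classic) x)%:E)%E.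
  by move=> _; rewrite lee_fin patchE; case: ifP.
have nd (x : RT) : setT x -> nondecreasing_seq (fun n => ((g \_ `[a n, b n]%classic) x)%:E).
  move=> _ n m nm; rewrite lee_fin !patchE; case: ifPn => [|_]; last by case: ifP.
  rewrite inE /= in_itv/= => /andP[ax xb].
  have Ix : x \in `[a m, b m]%classic.
    by rewrite inE /= in_itv/= (le_trans (na _ _ nm) ax) (le_trans xb (nb _ _ nm)).
  by rewrite Ix.
apply/integrableP; split; first exact/measurable_EFinP.
apply: (@le_lt_trans _ _ M%:E); last exact: ltry.
have -> : (\int[leb]_x `|(EFin \o g) x| =
    \int[leb]_x limn (fun n => ((g \_ `[a n, b n]%classic) x)%:E))%E.
  by apply: eq_integral => x _; rewrite (cvg_lim _ (c1 x))//= ger0_norm.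
have cv := @cvg_monotone_convergence _ RT R leb setT measurableT
  (fun n x => ((g \_ `[a n, b n]%classic) x)%:E)
  (fun n => measurable_restrict_itv n mg) p1 nd.
by apply: (cvge_to_le cv); apply: nearW => n; rewrite ftc lee_fin.
Qed.

End antiderivative.

Section complex_antiderivative.
Context {R : realType}.
Local Notation leb := (@lebesgue_measure R).

(** The fundamental theorem of calculus for a complex valued F on a union D of
    intervals, with an absolutely integrable derivative. *)
Lemma cint_derivative (D : set R) (a b : R^nat) (F f g : R -> R[i]) la lb :
  measurable D -> (forall n, a n < b n) ->
  (forall n x, a n <= x <= b n -> D x) ->
  (forall x, D x -> \forall n \near \oo, a n <= x <= b n) ->
  (forall x, D x -> is_derive x 1 (fun x => Re (F x)) (Re (f x))) ->
  (forall x, D x -> is_derive x 1 (fun x => Im (F x)) (Im (f x))) ->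
  (forall x, D x -> ccvg (nbhs x) f (f x)) ->
  (forall x, D x -> g x = f x) -> (forall x, ~ D x -> g x = 0) ->
  cintegrable leb setT g ->
  ccvg \oo (fun n => F (b n)) lb -> ccvg \oo (fun n => F (a n)) la ->
  cint leb g (lb - la).
Proof.
move=> mD ab abD Dab dr di cf gf g0 ig [br bi] [ar ai]; split=> //; case: ig => ir ii.
apply: complex_eqP; rewrite ?(ReImE) /=.
  apply: (@Rintegral_derivative R D (fun x => Re (F x)) (fun x => Re (f x)) _ _ _ _ _ a b) => //.
  - by move=> x /cf[].
  - by move=> x /gf ->.
  - by move=> x /g0 ->.
apply: (@Rintegral_derivative R D (fun x => Im (F x)) (fun x => Im (f x)) _ _ _ _ _ a b) => //.
- by move=> x /cf[].
- by move=> x /gf ->.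
- by move=> x /g0 ->.
Qed.

End complex_antiderivative.

(** * Integrability in Euler's integral *)

Section exhaustion.
Context {R : realType}.

Lemma cvg_expRN (c : R) : 0 < c -> expR (- (c * n.+1%:R)) @[n --> \oo] --> (0 : R).
Proof.
move=> c0; apply/cvgrPdist_le => e e0; near=> n.
rewrite sub0r normrN ger0_norm ?expR_ge0// expRN.
rewrite invf_ple ?posrE ?expR_gt0// (le_trans _ (expR_ge1Dx _))// ler_wpDl//.
rewrite mulrC -ler_pdivrMr//.
apply: (@le_trans _ _ n%:R); last by rewrite ler_nat.
by near: n; exact: nbhs_infty_ger.
Unshelve. all: by end_near. Qed.

Lemma near_exhaust0y (x : R) : 0 < x ->
  \forall n \near \oo, expR (- n.+1%:R) <= x <= n.+1%:R.
Proof.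
move=> x0; near=> n; apply/andP; split; last first.
  apply: (@le_trans _ _ n%:R); last by rewrite ler_nat.
  by near: n; exact: nbhs_infty_ger.
near: n; have := @cvg_expRN 1 ltr01 => /cvgrPdist_lt /(_ x x0).
apply: filterS => n; rewrite sub0r normrN ger0_norm ?expR_ge0// mul1r.
exact: ltW.
Unshelve. all: by end_near. Qed.

Lemma near_exhaustNyy (x : R) : \forall n \near \oo, - n.+1%:R <= x <= n.+1%:R.
Proof.
near=> n; rewrite -ler_norml.
apply: (@le_trans _ _ n%:R); last by rewrite ler_nat.
by near: n; exact: nbhs_infty_ger.
Unshelve. all: by end_near. Qed.

End exhaustion.

Section gamma_kernel_integrable.
Context {R : realType}.
Local Notation leb := (@lebesgue_measure R).
Local Notation RT := (measurableTypeR R).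

(** 1 + ln v <= v at v = u x / (2 p). *)
Lemma ln_le_linear (p x u : R) : 0 < p -> 0 < x -> 0 < u ->
  p * ln u <= u * (x / 2) - p * (1 + ln (x / (2 * p))).
Proof.
move=> p0 x0 u0; set c := x / (2 * p).
have c0 : 0 < c by rewrite divr_gt0// mulr_gt0.
have h : 1 + ln (c * u) <= c * u.
  by rewrite (le_trans (expR_ge1Dx _))// lnK// posrE mulr_gt0.
rewrite lnM ?posrE// in h.
have -> : u * (x / 2) = p * (c * u) by rewrite /c; field; rewrite gt_eqF.
by rewrite -mulrBr ler_pM2l//; lra.
Qed.

(** Half of the exponential rate absorbs the power. *)
Lemma expR_power_le (p x : R) : 0 < x ->
  exists2 C : R, 0 < C &
    forall u, 1 <= u -> expR (p * ln u - u * x) <= C * expR (- (u * (x / 2))).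
Proof.
move=> x0; pose q := Num.max p 1; have q0 : 0 < q by rewrite lt_max ltr01 orbT.
exists (expR (- (q * (1 + ln (x / (2 * q)))))); first exact: expR_gt0.
move=> u u1; have u0 : 0 < u by apply: lt_le_trans u1.
rewrite -expRD ler_expR.
have h1 : p * ln u <= q * ln u by rewrite ler_wpM2r ?ln_ge0// le_max lexx.
have h2 := ln_le_linear q0 x0 u0.
have e : u * x = u * (x / 2) + u * (x / 2) by field.
by rewrite e; lra.
Qed.

Lemma integrable_expRN (c : R) : 0 < c ->
  leb.-integrable setT (EFin \o (fun u => if 0 < u then expR (- (u * c)) else 0)).
Proof.
move=> c0.
apply: (@integrable_derivative R [set u | 0 < u] (fun u => - c^-1 * expR (- (u * c)))
  (fun u => expR (- (u * c))) _ _ _ _ _ (fun n => expR (- n.+1%:R)) (fun n => n.+1%:R)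
  _ _ _ c^-1).
- move=> x _; apply: is_derive_eq; rewrite ?scaler1 /GRing.scale /=.
  by field; rewrite gt_eqF.
- move=> x _; apply: continuous_cvg; first exact: continuous_expR.
  by apply: cvgN; apply: cvgM; [exact: cvg_id|exact: cvg_cst].
- by move=> x /= ->.
- by move=> x /negP/negbTE ->.
- move=> n; apply: (@lt_le_trans _ _ 1); last by rewrite ler1n.
  by rewrite -expR0 ltr_expR oppr_lt0.
- by move=> n x /andP[+ _]; apply: lt_le_trans; exact: expR_gt0.
- by move=> x; exact: near_exhaust0y.
- by move=> n m nm; rewrite ler_expR lerN2 ler_nat.
- by move=> n m nm; rewrite ler_nat.
- apply: measurable_fun_ifT; [exact: measurable_fun_ltr| |exact: measurable_cst].
  apply: measurableT_comp => //; apply: measurableT_comp => //; exact: measurable_funM.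
- by move=> x; case: ifP => // _; exact: expR_ge0.
- move=> n; set A := expR _; set B := expR _.
  have B1 : B <= 1 by rewrite -expR0 ler_expR oppr_le0 mulr_ge0 ?expR_ge0 ?ltW.
  have A0 : 0 <= A by exact: expR_ge0.
  have -> : - c^-1 * A - - c^-1 * B = c^-1 * (B - A) by ring.
  by rewrite -[leRHS]mulr1 ler_pM2l ?invr_gt0//; lra.
Qed.

Lemma integrable_power01 (a : R) : 0 < a ->
  leb.-integrable setT
    (EFin \o (fun u => if 0 < u <= 1 then expR ((a - 1) * ln u) else 0)).
Proof.
move=> a0.
apply: (@integrable_derivative R [set u | 0 < u <= 1] (fun u => a^-1 * expR (a * ln u))
  (fun u => expR ((a - 1) * ln u)) _ _ _ _ _ (fun n => expR (- n.+1%:R)) (fun=> 1)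
  _ _ _ a^-1).
- move=> x /andP[x0 x1]; have := is_derive1_ln x0 => dl.
  apply: is_derive_eq; rewrite ?scaler1 /GRing.scale /=.
  rewrite mulrBl mul1r expRB lnK//; by field; rewrite !gt_eqF.
- move=> x /andP[x0 x1]; apply: continuous_cvg; first exact: continuous_expR.
  by apply: cvgM; [exact: cvg_cst|exact: continuous_ln].
- by move=> x /= ->.
- by move=> x /negP/negbTE ->.
- by move=> n; rewrite -[ltRHS]expR0 ltr_expR oppr_lt0.
- move=> n x /andP[h1 h2] /=; rewrite h2 andbT.
  by apply: lt_le_trans h1; exact: expR_gt0.
- move=> x /andP[x0 x1]; have := near_exhaust0y x0; apply: filterS => n /andP[-> _].
  by rewrite x1.
- by move=> n m nm; rewrite ler_expR lerN2 ler_nat.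
- by [].
- apply: measurable_fun_ifT; [|  |exact: measurable_cst].
    by apply: measurable_and; [exact: measurable_fun_ltr|exact: measurable_fun_ler].
  apply: measurableT_comp => //; apply: measurable_funM => //; exact: measurable_ln.
- by move=> x; case: ifP => // _; exact: expR_ge0.
- move=> n; rewrite ln1 mulr0 expR0 mulr1 lerBlDr lerDl.
  by rewrite mulr_ge0 ?expR_ge0// invr_ge0 ltW.
Qed.

(** The power alone dominates on ]0, 1], and the exponential with half the
    rate beyond 1. *)
Lemma integrable_gamma_real (a x : R) : 0 < a -> 0 < x ->
  leb.-integrable setT
    (EFin \o (fun u => if 0 < u then expR ((a - 1) * ln u - u * x) else 0)).
Proof.
move=> a0 x0; have [C C0 H] := expR_power_le (a - 1) x0.
have x20 : 0 < x / 2 by lra.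
have i1 := integrableZl measurableT C (integrable_expRN x20).
have i2 : leb.-integrable setT (EFin \o (fun u =>
    (if 0 < u <= 1 then expR ((a - 1) * ln u) else 0) +
    C * (if 0 < u then expR (- (u * (x / 2))) else 0))).
  exact: (integrableD measurableT (integrable_power01 a0) i1).
apply: (le_integrable measurableT _ _ i2).
  apply/measurable_EFinP; apply: measurable_fun_ifT; [exact: measurable_fun_ltr| |exact: measurable_cst].
  apply: measurableT_comp => //; apply: measurable_funB; last exact: measurable_funM.
  by apply: measurable_funM => //; exact: measurable_ln.
move=> u _ /=; rewrite lee_fin; have [u0|u0] := ltP 0 u; last first.
  by rewrite normr0.
rewrite ger0_norm ?expR_ge0//; apply: le_trans (ler_norm _).
have [u1|u1] := leP u 1; last by rewrite add0r; apply: H; exact: ltW.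
rewrite ler_wpDr ?mulr_ge0 ?expR_ge0 ?(ltW C0)// ler_expR gerBl.
by rewrite mulr_ge0 ?ltW.
Qed.

End gamma_kernel_integrable.

(** * Derivatives of complex functions *)

Section complex_derivative.
Context {R : realType}.
Implicit Types (f g : R -> R[i]) (x : R) (z w : R[i]).

Definition cderive f x z := is_derive x 1 (fun y => Re (f y)) (Re z) /\
  is_derive x 1 (fun y => Im (f y)) (Im z).

Lemma eq_cderive f g x z : (forall y, f y = g y) -> cderive f x z -> cderive g x z.
Proof. by move=> /funext ->. Qed.

Lemma cderive_eq f x z w : cderive f x z -> z = w -> cderive f x w.
Proof. by move=> + <-. Qed.

Lemma is_deriveT (f : R -> R) x (a b : R) : is_derive x 1 f a -> a = b -> is_derive x 1 f b.
Proof. by move=> + <-. Qed.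

Lemma cderive_cst z x : cderive (fun=> z) x 0.
Proof. by split; exact: is_derive_cst. Qed.

Lemma cderiveC (f : R -> R) x (a : R) : is_derive x 1 f a -> cderive (fun y => (f y)%:C) x a%:C.
Proof. by move=> H; split=> //; exact: is_derive_cst. Qed.

Lemma cderiveD f g x z w : cderive f x z -> cderive g x w ->
  cderive (fun y => f y + g y) x (z + w).
Proof.
move=> [fr fi] [gr gi]; split; rewrite ReImE; under eq_fun do rewrite ReImE.
  exact: is_deriveD.
exact: is_deriveD.
Qed.

Lemma cderiveN f x z : cderive f x z -> cderive (fun y => - f y) x (- z).
Proof.
move=> [fr fi]; split; rewrite ReImE; under eq_fun do rewrite ReImE.
  exact: is_deriveN.
exact: is_deriveN.
Qed.

Lemma cderiveM f g x z w : cderive f x z -> cderive g x w ->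
  cderive (fun y => f y * g y) x (z * g x + f x * w).
Proof.
move=> [fr fi] [gr gi]; split; rewrite !ReImE; under eq_fun do rewrite ReImE.
  apply: (is_deriveT (is_deriveB (is_deriveM fr gr) (is_deriveM fi gi))).
  by rewrite /GRing.scale /=; ring.
apply: (is_deriveT (is_deriveD (is_deriveM fr gi) (is_deriveM fi gr))).
by rewrite /GRing.scale /=; ring.
Qed.

Lemma cderiveZ c f x z : cderive f x z -> cderive (fun y => c * f y) x (c * z).
Proof.
move=> fz; apply: cderive_eq (cderiveM (cderive_cst c x) fz) _.
by rewrite mul0r add0r.
Qed.

Lemma cderive_cexp f x z : cderive f x z ->
  cderive (fun y => cexp (f y)) x (z * cexp (f x)).
Proof.
move=> [fr fi].
have er : is_derive x 1 (fun y => expR (Re (f y))) (expR (Re (f x)) * Re z).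
  exact: (is_derive1_comp (f := expR)).
have ci : is_derive x 1 (fun y => cos (Im (f y))) (- sin (Im (f x)) * Im z).
  exact: (is_derive1_comp (f := cos)).
have si : is_derive x 1 (fun y => sin (Im (f y))) (cos (Im (f x)) * Im z).
  exact: (is_derive1_comp (f := sin)).
split; rewrite !(ReImE, Re_cexp, Im_cexp); under eq_fun do rewrite ?Re_cexp ?Im_cexp.
  apply: (is_deriveT (is_deriveM er ci)); rewrite /GRing.scale /=; ring.
apply: (is_deriveT (is_deriveM er si)); rewrite /GRing.scale /=; ring.
Qed.

Lemma cderive_comp f (g : R -> R) x z (a : R) : cderive f (g x) z -> is_derive x 1 g a ->
  cderive (fun y => f (g y)) x (a%:C * z).
Proof.
move=> [fr fi] ga; split; rewrite !ReImE mul0r ?subr0 ?addr0 mulrC.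
  exact: (is_derive1_comp (f := fun y => Re (f y))).
exact: (is_derive1_comp (f := fun y => Im (f y))).
Qed.

Lemma cderive_ccvg f x z : cderive f x z -> ccvg (nbhs x) f (f x).
Proof.
by move=> [[fr _] [fi _]]; split; apply/differentiable_continuous/derivable1_diffP.
Qed.

Lemma cderive0_cst f (a b : R) : (forall x, cderive f x 0) -> f a = f b.
Proof.
move=> H; apply: complex_eqP.
  by apply: (@is_derive_0_is_cst _ (fun y => Re (f y))) => x; have [] := H x.
by apply: (@is_derive_0_is_cst _ (fun y => Im (f y))) => x; have [] := H x.
Qed.

(** The line Re z = 1; the values 1 and -1 of k give 1 + ix and 1 - ix. *)
Definition vline (k s : R) : R[i] := 1 +i* (k * s).

Lemma Re_vline k s : 0 < Re (vline k s). Proof. exact: ltr01. Qed.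

Lemma Re_vlineE k s : Re (vline k s) = 1. Proof. by []. Qed.
Lemma Im_vlineE k s : Im (vline k s) = k * s. Proof. by []. Qed.
Lemma ReI : Re ('i : R[i]) = 0. Proof. by []. Qed.
Lemma ImI : Im ('i : R[i]) = 1. Proof. by []. Qed.
Definition vlineE := (Re_vlineE, Im_vlineE, ReI, ImI).

Lemma vline_neq0 k s : vline k s != 0. Proof. by rewrite Re_gt0_neq0. Qed.

Lemma cderive_vline k x : cderive (vline k) x (k%:C * 'i).
Proof.
have d : is_derive x 1 (fun s => k * s) k by apply: is_derive_eq; rewrite /GRing.scale /= mulr1.
split; first by apply: (is_deriveT (is_derive_cst (1 : R) x 1)); rewrite !(ReImE, vlineE); ring.
by apply: (is_deriveT d); rewrite !(ReImE, vlineE); ring.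
Qed.

Lemma normc_vline k s : normc (vline k s) = Num.sqrt (1 + (k * s) ^+ 2).
Proof. by rewrite /= expr1n. Qed.

Lemma cderive_hln_vline k x : cderive (fun s => hln (vline k s)) x (k%:C * 'i / vline k x).
Proof.
have d : is_derive x 1 (fun s => k * s) k by apply: is_derive_eq; rewrite /GRing.scale /= mulr1.
have p0 s : 0 < 1 + (k * s) ^+ 2 by rewrite ltr_pwDl ?sqr_ge0.
have n0 : 1 + (k * x) ^+ 2 != 0 by rewrite gt_eqF.
split; rewrite !(ReImE, ReV, ImV, vlineE) expr1n !(mulr0, mul0r, mulr1, addr0, subr0, sub0r, add0r, mul1r).
  rewrite (_ : (fun _ => _) = (fun s => 2^-1 * ln (1 + (k * s) ^+ 2))); last first.
    by apply/funext => s; rewrite -[RHS]ln_powR powR12_sqrt ?ltW// Re_hln normc_vline.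
  have dl := is_derive1_ln (p0 x).
  have dq : is_derive x 1 (fun s => 1 + (k * s) ^+ 2) (2 * (k * x) * k).
    apply: is_derive_eq; rewrite /GRing.scale /=; ring.
  have dc := is_derive1_comp (f := @ln R) (g := fun s => 1 + (k * s) ^+ 2) dl dq.
  have dm := is_deriveM (is_derive_cst (2^-1 : R) x (1 : R)) dc.
  apply: (is_deriveT dm).
  by rewrite /GRing.scale /=; field.
rewrite (_ : (fun _ => _) = (fun s => atan (k * s))); last first.
  by apply/funext => s; rewrite Im_hln !vlineE divr1.
have dc := is_derive1_comp (f := atan) (g := fun s => k * s) (is_derive1_atan (k * x)) d.
have e : (1 + (k * x) ^+ 2)^-1 * k = k * (1 * (1 + (k * x) ^+ 2)^-1).
  by rewrite mul1r mulrC.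
exact: (is_deriveT dc e).
Qed.

Lemma cderive_hpow_vline k a x : cderive (fun s => hpow (vline k s) a 0) x
  (a * (k%:C * 'i) * hpow (vline k x) (a - 1) 0).
Proof.
have H := cderive_cexp (cderiveZ a (cderive_hln_vline k x)).
apply: cderive_eq.
  by apply: eq_cderive H => s; rewrite /hpow mul0r addr0.
have -> : cexp (a * hln (vline k x)) = hpow (vline k x) a 0.
  by rewrite /hpow mul0r addr0.
have -> : hpow (vline k x) (a - 1) 0 = hpow (vline k x) a 0 * hpow (vline k x) (-1) 0.
  by rewrite -hpowD addr0.
have -> : hpow (vline k x) (-1) 0 = (vline k x)^-1.
  by rewrite -[in RHS](hpow10 (Re_vline k x)) -hpowN oppr0.
by field; rewrite vline_neq0.
Qed.

End complex_derivative.

(** * Euler's integral *)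

Section gamma.
Context {R : realType}.
Local Notation leb := (@lebesgue_measure R).
Local Notation RT := (measurableTypeR R).
Implicit Types (t z : R[i]).

(** The integrand of Gamma (t) z ^ (-t) = int_0^oo u ^ (t - 1) e ^ (- u z) du. *)
Definition gker t z (u : R) : R[i] :=
  if 0 < u then cexp ((t - 1) * (ln u)%:C - u%:C * z) else 0.

Definition gint t z : R[i] := cintegral leb setT (gker t z).

Lemma normc_gker t z u :
  normc (gker t z u) = if 0 < u then expR ((Re t - 1) * ln u - u * Re z) else 0.
Proof.
rewrite /gker; case: ifP => _; last exact: Normc.normc0.
by rewrite normc_cexp !ReImE; congr expR; ring.
Qed.

Lemma cmeas_gker t z : cmeas (gker t z : RT -> R[i]).
Proof.
apply: cmeas_if; [exact: measurable_fun_ltr| |exact: cmeas_cst].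
apply: cmeas_cexp; apply: cmeasB; apply: cmeasM; try exact: cmeas_cst.
  by apply: cmeasC; exact: measurable_ln.
by apply: cmeasC.
Qed.

Lemma gker_cint t z : 0 < Re t -> 0 < Re z -> cint leb (gker t z) (gint t z).
Proof.
move=> t0 z0; apply: cintegrable_cint.
apply: (cintegrable_dom (cmeas_gker t z) (integrable_gamma_real t0 z0)) => u.
by rewrite normc_gker.
Qed.

Lemma euler_gammaE t : 0 < Re t -> euler_gamma t = gint t 1.
Proof.
move=> t0.
have [| |h _] := @cint_mkcond _ _ _ leb `]0, +oo[%classic
  (fun u => rpowc u (t - 1) * (expR (- u))%:C) (gker t 1) (gint t 1)
  (measurable_itv `]0, +oo[).
- move=> u /=; rewrite in_itv/= andbT /gker => ->.
  by rewrite /rpowc -cexp_real -cexpD; congr cexp; rewrite mulr1 rmorphN.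
- move=> u /=; rewrite in_itv/= andbT /gker => /negP/negbTE -> //.
- by have [] := h (gker_cint t0 (ltr01 : 0 < Re (1 : R[i]))).
Qed.

Lemma gker_succ t z u : gker (t + 1) z u = u%:C * gker t z u.
Proof.
rewrite /gker; case: ifP => u0; last by rewrite mulr0.
rewrite -{3}(lnK u0) -cexp_real -cexpD; congr cexp.
by ring.
Qed.

(** Integrate the derivative of u ^ t e ^ (- u z), which vanishes at both
    ends. *)
Lemma gint_succ t z : 0 < Re t -> 0 < Re z -> z * gint (t + 1) z = t * gint t z.
Proof.
move=> t0 z0.
have t10 : 0 < Re (t + 1) by rewrite !ReImE; lra.
have g1 := gker_cint t0 z0; have g2 := gker_cint t10 z0.
pose F u := cexp (t * (ln u)%:C - u%:C * z).
pose f (u : R) := (t * (u^-1)%:C - z) * F u.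
have dF u : 0 < u -> cderive F u (f u).
  move=> u0; apply: cderive_cexp; apply: cderiveD.
    exact: cderiveZ (cderiveC (is_derive1_ln u0)).
  apply: cderiveN.
  apply: (@eq_cderive _ (fun y => z * y%:C)); first by move=> y; rewrite mulrC.
  apply: cderive_eq (cderiveZ z (cderiveC (is_derive_id u 1))) _.
  by rewrite mulr1.
have gf := cintB (cintZ t g1) (cintZ z g2).
have h : cint leb (fun u => t * gker t z u - z * gker (t + 1) z u) (0 - 0).
  apply: (@cint_derivative _ [set u | 0 < u] (fun n => expR (- n.+1%:R))
    (fun n => n.+1%:R) F f _ 0 0).
  - by apply: open_measurable; exact: open_gt.
  - move=> n; apply: (@lt_le_trans _ _ 1); last by rewrite ler1n.
    by rewrite -expR0 ltr_expR oppr_lt0.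
  - by move=> n x /andP[+ _]; apply: lt_le_trans; exact: expR_gt0.
  - by move=> x; exact: near_exhaust0y.
  - by move=> x /dF[].
  - by move=> x /dF[].
  - move=> x /= x0; apply: ccvgM; last exact: cderive_ccvg (dF _ x0).
    apply: ccvgB; last exact: ccvg_cst.
    apply: ccvgM; first exact: ccvg_cst.
    by apply: ccvgC; apply: cvgV; [rewrite gt_eqF|exact: cvg_id].
  - move=> u /= u0; rewrite gker_succ /f /gker u0.
    have -> : F u = u%:C * cexp ((t - 1) * (ln u)%:C - u%:C * z).
      rewrite -{2}(lnK u0) -cexp_real -cexpD; congr cexp; ring.
    rewrite rmorphV ?unitfE ?gt_eqF//=; field.
    by rewrite (_ : 0 = 0%:C)// (inj_eq (@complexI R)) gt_eqF.
  - by move=> u /negP/negbTE u0; rewrite /gker u0 !mulr0 subr0.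
  - by have [] := gf.
  - apply: ccvg_normc0.
    have [C C0 H] := expR_power_le (Re t) z0.
    apply: (@squeeze_cvgr _ _ _ _ (fun=> 0) (fun n => C * expR (- (Re z / 2 * n.+1%:R)))).
    + apply: nearW => n; apply/andP; split; first exact: normc_ge0.
      rewrite normc_cexp !ReImE.
      have -> : Re t * ln n.+1%:R - Im t * 0 - (n.+1%:R * Re z - 0 * Im z) =
        Re t * ln n.+1%:R - n.+1%:R * Re z by ring.
      by rewrite [Re z / 2 * _]mulrC; apply: H; rewrite ler1n.
    + exact: cvg_cst.
    + rewrite -[X in _ --> X](mulr0 C); apply: cvgM; first exact: cvg_cst.
      by apply: cvg_expRN; rewrite divr_gt0.
  - apply: ccvg_normc0.
    apply: (@squeeze_cvgr _ _ _ _ (fun=> 0) (fun n => expR (- (Re t * n.+1%:R)))).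
    + apply: nearW => n; apply/andP; split; first exact: normc_ge0.
      rewrite normc_cexp !ReImE ler_expR expRK.
      have : 0 <= expR (- n.+1%:R) * Re z by rewrite mulr_ge0 ?expR_ge0// ltW.
      by lra.
    + exact: cvg_cst.
    + exact: cvg_expRN.
have := cint_unique gf h; rewrite subr0 => /eqP; rewrite subr_eq0 => /eqP -> //.
Qed.

Lemma gint_scale t z (x : R) : 0 < Re t -> 0 < Re z -> 0 < x ->
  gint t (x%:C * z) = rpowc x (- t) * gint t z.
Proof.
move=> t0 z0 x0; have xz0 : 0 < Re (x%:C * z) by rewrite !ReImE mul0r subr0 mulr_gt0.
have h := cint_scale x0 (gker_cint t0 z0).
apply: (cint_unique (gker_cint t0 xz0)).
have -> : rpowc x (- t) * gint t z = rpowc x (1 - t) * (x^-1%:C * gint t z).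
  rewrite mulrA; congr (_ * _); rewrite rpowcD -[(x^-1)%:C]rpowc1 ?invr_gt0//.
  by rewrite rpowcV// mulrAC divff ?mul1r// rpowc_neq0.
apply: eq_cint (cintZ (rpowc x (1 - t)) h) => u.
rewrite /gker pmulr_rgt0//; case: ifP => u0; last by rewrite mulr0.
rewrite /rpowc -cexpD lnM//; congr cexp; rewrite rmorphD rmorphM/=; ring.
Qed.

End gamma.

(** * Differentiation under the integral and complex scaling *)

Section under_integral.
Context {R : realType} d (Y : measurableType d) (mu : {measure set Y -> \bar R}).

Lemma cderive_under (f df : R -> Y -> R[i]) (G : Y -> R) (a u v : R) :
  u < a < v ->
  (forall x, u < x < v -> cintegrable mu setT (f x)) ->
  (forall x y, u < x < v -> cderive (f ^~ y) x (df x y)) ->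
  mu.-integrable setT (EFin \o G) ->
  (forall x y, u < x < v -> normc (df x y) <= G y) ->
  cderive (fun x => cintegral mu setT (f x)) a (cintegral mu setT (df a)).
Proof.
move=> uav fi fd iG dfG.
have aI : `]u, v[%classic a by rewrite /= in_itv.
have G0 y : 0 <= G y by apply: le_trans (dfG a y uav); exact: normc_ge0.
have D (h : R -> Y -> R) (dh : R -> Y -> R) :
    (forall x, u < x < v -> mu.-integrable setT (EFin \o h x)) ->
    (forall x y, u < x < v -> is_derive x 1 (h ^~ y) (dh x y)) ->
    (forall x y, u < x < v -> `|dh x y| <= G y) ->
    is_derive a 1 (fun x => \int[mu]_y h x y) (\int[mu]_y dh a y).
  move=> hi hd hG.
  have p1 x y : u < x < v -> partial1of2 h x y = dh x y.
    by move=> xI; rewrite partial1of2E; have [] := hd x y xI.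
  have H1 x : `]u, v[%classic x -> mu.-integrable setT (EFin \o h x).
    by rewrite /= in_itv/= => /hi.
  have H2 x y : `]u, v[%classic x -> setT y -> derivable (h ^~ y) x 1.
    by rewrite /= in_itv/= => /(hd x y)[].
  have H3 x y : `]u, v[%classic x -> setT y -> `|partial1of2 h x y| <= G y.
    by rewrite /= in_itv/= => xI _; rewrite p1// hG.
  have E := differentiation_under_integral measurableT aI H1 H2 G0 iG H3.
  have dd := derivable_under_integral measurableT aI H1 H2 G0 iG H3.
  apply: DeriveDef => //; rewrite -derive1E E.
  by apply: eq_Rintegral => y _; rewrite p1.
split.
  apply: (D (fun x y => Re (f x y)) (fun x y => Re (df x y))).
  - by move=> x /fi[].
  - by move=> x y xI; have [] := fd x y xI.
  - by move=> x y xI; apply: le_trans (normRe _) (dfG x y xI).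
apply: (D (fun x y => Im (f x y)) (fun x y => Im (df x y))).
- by move=> x /fi[].
- by move=> x y xI; have [] := fd x y xI.
- by move=> x y xI; apply: le_trans (normIm _) (dfG x y xI).
Qed.

End under_integral.

Section gamma_complex_scale.
Context {R : realType}.
Local Notation leb := (@lebesgue_measure R).
Implicit Types (t z : R[i]).

Lemma cderive_gker t k u s :
  cderive (fun s => gker t (vline k s) u) s (- (k%:C * 'i) * gker (t + 1) (vline k s) u).
Proof.
rewrite gker_succ /gker; case: ifP => u0; last first.
  by apply: cderive_eq (cderive_cst _ _) _; rewrite !mulr0.
have H : cderive (fun s => (t - 1) * (ln u)%:C - u%:C * vline k s) s (- (u%:C * (k%:C * 'i))).
  apply: cderive_eq.
    apply: cderiveD; first exact: cderive_cst.
    by apply: cderiveN; apply: cderiveZ; exact: cderive_vline.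
  by rewrite add0r.
apply: cderive_eq (cderive_cexp H) _.
by ring.
Qed.

Lemma cderive_gint t k s : 0 < Re t ->
  cderive (fun s => gint t (vline k s)) s (- (k%:C * 'i) * gint (t + 1) (vline k s)).
Proof.
move=> t0; have t10 : 0 < Re (t + 1) by rewrite !ReImE; lra.
have -> : - (k%:C * 'i) * gint (t + 1) (vline k s) =
    cintegral leb setT (fun u => - (k%:C * 'i) * gker (t + 1) (vline k s) u).
  by have [_ ->] := cintZ (- (k%:C * 'i)) (gker_cint t10 (Re_vline k s)).
apply: (@cderive_under R _ _ leb (fun s => gker t (vline k s))
  (fun s u => - (k%:C * 'i) * gker (t + 1) (vline k s) u)
  (fun u => `|k| * normc (gker (t + 1) 1 u)) s (s - 1) (s + 1)).
- by apply/andP; split; lra.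
- by move=> x _; have [] := gker_cint t0 (Re_vline k x).
- by move=> x u _; exact: cderive_gker.
- have [h _] := gker_cint t10 (ltr01 : 0 < Re (1 : R[i])).
  by have := integrableZl measurableT `|k| (integrable_normc h).
- move=> x u _; rewrite Normc.normcM normcN Normc.normcM normcC.
  rewrite (_ : normc 'i = 1) ?mulr1; last by rewrite /= expr0n expr1n add0r sqrtr1.
  by rewrite !normc_gker.
Qed.

(** Both sides of gint t z * z ^ t = Gamma (t) have derivative zero along the
    line Re z = 1. *)
Lemma gint_vline t k s : 0 < Re t ->
  gint t (vline k s) = gint t 1 * hpow (vline k s) (- t) 0.
Proof.
move=> t0.
pose f s := gint t (vline k s) * hpow (vline k s) t 0.
have df x : cderive f x 0.
  apply: cderive_eq (cderiveM (cderive_gint k x t0) (cderive_hpow_vline k t x)) _.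
  have e : gint (t + 1) (vline k x) = t * gint t (vline k x) / vline k x.
    by rewrite -(gint_succ t0 (Re_vline k x)) mulrAC divff ?mul1r// vline_neq0.
  have e2 : hpow (vline k x) t 0 = hpow (vline k x) (t - 1) 0 * vline k x.
    by rewrite -[X in _ = _ * X](hpow10 (Re_vline k x)) -hpowD subrK addr0.
  by rewrite e e2; field; rewrite vline_neq0.
have v0 : vline k 0 = 1 by rewrite /vline mulr0.
have := cderive0_cst s 0 df; rewrite /f v0.
have -> : hpow (1 : R[i]) t 0 = 1 by rewrite (hpow_real t 0 (ltr01 : 0 < (1 : R))) rpow1c.
rewrite mulr1 => <-; rewrite -mulrA -hpowD addrN addr0.
by rewrite /hpow !mul0r addr0 cexp0 mulr1.
Qed.

(** The integrand is nonnegative, and bounded from below on [1, 2]. *)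
Lemma gint_gt0 (p : R) : 0 < p -> 0 < Re (gint p%:C 1).
Proof.
move=> p0; have h := gker_cint (p0 : 0 < Re p%:C) (ltr01 : 0 < Re (1 : R[i])).
rewrite -(Re_cintegral h).
pose c := expR (- `|p - 1| - 2).
have c0 : 0 < c by exact: expR_gt0.
apply: (@lt_le_trans _ _ (\int[leb]_x (c * \1_(`[1, 2]%classic) x))).
  rewrite RintegralZl//; last exact: integrable_indic_itv.
  rewrite mulr_gt0// (_ : \int[leb]_x _ = 1)// /Rintegral integral_indic// setIT.
  have e : leb `[1 : R, 2]%classic = 1%:E.
    by rewrite lebesgue_measure_itv/= lte_fin ltr1n -EFinB; congr EFin; ring.
  by etransitivity; [apply: congr1; exact: e|].
apply: le_Rintegral => //.
- by have := integrableZl measurableT c (@integrable_indic_itv R 1 2 true false).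
- by have [[]] := h.
move=> x _; rewrite indicE; case: (boolP (x \in _)) => [|_]; last first.
  rewrite mulr0 /gker; case: ifP => // _.
  have -> : cexp ((p%:C - 1) * (ln x)%:C - x%:C * 1) = (expR ((p - 1) * ln x - x))%:C.
    by rewrite -cexp_real; congr cexp; rewrite rmorphB rmorphM rmorphB/=; ring.
  exact: expR_ge0.
rewrite inE /= in_itv/= => /andP[x1 x2].
have x0 : 0 < x by apply: lt_le_trans x1.
rewrite /gker x0 [c * 1]mulr1.
have -> : cexp ((p%:C - 1) * (ln x)%:C - x%:C * 1) = (expR ((p - 1) * ln x - x))%:C.
  by rewrite -cexp_real; congr cexp; rewrite rmorphB rmorphM rmorphB/=; ring.
rewrite /= ler_expR; have l0 := ln_ge0 x1.
have l1 : ln x <= 1.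
  have := ln_sublinear x0.
  have : ln x <= x - 1.
    by have := @le_ln1Dx R (x - 1); rewrite [1 + _]addrC subrK; apply; lra.
  lra.
have : - `|p - 1| <= (p - 1) * ln x.
  rewrite lerNl -mulNr; apply: (@le_trans _ _ (`|p - 1| * ln x)).
    by rewrite ler_wpM2r// -normrN ler_norm.
  by rewrite ler_piMr.
lra.
Qed.

End gamma_complex_scale.

(** * The Gamma function *)

Section gamma_function.
Context {R : realType}.
Local Notation leb := (@lebesgue_measure R).
Local Notation RT := (measurableTypeR R).
Implicit Types (t z : R[i]).

Lemma cgamma_gint z : 0 < Re z -> cgamma z = gint z 1.
Proof.
by move=> z0; rewrite /cgamma z0 addr0 big_ord0 divr1 euler_gammaE.
Qed.

Lemma gint1_succ t : 0 < Re t -> gint (t + 1) 1 = t * gint t 1.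
Proof. by move=> t0; rewrite -(gint_succ t0 (ltr01 : 0 < Re (1 : R[i]))) mul1r. Qed.

(** The convention at the poles makes this hold on the whole plane. *)
Lemma rgamma_succ z : (cgamma z)^-1 = z * (cgamma (z + 1))^-1.
Proof.
have [z0|z0] := ltP 0 (Re z).
  have z10 : 0 < Re (z + 1) by rewrite !ReImE; lra.
  rewrite !cgamma_gint// gint1_succ// invfM mulrA divff ?mul1r//.
  exact: Re_gt0_neq0.
pose m (w : R[i]) := if 0 < Re w then 0%N else (Num.truncn (- Re w)).+1.
have mS : m z = (m (z + 1)).+1.
  rewrite /m ltNge z0/= !ReImE; case: ltP => z1; congr S.
    by apply/eqP; rewrite truncn_eq; [rewrite oppr_ge0 z0/=; lra|lra].
  apply: truncn_def; have := @truncn_itv R (- (Re z + 1)); rewrite oppr_ge0 => /(_ z1).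
  move=> /andP[h1 h2]; rewrite -[X in _ < X]natr1 -[X in X <= _]natr1.
  rewrite -[X in _ < X + 1]natr1.
  by apply/andP; split; move: h1 h2; rewrite -[X in _ < X -> _]natr1; lra.
rewrite /cgamma -!/(m _) mS big_ord_recl addr0 !invf_div -mulrA; congr (_ * (_ / _)).
  by apply: eq_bigr => j _; rewrite -addrA [1 + _]addrC natr1.
by congr euler_gamma; rewrite -addrA [1 + _]addrC natr1.
Qed.

Lemma gint11 : gint 1 1 = 1 :> R[i].
Proof.
have d1 (x : R) : cderive (fun u => cexp (- u%:C)) x (- cexp (- x%:C)).
  apply: cderive_eq (cderive_cexp (cderiveN (cderiveC (is_derive_id x 1)))) _.
  by rewrite mulN1r.
have d (x : R) : cderive (fun u => - cexp (- u%:C)) x (cexp (- x%:C)).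
  by apply: cderive_eq (cderiveN (d1 x)) _; rewrite opprK.
have e0 := cvg_expRN (ltr01 : 0 < (1 : R)).
have h : cint leb (gker 1 1) (- 0 - (- cexp (- 0%:C)) : R[i]).
  apply: (@cint_derivative _ [set u | 0 < u] (fun n => expR (- (1 * n.+1%:R)))
    (fun n => n.+1%:R) (fun u => - cexp (- u%:C)) (fun u => cexp (- u%:C))).
  - by apply: open_measurable; exact: open_gt.
  - move=> n; apply: (@lt_le_trans _ _ 1); last by rewrite ler1n.
    by rewrite mul1r -expR0 ltr_expR oppr_lt0.
  - by move=> n x /andP[+ _]; apply: lt_le_trans; exact: expR_gt0.
  - move=> x /near_exhaust0y; apply: filterS => n; by rewrite mul1r.
  - by move=> x _; have [] := d x.
  - by move=> x _; have [] := d x.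
  - by move=> x _; exact: cderive_ccvg (d1 x).
  - by move=> u /= u0; rewrite /gker u0 subrr mul0r sub0r mulr1.
  - by move=> u /negP/negbTE u0; rewrite /gker u0.
  - by have [] := gker_cint (ltr01 : 0 < Re (1 : R[i])) (ltr01 : 0 < Re (1 : R[i])).
  - apply: ccvgN; apply: ccvg_normc0.
    apply: cvg_trans e0; apply: near_eq_cvg; apply: nearW => n.
    by rewrite normc_cexp !ReImE mul1r.
  - by apply: ccvgN; apply: ccvg_cexp; apply: ccvgN; exact: ccvgC.
have h2 := gker_cint (ltr01 : 0 < Re (1 : R[i])) (ltr01 : 0 < Re (1 : R[i])).
by rewrite (cint_unique h2 h) !oppr0 cexp0 opprK add0r.
Qed.

(** For w = v ^ 2 this is the square of abs (ln v) <= abs (v - 1 / v). *)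
Lemma sqr_ln_le (w : R) : 0 < w -> ln w ^+ 2 <= 4 * (w - 2 + w^-1).
Proof.
move=> w0; pose v := Num.sqrt w; have v0 : 0 < v by rewrite sqrtr_gt0.
have wE : w = v ^+ 2 by rewrite sqr_sqrtr// ltW.
have l1 : ln v <= v - 1.
  by have := @le_ln1Dx R (v - 1); rewrite [1 + _]addrC subrK; apply; lra.
have l2 : - ln v <= v^-1 - 1.
  have vi : 0 < v^-1 by rewrite invr_gt0.
  have := @le_ln1Dx R (v^-1 - 1); rewrite [1 + _]addrC subrK lnV ?posrE//; apply; lra.
have vv : v * v^-1 = 1 by rewrite divff// gt_eqF.
rewrite wE lnXn// -exprVn mulr2n.
have vi : 0 < v^-1 by rewrite invr_gt0.
set u := v^-1 in l2 vv vi *; set l := ln v in l1 l2 *.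
have [v1|v1] := leP 1 v.
  have u1 : u <= 1 by rewrite invf_le1.
  have l0 : 0 <= l by exact: ln_ge0.
  by nra.
have u1 : 1 <= u by rewrite -[leLHS]invr1 lef_pV2 ?posrE// ltW.
have l0 : l <= 0 by apply: ln_le0; exact: ltW.
by nra.
Qed.

Lemma cos_ge (x : R) : 1 - x ^+ 2 / 2 <= cos x.
Proof.
have sle (h : R) : sin h ^+ 2 <= h ^+ 2.
  wlog h0 : h / 0 < h => [H|].
    have [h0|h0|<-] := ltgtP 0 h; [exact: H| |by rewrite sin0].
    by have := H (- h); rewrite oppr_gt0 sinN !sqrrN; apply.
  have [|c _] := @MVT R sin cos 0 h h0 (fun x _ => is_derive_sin x).
    by apply: continuous_subspaceT => u; exact: continuous_sin.
  by rewrite sin0 !subr0 => ->; rewrite exprMn ler_piMl ?sqr_ge0.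
have -> : cos x = 1 - 2 * sin (x / 2) ^+ 2.
  have -> : cos x = cos (x / 2 + x / 2) by congr cos; field.
  by have := cos2Dsin2 (x / 2); rewrite cosD; lra.
have -> : x ^+ 2 / 2 = 2 * (x / 2) ^+ 2 by field.
by rewrite lerB// ler_pM2l.
Qed.

(** For X real and large, u ^ (iy) is nearly constant where u ^ (X - 1) e ^ (-
    u) is concentrated. Precisely, cos x >= 1 - x ^ 2 / 2 and sqr_ln_le bound
    the real part of (u / X) ^ (iy) from below by a combination of 1, u and 1
    / u, whose integrals against u ^ (X - 1) e ^ (- u) are values of Gamma at
    X, X + 1 and X - 1. *)
Lemma gint_neq0_large (X y : R) : 1 + 2 * y ^+ 2 < X -> gint (X +i* y) 1 != 0.
Proof.
move=> Xy; have y2 := sqr_ge0 y.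
have X1 : 0 < X - 1 by lra.
have X0 : 0 < X by lra.
have R1 : 0 < Re (1 : R[i]) := ltr01.
have h := cintZ (cexp (- (y * ln X)%:C * 'i)) (gker_cint (X0 : 0 < Re (X +i* y)) R1).
have XC : 0 < Re X%:C by [].
have XB : 0 < Re (X%:C - 1) by rewrite !ReImE.
have XD : 0 < Re (X%:C + 1) by rewrite !ReImE; lra.
have g1 := gker_cint XC R1; have g2 := gker_cint XB R1; have g3 := gker_cint XD R1.
have H := cintD (cintZ (1 + 4 * y ^+ 2)%:C g1)
  (cintD (cintZ (- (2 * y ^+ 2 / X))%:C g3) (cintZ (- (2 * y ^+ 2 * X))%:C g2)).
apply/eqP => g0.
suff : 0 < Re (cexp (- (y * ln X)%:C * 'i) * gint (X +i* y) 1).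
  by rewrite g0 mulr0 ltxx.
rewrite -(Re_cintegral h).
apply: (lt_le_trans (y := Re ((1 + 4 * y ^+ 2)%:C * gint X%:C 1 +
   ((- (2 * y ^+ 2 / X))%:C * gint (X%:C + 1) 1 +
    (- (2 * y ^+ 2 * X))%:C * gint (X%:C - 1) 1)))).
  have e1 : gint (X%:C + 1) 1 = X%:C * gint X%:C 1 by exact: gint1_succ.
  have e2 : gint X%:C 1 = (X - 1)%:C * gint (X%:C - 1) 1.
    by rewrite -{1}[X%:C](subrK 1) (gint1_succ XB) rmorphB.
  have eB : X%:C - 1 = (X - 1)%:C by rewrite rmorphB.
  have e3 := gint_gt0 X1.
  rewrite e1 e2 eB; move: (gint (X - 1)%:C 1) e3 => g e3.
  rewrite !ReImE !(mul0r, mulr0, subr0, add0r, addr0, oppr0).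
  have -> : (1 + 4 * y ^+ 2) * ((X - 1) * Re g) + (- (2 * y ^+ 2 / X) * (X * ((X - 1) * Re g))
     + - (2 * y ^+ 2 * X) * Re g) = (X - 1 - 2 * y ^+ 2) * Re g.
    by field; rewrite gt_eqF.
  by apply: mulr_gt0 => //; lra.
rewrite -(Re_cintegral H); apply: le_Rintegral => //.
- by have [[]] := H.
- by have [[]] := h.
move=> u _; rewrite /gker; case: ifP => u0; last by rewrite !mulr0 !addr0.
have e c : (c%:C - 1) * (ln u)%:C - u%:C * 1 = ((c - 1) * ln u - u)%:C.
  by rewrite rmorphB rmorphM rmorphB/=; ring.
pose r := expR ((X - 1) * ln u - u).
have -> : cexp ((X%:C - 1) * (ln u)%:C - u%:C * 1) = r%:C by rewrite e cexp_real.
have -> : cexp ((X%:C + 1 - 1) * (ln u)%:C - u%:C * 1) = (r * u)%:C.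
  have := e (X + 1); rewrite rmorphD /= => ->; rewrite cexp_real -{3}(lnK u0) -expRD.
  by congr (expR _)%:C; ring.
have -> : cexp ((X%:C - 1 - 1) * (ln u)%:C - u%:C * 1) = (r / u)%:C.
  have := e (X - 1); rewrite rmorphB /= => ->; rewrite cexp_real -{3}(lnK u0) -expRN -expRD.
  by congr (expR _)%:C; ring.
have RP (a b : R) : Re (a +i* b) = a by [].
have IP (a b : R) : Im (a +i* b) = b by [].
rewrite -cexpD.
have -> : - (y * ln X)%:C * 'i + ((X +i* y - 1) * (ln u)%:C - u%:C * 1) =
    ((X - 1) * ln u - u) +i* (y * ln (u / X)).
  have E (l L v : R) : - (y * L)%:C * 'i + ((X +i* y - 1) * l%:C - v%:C * 1) =
      ((X - 1) * l - v) +i* (y * (l - L)).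
    apply: complex_eqP; [transitivity ((X - 1) * l - v)|transitivity (y * (l - L))] => //.
      by rewrite !(ReImE, vlineE, RP, IP); ring.
    by rewrite !(ReImE, vlineE, RP, IP); ring.
  by rewrite E -ln_div.
rewrite [X in _ <= X]Re_cexp [X in expR X]RP [X in cos X]IP -/r !ReImE !(mul0r, mulr0, subr0, add0r, addr0, oppr0).
have -> : (1 + 4 * y ^+ 2) * r + (- (2 * y ^+ 2 / X) * (r * u) + - (2 * y ^+ 2 * X) * (r / u)) =
   r * (1 - y ^+ 2 * (4 * (u / X - 2 + (u / X)^-1)) / 2).
  by field; rewrite !gt_eqF.
rewrite ler_pM2l ?expR_gt0//; apply: le_trans (cos_ge _).
rewrite lerB// ler_pM2r ?invr_gt0// exprMn ler_wpM2l// sqr_ln_le// divr_gt0//.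
Qed.

(** A zero t would propagate to all t + k by the functional equation. *)
Lemma gint_neq0 t : 0 < Re t -> gint t 1 != 0.
Proof.
move=> t0; pose N := (Num.truncn (1 + 2 * Im t ^+ 2)).+1.
have h k : gint t 1 = 0 -> gint (t + k%:R) 1 = 0.
  move=> g0; elim: k => [|k IH]; first by rewrite addr0.
  rewrite -natr1 addrA gint1_succ ?IH ?mulr0// !ReImE.
  by apply: ltr_wpDr => //; rewrite ler0n.
apply/eqP => /(h N); apply/eqP.
have -> : t + N%:R = (Re t + N%:R) +i* Im t.
  by apply: complex_eqP; rewrite !ReImE ?addr0.
apply: gint_neq0_large; apply: (lt_trans (truncnS_gt _)).
by rewrite -/N ltrDr.
Qed.

Lemma cgamma_neq0 t : 0 < Re t -> cgamma t != 0.
Proof. by move=> t0; rewrite cgamma_gint// gint_neq0. Qed.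

End gamma_function.

(** * Radial integrals and powers on a vertical line *)

Section gaussian.
Context {R : realType}.
Local Notation leb := (@lebesgue_measure R).
Local Notation RT := (measurableTypeR R).

Lemma cint_gauss (u : R) : 0 < u ->
  cint leb (fun x => (expR (- (u * x ^+ 2)))%:C) (Num.sqrt (pi / u))%:C.
Proof.
move=> u0; have su0 : 0 < Num.sqrt u by rewrite sqrtr_gt0.
have h : cint leb (fun x => (gauss_fun x)%:C) (Num.sqrt pi)%:C.
  apply: cint_ge0; [exact: measurable_gauss_fun|exact: gauss_fun_ge0|exact: integralT_gauss].
have -> : Num.sqrt (pi / u) = (Num.sqrt u)^-1 * Num.sqrt pi.
  by rewrite sqrtrM ?pi_ge0// sqrtrV 1?mulrC// ltW.
rewrite -real_complexM; apply: eq_cint (cint_scale su0 h) => x.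
by rewrite /gauss_fun exprMn sqr_sqrtr// ltW.
Qed.

End gaussian.

Section radial.
Context {R : realType} d (T : measurableType d).
Variable m : {sigma_finite_measure set T -> \bar R}.

(** Gamma (s) (1 + Q) ^ (- s) = int_0^oo u ^ (s - 1) e ^ (- u (1 + Q)) du reduces
    the integral of (1 + Q) ^ (- s) to those of e ^ (- u Q). *)
Lemma cint_radial (Q : T -> R) (k nu : R) s : measurable_fun setT Q ->
  (forall x, 0 <= Q x) -> 0 <= k -> nu < Re s -> 0 <= nu ->
  (forall u, 0 < u -> cint m (fun x => (expR (- (u * Q x)))%:C) (k * u `^ (- nu))%:C) ->
  cint m (fun x => rpowc (1 + Q x) (- s)) (k%:C * gint (s - nu%:C) 1 / gint s 1).
Proof.
move=> mQ Q0 k0 snu nu0 H.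
have R1 : 0 < Re (1 : R[i]) := ltr01.
have s0 : 0 < Re s by apply: le_lt_trans snu.
have sB : 0 < Re (s - nu%:C) by rewrite !ReImE subr_gt0.
pose leb := (@lebesgue_measure R); pose RT := measurableTypeR R.
pose f (ux : RT * T) := gker s (1 + Q ux.2)%:C ux.1.
have x0 x : 0 < 1 + Q x by rewrite ltr_pwDl.
have mf : cmeas f.
  apply: cmeas_if; [exact: measurable_fun_ltr| |exact: cmeas_cst].
  apply: cmeas_cexp; apply: cmeasB; apply: cmeasM; try exact: cmeas_cst.
  - apply: cmeasC; apply: measurableT_comp => //; exact: measurable_ln.
  - exact: cmeasC.
  - apply: cmeasC; apply: measurable_funD => //; exact: measurableT_comp.
have fE u x : f (u, x) = gker s 1 u * (expR (- (u * Q x)))%:C.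
  rewrite /f /gker /=; case: ifP => _; last by rewrite mul0r.
  by rewrite -cexp_real -cexpD; congr cexp; rewrite rmorphN rmorphM rmorphD/=; ring.
have gE u : 0 < u -> gker s 1 u * (u `^ (- nu))%:C = gker (s - nu%:C) 1 u.
  move=> u0; rewrite /gker u0 -rpowc_real// /rpowc -cexpD; congr cexp.
  by rewrite rmorphN; ring.
have fx u : cint m (fun x => f (u, x)) (k%:C * gker (s - nu%:C) 1 u).
  have [u0|u0] := ltP 0 u; last first.
    have gk z : gker z 1 u = 0 by rewrite /gker ltNge u0.
    rewrite gk mulr0; apply: eq_cint (cint0 _) => x.
    by rewrite fE gk mul0r.
  rewrite -gE// mulrCA real_complexM; apply: eq_cint (cintZ _ (H u u0)) => x.
  by rewrite fE.
have [gi _] := gker_cint sB R1.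
have fi : cintegrable (prodm leb m) setT f.
  apply: (cintegrable_prod mf (integrableZl measurableT k (integrable_normc gi))) => u.
  have -> : nint m (fun x => f (u, x)) = (k * normc (gker (s - nu%:C) 1 u))%:E; last by [].
  have [u0|u0] := ltP 0 u; last first.
    have gk z : gker z 1 u = 0 by rewrite /gker ltNge u0.
    rewrite gk Normc.normc0 mulr0.
    have -> : 0 = Re (0%:C : R[i]) by [].
    apply: nint_cint; first by have /cint_cmeas := fx u.
    apply: eq_cint (cint0 _) => x.
    by rewrite fE gk mul0r Normc.normc0.
  rewrite -gE// Normc.normcM normcC [`|u `^ _|]ger0_norm ?powR_ge0//.
  have -> : k * (normc (gker s 1 u) * u `^ (- nu)) =
      Re ((normc (gker s 1 u))%:C * (k * u `^ (- nu))%:C).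
    by rewrite real_complexM ReC; ring.
  apply: nint_cint; first by have /cint_cmeas := fx u.
  apply: eq_cint (cintZ _ (H u u0)) => x.
  by rewrite fE Normc.normcM normcC real_complexM ger0_norm ?expR_ge0.
have fu x : cint leb (fun u => f (u, x)) (gint s (1 + Q x)%:C).
  by exact: (@gker_cint R s (1 + Q x)%:C s0 (x0 x)).
have H1 := cint_fubini1 (cintegrable_cint fi) fx.
have H2 := cint_fubini2 (cintegrable_cint fi) fu.
have e := cint_unique H1 (cintZ k%:C (gker_cint sB R1)).
have gp := gint_neq0 s0.
rewrite e in H2; rewrite mulrC; apply: eq_cint (cintZ (gint s 1)^-1 H2) => x.
by rewrite -[(1 + Q x)%:C]mulr1 gint_scale//; field.
Qed.

End radial.

Section vertical_line_powers.
Context {R : realType}.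
Local Notation leb := (@lebesgue_measure R).
Local Notation RT := (measurableTypeR R).
Implicit Types (a b s t : R[i]).

(** The radial reduction for Q x = x ^ 2. *)
Lemma cint_japanese (p : R) : 2^-1 < p ->
  exists v, cint leb (fun x => rpowc (1 + x ^+ 2) (- p%:C)) v.
Proof.
move=> p2.
have mQ : measurable_fun setT (fun x : RT => x ^+ 2) by exact: measurable_funX.
have i0 : 0 <= 2^-1 :> R by rewrite invr_ge0.
have H := @cint_radial R _ _ leb (fun x => x ^+ 2) _ _ p%:C mQ (fun x => sqr_ge0 x)
  (sqrtr_ge0 pi) p2 i0.
eexists; apply: H => u u0.
apply: cint_eqv (cint_gauss u0) _; congr _%:C.
by rewrite sqrtrM ?pi_ge0// sqrtrV ?ltW// powRN powR12_sqrt// ltW.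
Qed.

(** (1 + ix) ^ a (1 - ix) ^ b. *)
Definition vker a b (x : R) : R[i] := hpow (vline 1 x) a 0 * hpow (vline (-1) x) b 0.

Definition vint a b : R[i] := cintegral leb setT (vker a b).

Lemma cmeas_vline k : cmeas (vline k : RT -> R[i]).
Proof. by split; [exact: measurable_cst|exact: measurable_funM]. Qed.

Lemma cmeas_vker a b : cmeas (vker a b : RT -> R[i]).
Proof. by apply: cmeasM; apply: cmeas_hpow; exact: cmeas_vline. Qed.

Lemma normc_vker_le a b : exists2 C : R, 0 < C &
  forall x, normc (vker a b x) <= C * (1 + x ^+ 2) `^ (Re (a + b) / 2).
Proof.
exists (expR (pi * `|Im a|) * expR (pi * `|Im b|)); first by rewrite mulr_gt0 ?expR_gt0.
move=> x; rewrite Normc.normcM.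
have x0 : 0 < 1 + x ^+ 2 by rewrite ltr_pwDl ?sqr_ge0.
have H k c : k ^+ 2 = 1 -> normc (hpow (vline k x) c 0) <=
    expR (pi * `|Im c|) * (1 + x ^+ 2) `^ (Re c / 2).
  move=> k1; have := normc_hpow_le c 0 (Re_vline k x).
  have e : Num.sqrt (1 + x ^+ 2) `^ Re c = (1 + x ^+ 2) `^ (Re c / 2).
    by rewrite -powR12_sqrt ?ltW// -powRrM mulrC.
  by rewrite normc_vline exprMn k1 mul1r addr0 subr0 e.
have -> : (1 + x ^+ 2) `^ (Re (a + b) / 2) =
    (1 + x ^+ 2) `^ (Re a / 2) * (1 + x ^+ 2) `^ (Re b / 2).
  by rewrite ReD mulrDl powRD// (gt_eqF x0) implybT.
rewrite mulrACA; apply: ler_pM; rewrite ?normc_ge0//; apply: H.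
  by rewrite expr1n.
by rewrite sqrrN expr1n.
Qed.

Lemma vker_cint a b : Re (a + b) < -1 -> cint leb (vker a b) (vint a b).
Proof.
move=> ab; apply: cintegrable_cint; have [C C0 H] := normc_vker_le a b.
have p0 : 2^-1 < - (Re (a + b) / 2) by lra.
have [v [[vi _] _]] := cint_japanese p0.
have ji := integrableZl measurableT C vi.
apply: (cintegrable_dom (cmeas_vker a b) ji) => x.
have x0 : 0 < 1 + x ^+ 2 by rewrite ltr_pwDl ?sqr_ge0.
have -> : - (- (Re (a + b) / 2))%:C = (Re (a + b) / 2)%:C by rewrite rmorphN opprK.
by rewrite rpowc_real//; exact: H.
Qed.

Lemma vkerD a b a' b' x : vker (a + a') (b + b') x = vker a b x * vker a' b' x.
Proof.
rewrite /vker -[in X in X * _ = _](addr0 (0 : R[i])) -[in X in _ * X = _](addr0 (0 : R[i])).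
by rewrite !hpowD; ring.
Qed.

Lemma vker10 x : vker 1 0 x = vline 1 x.
Proof.
by rewrite /vker hpow10 ?Re_vline// /hpow !mul0r addr0 cexp0 mulr1.
Qed.

Lemma vker01 x : vker 0 1 x = vline (-1) x.
Proof.
by rewrite /vker hpow10 ?Re_vline// /hpow !mul0r addr0 cexp0 mul1r.
Qed.

Lemma vker00 x : vker 0 0 x = 1.
Proof. by rewrite /vker /hpow !mul0r addr0 cexp0 mulr1. Qed.

Lemma vline_sum x : vline (-1) x = 2%:R - vline 1 x :> R[i].
Proof. by apply: complex_eqP; rewrite !(ReImE, vlineE); ring. Qed.

Lemma vlineB1 x : vline 1 x - 1 = 'i * x%:C :> R[i].
Proof. by apply: complex_eqP; rewrite !(ReImE, vlineE); ring. Qed.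

Lemma cderive_vker a b x : cderive (vker a b) x
  ('i * (a * vker (a - 1) b x - b * vker a (b - 1) x)).
Proof.
apply: cderive_eq (cderiveM (cderive_hpow_vline 1 a x) (cderive_hpow_vline (-1) b x)) _.
by rewrite /vker rmorphN1 rmorph1; ring.
Qed.

Lemma cvg_vker0 a b (e : R) : e ^+ 2 = 1 -> Re (a + b) < 0 ->
  ccvg \oo (fun n => vker a b (e * expR n.+1%:R)) 0.
Proof.
move=> e1 ab; have [C C0 H] := normc_vker_le a b; apply: ccvg_normc0.
apply: (@squeeze_cvgr _ _ _ _ (fun=> 0) (fun n => C * expR (- (- Re (a + b) * n.+1%:R)))).
- apply: nearW => n; rewrite normc_ge0 (le_trans (H _))// ler_pM2l//.
  rewrite exprMn e1 mul1r mulNr opprK.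
  have h : expR n.+1%:R ^+ 2 <= 1 + expR n.+1%:R ^+ 2 :> R by rewrite lerDr.
  rewrite /powR gt_eqF ?ltr_pwDl ?sqr_ge0// ler_expR.
  have : n.+1%:R *+ 2 <= ln (1 + expR n.+1%:R ^+ 2) :> R.
    rewrite -[leLHS](@expRK R) ler_ln ?posrE ?expR_gt0 ?ltr_pwDl ?sqr_ge0//.
    by rewrite mulr2n expRD -expr2.
  by rewrite mulr2n => h2; nra.
- exact: cvg_cst.
- rewrite -[X in _ --> X](mulr0 C); apply: cvgM; first exact: cvg_cst.
  by apply: cvg_expRN; rewrite oppr_gt0.
Qed.

End vertical_line_powers.

(** * The integral of (1 + ix) ^ (- s) (1 - ix) ^ (- t) *)

Lemma near_exhaust_expR {R : realType} (x : R) :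
  \forall n \near \oo, -1 * expR n.+1%:R <= x <= 1 * expR n.+1%:R.
Proof.
apply: filterS (near_exhaustNyy x) => n /andP[h1 h2].
by have := @expR_ge1Dx R n.+1%:R; rewrite mul1r mulN1r; lra.
Qed.

(** End points that grow exponentially turn the decay of a power into that of
    an exponential. *)
Lemma cint_derivative_line {R : realType} (F f : R -> R[i]) :
  (forall x, cderive F x (f x)) -> (forall x, ccvg (nbhs x) f (f x)) ->
  cintegrable (@lebesgue_measure R) setT f ->
  (forall e : R, e ^+ 2 = 1 -> ccvg \oo (fun n => F (e * expR n.+1%:R)) 0) ->
  cint (@lebesgue_measure R) f 0.
Proof.
move=> dF cf fi L; rewrite -[X in cint _ _ X](subr0 (0 : R[i])).
apply: (@cint_derivative _ setT (fun n => -1 * expR n.+1%:R)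
  (fun n => 1 * expR n.+1%:R) F f) => //.
- by move=> n; rewrite mul1r mulN1r; have := expR_gt0 (n.+1%:R : R); lra.
- by move=> x _; exact: near_exhaust_expR.
- by move=> x _; have [] := dF x.
- by move=> x _; have [] := dF x.
- by move=> x; case.
- by apply: L; rewrite expr1n.
- by apply: L; rewrite sqrrN expr1n.
Qed.

Section fourier_kernel.
Context {R : realType}.
Local Notation leb := (@lebesgue_measure R).
Local Notation RT := (measurableTypeR R).
Implicit Types (a b s t : R[i]).

Lemma i_neq0 : ('i : R[i]) != 0.
Proof. by rewrite eq_complex /= eqxx oner_eq0. Qed.

(** The integrand of the Fourier transform of (1 + ix) ^ (- s) at v. *)
Definition fker s (v x : R) : R[i] := vker (- s) 0 x * cexp ('i * (v * x)%:C).

Definition fint s (v : R) : R[i] := cintegral leb setT (fker s v).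

Lemma normc_cexpi (y : R) : normc (cexp ('i * y%:C)) = 1.
Proof. by rewrite normc_cexp !(ReImE, vlineE) !(mul0r, mulr0) subr0 expR0. Qed.

Lemma cmeas_fker s v : cmeas (fker s v : RT -> R[i]).
Proof.
apply: cmeasM; first exact: cmeas_vker.
apply: cmeas_cexp; apply: cmeasM; first exact: cmeas_cst.
by apply: cmeasC; exact: measurable_funM.
Qed.

Lemma normc_fker s v x : normc (fker s v x) = normc (vker (- s) 0 x).
Proof. by rewrite /fker (Normc.normcM (vker _ _ _)) normc_cexpi mulr1. Qed.

Lemma fker_cint s v : 1 < Re s -> cint leb (fker s v) (fint s v).
Proof.
move=> s1; apply: cintegrable_cint.
have h : Re (- s + 0) < -1 by rewrite !ReImE; lra.
have [[vi _] _] := (vker_cint h, tt).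
apply: (cintegrable_dom (cmeas_fker s v) (integrable_normc vi)) => x.
by rewrite normc_fker.
Qed.

Lemma vkerS a b x : vker (a + 1) b x = vline 1 x * vker a b x.
Proof. by rewrite -[b in LHS]addr0 vkerD vker10 mulrC. Qed.

Lemma vkerS' a b x : vker a (b + 1) x = vline (-1) x * vker a b x.
Proof. by rewrite -[a in LHS]addr0 vkerD vker01 mulrC. Qed.

(** The factor ix from the derivative is (1 + ix) - 1. *)
Lemma cderive_fint s v : 2 < Re s -> cderive (fint s) v (fint (s - 1) v - fint s v).
Proof.
move=> s2.
have s1 : 1 < Re s by apply: lt_trans s2; lra.
have sB : 1 < Re (s - 1) by rewrite !ReImE; lra.
have dE x y : fker (s - 1) x y - fker s x y = ('i * y%:C) * fker s x y.
  by rewrite /fker opprB [1 - s]addrC vkerS -(vlineB1 y); ring.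
have H := cintB (fker_cint v sB) (fker_cint v s1).
have [_ <-] : cint leb (fun y => ('i * y%:C) * fker s v y) (fint (s - 1) v - fint s v).
  by apply: eq_cint H => y; exact: dE.
apply: (@cderive_under R _ _ leb (fker s) (fun x y => ('i * y%:C) * fker s x y)
  (fun y => normc (fker (s - 1) 0 y) + normc (fker s 0 y)) v (v - 1) (v + 1)).
- by apply/andP; split; lra.
- by move=> x _; have [] := fker_cint x s1.
- move=> x y _; rewrite /fker.
  apply: cderive_eq (cderiveZ (vker (- s) 0 y) (cderive_cexp (z := 'i * y%:C) _)) _; last by ring.
  apply: (@eq_cderive _ (fun z => ('i * y%:C) * z%:C)); first by move=> z; rewrite -real_complexM; ring.
  by apply: cderive_eq (cderiveZ _ (cderiveC (is_derive_id x 1))) _; rewrite mulr1.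
- have [h1 _] := fker_cint 0 sB; have [h2 _] := fker_cint 0 s1.
  by have := integrableD measurableT (integrable_normc h1) (integrable_normc h2).
- move=> x y _; rewrite -dE.
  have e u w : normc (fker u w y) = normc (fker u 0 y).
    by rewrite !normc_fker.
  by apply: le_trans (le_normcD _ _) _; rewrite normcN !(e _ x).
Qed.

(** Integrate the derivative of (1 + ix) ^ (1 - s) e ^ (ivx). *)
Lemma fint_recurrence s v : 2 < Re s ->
  (s - 1) * fint s v = v%:C * fint (s - 1) v.
Proof.
move=> s2.
have s1 : 1 < Re s by apply: lt_trans s2; lra.
have sB : 1 < Re (s - 1) by rewrite !ReImE; lra.
pose F x := vker (1 - s) 0 x * cexp ('i * (v * x)%:C).
pose f x := ('i * ((1 - s) * fker s v x + v%:C * fker (s - 1) v x)).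
have dF x : cderive F x (f x).
  have d2 : cderive (fun x => 'i * (v * x)%:C) x ('i * v%:C).
    apply: (@eq_cderive _ (fun y => ('i * v%:C) * y%:C)).
      by move=> y; rewrite -real_complexM mulrA.
    apply: cderive_eq (cderiveZ _ (cderiveC (is_derive_id x 1))) _.
    by rewrite mulr1.
  apply: cderive_eq (cderiveM (cderive_vker (1 - s) 0 x) (cderive_cexp d2)) _.
  rewrite /f /fker mul0r subr0 opprB.
  by rewrite (_ : 1 - s - 1 = - s); [ring|ring].
have H := cintZ 'i (cintD (cintZ (1 - s) (fker_cint v s1)) (cintZ v%:C (fker_cint v sB))).
have L (e : R) : e ^+ 2 = 1 -> ccvg \oo (fun n => F (e * expR n.+1%:R)) 0.
  move=> e1; apply: ccvg_normc0.
  have h : Re (1 - s + 0) < 0 by rewrite !ReImE; lra.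
  have H0 : normc (vker (1 - s) 0 (e * expR n.+1%:R)) @[n --> \oo] --> normc (0 : R[i]).
    by apply: ccvg_normc; exact: cvg_vker0.
  rewrite Normc.normc0 in H0; apply: cvg_trans H0; apply: near_eq_cvg; apply: nearW => n.
  by rewrite /F (Normc.normcM (vker _ _ _)) normc_cexpi mulr1.
have c u x : ccvg (nbhs x) (fker u v) (fker u v x).
  apply: ccvgM; first exact: cderive_ccvg (cderive_vker _ _ _).
  apply: ccvg_cexp; apply: ccvgM; first exact: ccvg_cst.
  by apply: ccvgC; apply: cvgM; [exact: cvg_cst|exact: cvg_id].
have cf x : ccvg (nbhs x) f (f x).
  apply: ccvgM; first exact: ccvg_cst.
  by apply: ccvgD; apply: ccvgM; (exact: ccvg_cst || exact: c).
have := cint_unique H (cint_derivative_line dF cf H.1 L).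
move=> /eqP; rewrite mulf_eq0 (negbTE i_neq0).
move=> /= /eqP E; transitivity (- ((1 - s) * fint s v)); first by ring.
by rewrite -[LHS]addr0 -E; ring.
Qed.

(** The factor in fint_gker, where gker s 1 takes the value e ^ (- 1) at v =
    1. *)
Definition fcst s : R[i] := fint s 1 * cexp 1.

(** The Fourier transform of (1 + ix) ^ (- s) is proportional to
    v ^ (s - 1) e ^ (- v) on v > 0, both being solutions of
    v K' = (s - 1 - v) K. *)
Lemma fint_gker s v : 2 < Re s -> 0 < v -> fint s v = fcst s * gker s 1 v.
Proof.
move=> s2 v0.
pose L (t : R) := fint s (expR t) * cexp ((1 - s) * t%:C + (expR t)%:C).
have d (t : R) : cderive L t 0.
  have d1 : cderive (fun t : R => fint s (expR t)) t
      ((expR t)%:C * (fint (s - 1) (expR t) - fint s (expR t))).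
    exact: cderive_comp (cderive_fint (expR t) s2) (is_derive_expR t).
  have d2 : cderive (fun t : R => (1 - s) * t%:C + (expR t)%:C) t ((1 - s) + (expR t)%:C).
    apply: cderiveD; last exact: cderiveC (is_derive_expR t).
    apply: cderive_eq (cderiveZ _ (cderiveC (is_derive_id t 1))) _.
    by rewrite mulr1.
  apply: cderive_eq (cderiveM d1 (cderive_cexp d2)) _.
  have e := fint_recurrence (expR t) s2.
  by rewrite mulrBr -e; ring.
have := cderive0_cst (ln v) 0 d; rewrite /L lnK// expR0 mulr0 add0r.
rewrite -/(fcst s) => <-; rewrite /gker v0 -mulrA -cexpD.
rewrite (_ : _ + _ = 0) ?cexp0 ?mulr1//; ring.
Qed.

(** Integrate v ^ (t - 1) e ^ (- v (1 - ix)) (1 + ix) ^ (- s) in both orders. *)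
Lemma vint_fcst s t : 2 < Re s -> 0 < Re t ->
  gint t 1 * vint (- s) (- t) = fcst s * (rpowc 2 (1 - s - t) * gint (s + t - 1) 1).
Proof.
move=> s2 t0.
have s1 : 1 < Re s by apply: lt_trans s2; lra.
have R1 : 0 < Re (1 : R[i]) := ltr01.
have R2 : 0 < Re (2%:C : R[i]) by rewrite ReC.
pose f (vx : RT * RT) := gker t 1 vx.1 * fker s vx.1 vx.2.
have mf : cmeas f.
  apply: cmeasM; first exact: cmeas_comp (cmeas_gker t 1) measurable_fst.
  apply: cmeasM; first exact: cmeas_comp (cmeas_vker (- s) 0) measurable_snd.
  apply: cmeas_cexp; apply: cmeasM; first exact: cmeas_cst.
  by apply: cmeasC; exact: measurable_funM.
have h1 v : cint leb (fun x => f (v, x)) (fcst s * gker (s + t - 1) 2%:C v).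
  apply: cint_eqv (cintZ (gker t 1 v) (fker_cint v s1)) _.
  have [v0|v0] := ltP 0 v; last by rewrite /gker ltNge v0 !(mul0r, mulr0).
  rewrite fint_gker// mulrCA; congr (_ * _); rewrite /gker v0 -cexpD; congr cexp.
  by rewrite rmorph_nat; ring.
have [gi _] := gker_cint t0 R1.
have h := fker_cint 0 s1.
have fi : cintegrable (prodm leb leb) setT f.
  have gn := integrableZl measurableT (fine (nint leb (fker s 0))) (integrable_normc gi).
  apply: (cintegrable_prod mf gn) => v.
  have -> : nint leb (fun y => f (v, y)) = ((normc (gker t 1 v))%:E * nint leb (fker s v))%E.
    exact: (nintZ leb (gker t 1 v) (cmeas_fker s v)).
  have -> : nint leb (fker s v) = nint leb (fker s 0).
    by apply: eq_integral => x _; rewrite !normc_fker.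
  rewrite EFinM muleC fineK// ge0_fin_numE ?nint_ge0//; apply: nint_lty.
  by have [] := h.
have h2 x : cint leb (fun v => f (v, x)) (gint t 1 * vker (- s) (- t) x).
  have h3 := cintZ (vker (- s) 0 x) (gker_cint t0 (Re_vline (-1) x)).
  apply: cint_eqv (eq_cint _ h3) _.
    move=> v; rewrite /f /fker /gker /=; case: ifP => v0; last by rewrite mulr0 mul0r.
    rewrite mulrCA -cexpD; congr (_ * cexp _).
    by apply: complex_eqP; rewrite !(ReImE, vlineE); ring.
  rewrite gint_vline// mulrCA; congr (_ * _).
  have h00 z : hpow z 0 0 = 1 :> R[i] by rewrite /hpow !mul0r addr0 cexp0.
  by rewrite /vker h00 mulr1.
have st : 0 < Re (s + t - 1) by rewrite !ReImE; lra.
have F1 := cint_fubini1 (cintegrable_cint fi) h1.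
have F2 := cint_fubini2 (cintegrable_cint fi) h2.
have e1 := cint_unique F1 (cintZ (fcst s) (gker_cint st R2)).
have ab : Re (- s + - t) < -1 by rewrite !ReImE; lra.
have e2 := cint_unique F2 (cintZ (gint t 1) (vker_cint ab)).
rewrite -e2 e1; congr (_ * _).
rewrite -[2%:C]mulr1 gint_scale//; congr (rpowc _ _ * _); ring.
Qed.

End fourier_kernel.

Section vint.
Context {R : realType}.
Local Notation leb := (@lebesgue_measure R).
Local Notation RT := (measurableTypeR R).
Implicit Types (a b s t : R[i]).

Lemma mpres_opp : mpres leb leb (fun x : RT => (- x : RT)).
Proof.
split=> [|A mA]; first exact: measurable_funN.
exact: (lebesgue_measureN mA).
Qed.

(** Substitute - x for x. *)
Lemma vint_sym a b : Re (a + b) < -1 -> vint a b = vint b a.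
Proof.
move=> ab; have h := vker_cint ab.
apply: (cint_unique h); apply: (mpres_cint mpres_opp); first exact: cmeas_vker.
rewrite addrC in ab; apply: eq_cint (vker_cint ab) => x.
have e k : vline k (- x) = vline (- k) x by rewrite /vline mulrN mulNr.
by rewrite /vker !e opprK mulrC.
Qed.

(** Integrate the derivative of vker a b. *)
Lemma vint_parts a b : Re (a + b) < 0 -> a * vint (a - 1) b = b * vint a (b - 1).
Proof.
move=> ab.
have ab1 : Re (a - 1 + b) < -1 by move: ab; rewrite !ReImE; lra.
have ab2 : Re (a + (b - 1)) < -1 by move: ab; rewrite !ReImE; lra.
have H := cintZ 'i (cintB (cintZ a (vker_cint ab1)) (cintZ b (vker_cint ab2))).
have cf x : ccvg (nbhs x) (fun x => 'i * (a * vker (a - 1) b x - b * vker a (b - 1) x))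
    ('i * (a * vker (a - 1) b x - b * vker a (b - 1) x)).
  apply: ccvgM; first exact: ccvg_cst.
  by apply: ccvgB; apply: ccvgM; (exact: ccvg_cst || exact: cderive_ccvg (cderive_vker _ _ _)).
have L (e : R) : e ^+ 2 = 1 -> ccvg \oo (fun n => vker a b (e * expR n.+1%:R)) 0.
  by move=> e1; exact: cvg_vker0.
have := cint_unique H (cint_derivative_line (cderive_vker a b) cf H.1 L).
move=> /eqP; rewrite mulf_eq0 (negbTE i_neq0).
by rewrite /= subr_eq0 => /eqP.
Qed.

(** Integration by parts, and (1 + ix) + (1 - ix) = 2. *)
Lemma vint_succ a b : Re (a + b) < -1 ->
  2%:R * a * vint (a - 1) b = (a + b + 1) * vint a b.
Proof.
move=> ab.
have ab0 : Re (a + (b + 1)) < 0 by move: ab; rewrite !ReImE; lra.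
have ab1 : Re (a - 1 + b) < -1 by move: ab; rewrite !ReImE; lra.
have ab2 : Re (a - 1 + (b + 1)) < -1 by move: ab; rewrite !ReImE; lra.
have e1 := vint_parts ab0; rewrite addrK in e1.
have e2 : vint a b + vint (a - 1) (b + 1) = 2%:R * vint (a - 1) b.
  have H := cintD (vker_cint ab) (vker_cint ab2).
  apply: cint_unique H _; apply: eq_cint (cintZ 2%:R (vker_cint ab1)) => x.
  by rewrite vkerS' -{2}(subrK 1 a) vkerS vline_sum; ring.
by rewrite -mulrA mulrCA -e2 mulrDr e1; ring.
Qed.

Lemma vint11 : vint (- 1) (- 1) = (pi : R)%:C.
Proof.
have ab : Re (- 1 + - 1 : R[i]) < -1 by rewrite !ReImE; lra.
have h := vker_cint ab.
have fE (x : R) : vker (- 1) (- 1) x = ((1 + x ^+ 2)^-1)%:C.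
  have e : vker 1 1 x * vker (-1) (-1) x = 1 by rewrite -vkerD !subrr vker00.
  have e2 : vker 1 1 x = (1 + x ^+ 2)%:C.
    rewrite -[X in vker X _]addr0 -[X in vker _ X]add0r vkerD vker10 vker01.
    by apply: complex_eqP; rewrite !(ReImE, vlineE); ring.
  have n0 : (1 + x ^+ 2)%:C != 0 :> R[i].
    by rewrite (inj_eq (@complexI R)) gt_eqF// ltr_pwDl ?sqr_ge0.
  by apply: (mulfI n0); rewrite -e2 e e2 real_complexM divff// gt_eqF// ltr_pwDl ?sqr_ge0.
have A : ccvg \oo (fun n => (atan n.+1%:R)%:C) (pi / 2 : R)%:C.
  apply: ccvgC; apply: (cvg_comp _ _ _ (@cvgy_atan R)).
  by apply/cvgryPge => A; apply: filterS (near_exhaustNyy A) => n /andP[].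
have H : cint leb (vker (- 1) (- 1)) ((pi / 2)%:C - - (pi / 2)%:C).
  apply: (@cint_derivative _ setT (fun n => - n.+1%:R)
    (fun n => n.+1%:R) (fun x => (atan x)%:C) (fun x => ((1 + x ^+ 2)^-1)%:C)).
  - exact: measurableT.
  - by move=> n; rewrite gtrN.
  - by [].
  - by move=> x _; exact: near_exhaustNyy.
  - by move=> x _; exact: is_derive_cst.
  - move=> x _; apply: eq_ccvg (fun y => esym (fE y)) _; rewrite -fE.
    exact: cderive_ccvg (cderive_vker _ _ _).
  - by move=> x _; exact: fE.
  - by move=> x; case.
  - by have [] := h.
  - exact: A.
  - apply: eq_ccvg (ccvgN A) => n; by rewrite atanN rmorphN.
rewrite (cint_unique h H) opprK -rmorphD/=; congr _%:C; lra.
Qed.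

Let W s t : R[i] := rpowc 2 (1 - s - t) * cgamma (s + t - 1) * ((cgamma s)^-1 * (cgamma t)^-1).

(** For large real parts, vint_fcst gives the formula with fcst s * Gamma (s)
    in place of a constant, and the symmetry in s and t shows that this does
    not depend on s. The recursion vint_succ then lowers the exponents. *)
Lemma vint_proportional : exists c : R[i], forall s t, 1 < Re (s + t) ->
  vint (- s) (- t) = c * W s t.
Proof.
exists (fcst 3%:R * cgamma 3%:R).
have large s t : 2 < Re s -> 2 < Re t ->
    vint (- s) (- t) = fcst s * cgamma s * W s t.
  move=> s2 t2.
  have s0 : 0 < Re s by lra.
  have t0 : 0 < Re t by lra.
  have st : 0 < Re (s + t - 1) by rewrite !ReImE; lra.
  have := vint_fcst s2 t0; rewrite -!cgamma_gint// => e.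
  have gt := cgamma_neq0 t0; have gs := cgamma_neq0 s0.
  apply: (mulfI gt); rewrite e /W; field; exact/andP.
have W0 s t : 2 < Re s -> 2 < Re t -> W s t != 0.
  move=> s2 t2; apply: mulf_neq0; [apply: mulf_neq0|apply: mulf_neq0].
  - exact: rpowc_neq0.
  - by apply: cgamma_neq0; rewrite !ReImE; lra.
  - by rewrite invr_eq0; apply: cgamma_neq0; lra.
  - by rewrite invr_eq0; apply: cgamma_neq0; lra.
have WC s t : W s t = W t s.
  by rewrite /W [s + t]addrC -!addrA [- s - t]addrC [(cgamma s)^-1 * _]mulrC.
have cst s : 2 < Re s -> fcst s * cgamma s = fcst 3%:R * cgamma 3%:R.
  move=> s2; have R3 : 2 < Re (3%:R : R[i]) by rewrite !ReImE ltr_nat.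
  apply: (mulIf (W0 _ _ s2 R3)); rewrite -large// WC -large//.
  by apply: vint_sym; rewrite !ReImE; move: R3; rewrite !ReImE; lra.
set c := fcst 3%:R * _ in cst *.
have down s t : 1 < Re (s + t) -> vint (- (s + 1)) (- t) = c * W (s + 1) t ->
    vint (- s) (- t) = c * W s t.
  move=> st; have ab : Re (- s + - t) < -1 by move: st; rewrite !ReImE; lra.
  have := vint_succ ab; rewrite -opprD => e h; rewrite h in e.
  have n0 : - s + - t + 1 != 0.
    have : 0 < Re (- (- s + - t + 1)) by move: st; rewrite !ReImE; lra.
    by move/Re_gt0_neq0; rewrite oppr_eq0.
  apply: (mulfI n0); rewrite -e /W (rgamma_succ s).
  have st0 : 0 < Re (s + t - 1) by move: st; rewrite !ReImE; lra.
  have -> : cgamma (s + 1 + t - 1) = (s + t - 1) * cgamma (s + t - 1).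
    rewrite !cgamma_gint//; last by move: st; rewrite !ReImE; lra.
    by rewrite -(gint1_succ st0); congr (gint _ 1); ring.
  have -> : rpowc 2 (1 - s - t) = 2%:R * rpowc 2 (1 - (s + 1) - t) :> R[i].
    rewrite (_ : 1 - s - t = 1 + (1 - (s + 1) - t)); last by ring.
    by rewrite rpowcD rpowc1// rmorph_nat.
  by ring.
have downs m s t : 1 < Re (s + t) -> vint (- (s + m%:R)) (- t) = c * W (s + m%:R) t ->
    vint (- s) (- t) = c * W s t.
  elim: m s => [|m IH] s st; first by rewrite addr0.
  move=> h; apply: (down _ _ st); apply: IH.
    by move: st; rewrite !ReImE; lra.
  by rewrite -addrA [1 + _]addrC natr1.
have downs' m s t : 1 < Re (s + t) -> vint (- s) (- (t + m%:R)) = c * W s (t + m%:R) ->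
    vint (- s) (- t) = c * W s t.
  move=> st h; have ab (u w : R[i]) : 1 < Re (u + w) -> Re (- u + - w) < -1.
    by rewrite !ReImE; lra.
  rewrite vint_sym ?ab// WC; apply: (downs m); first by rewrite addrC.
  rewrite -vint_sym ?h 1?WC// ab// addrA; move: st; rewrite !ReImE.
  by have := ler0n R m; lra.
move=> s t st.
have [m hm] : exists m : nat, 2 < Re (s + m%:R).
  exists (Num.truncn (`|2 - Re s|)).+1; rewrite !ReImE.
  have := truncnS_gt `|2 - Re s|; have := ler_norm (2 - Re s); lra.
have [k hk] : exists m : nat, 2 < Re (t + m%:R).
  exists (Num.truncn (`|2 - Re t|)).+1; rewrite !ReImE.
  have := truncnS_gt `|2 - Re t|; have := ler_norm (2 - Re t); lra.
apply: (downs m) => //; apply: (downs' k).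
  by move: st; rewrite !ReImE; have := ler0n R m; lra.
by rewrite (large _ _ hm hk) (cst _ hm).
Qed.

(** The constant is found at s = t = 1, where the integrand is 1 / (1 + x ^ 2). *)
Lemma vintE s t : 1 < Re (s + t) -> vint (- s) (- t) =
  2%:R * (pi : R)%:C * (rpowc 2 (1 - s - t) * cgamma (s + t - 1) * ((cgamma s)^-1 * (cgamma t)^-1)).
Proof.
have [c H] := vint_proportional => st; rewrite H//; congr (_ * _).
have := H 1 1; rewrite !ReImE vint11 /W => /(_ _) ->; last by lra.
have g1 : cgamma 1 = 1 :> R[i] by rewrite cgamma_gint ?gint11// ltr01.
rewrite addrK g1 invr1 !mulr1 subrr sub0r rpowcN rpowc1// rmorph_nat; by field.
Qed.

End vint.

(** * Integrals carried together with a bound of the modulus *)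

(** The bound of the integral of the modulus is what Fubini's theorem asks for
    when a further variable is integrated. *)
Definition cintb d (T : measurableType d) (R : realType) (m : {measure set T -> \bar R})
    (f : T -> R[i]) v (B : R) : Prop :=
  cint m f v /\ (nint m f <= B%:E)%E.

Lemma eq_cintb d (T : measurableType d) (R : realType) (m : {measure set T -> \bar R})
    (f g : T -> R[i]) v w (B C : R) :
  (forall x, f x = g x) -> v = w -> B = C -> cintb m f v B -> cintb m g w C.
Proof.
move=> fg <- <- [h b]; split; first exact: eq_cint h.
by move: b; rewrite (_ : f = g)//; apply/funext.
Qed.

Lemma mpres_cintb d1 d2 (R : realType) (T1 : measurableType d1) (T2 : measurableType d2)
    (m1 : {measure set T1 -> \bar R}) (m2 : {measure set T2 -> \bar R})
    (phi : T1 -> T2) (f : T2 -> R[i]) v (B : R) : mpres m1 m2 phi -> cmeas f ->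
  cintb m1 (fun x => f (phi x)) v B -> cintb m2 f v B.
Proof.
move=> h mf [h1 h2]; split; first exact: mpres_cint h1.
by rewrite -(mpres_nint h mf).
Qed.

Section iterated_with_bound.
Context {R : realType} d1 d2 (T1 : measurableType d1) (T2 : measurableType d2).
Variables (m1 : {sigma_finite_measure set T1 -> \bar R})
  (m2 : {sigma_finite_measure set T2 -> \bar R}).

(** In every step of the reduction the inner integral and the integral of the
    modulus are constant multiples of one function and of its modulus. *)
Lemma cintb_prod (f : T1 * T2 -> R[i]) (g : T1 -> R[i]) c (C : R) v (B : R) :
  cmeas f -> 0 <= C ->
  (forall x, cintb m2 (fun y => f (x, y)) (c * g x) (C * normc (g x))) ->
  cintb m1 g v B -> cintb (prodm m1 m2) f (c * v) (C * B).
Proof.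
move=> mf C0 fg [gv gB]; have [gi _] := gv.
have gn := integrableZl measurableT C (integrable_normc gi).
split; first exact: (cint_prod mf (fun x => (fg x).1) gn (fun x => (fg x).2) (cintZ c gv)).
have mg := cint_cmeas gv.
rewrite (nint_fubini _ _ mf) EFinM.
apply: (@le_trans _ _ (C%:E * nint m1 g)%E); last by rewrite lee_pmul// ?nint_ge0// lee_fin.
have -> : (C%:E * nint m1 g = nint m1 (fun x => (C%:C * g x)%R))%E.
  by rewrite nintZ// normcC ger0_norm.
apply: ge0_le_integral => //.
- by move=> x _; exact: nint_ge0.
- apply: (@measurable_fun_fubini_tonelli_F _ _ _ _ _ _ (fun z => (normc (f z))%:E)).
    exact: measurable_nint.
  by move=> x; rewrite lee_fin normc_ge0.
- by apply: measurable_nint; apply: cmeasM => //; exact: cmeas_cst.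
- by move=> x _; rewrite Normc.normcM normcC ger0_norm//; exact: (fg x).2.
Qed.

End iterated_with_bound.

Section one_dimensional_integrals.
Context {R : realType}.
Local Notation leb := (@lebesgue_measure R).
Local Notation RT := (measurableTypeR R).
Implicit Types (s t : R[i]).

Lemma hpow_vline s t (x : R) : hpow (vline 1 x) s t = vker s t x.
Proof.
have e : vline (-1) x = (vline 1 x)^* by rewrite /vline mulN1r mul1r.
by rewrite /vker e hpowJ -hpowD addr0 add0r.
Qed.

Definition vnorm s t : R := fine (nint leb (vker s t)).

Lemma vnorm_ge0 s t : 0 <= vnorm s t.
Proof. by rewrite fine_ge0// nint_ge0. Qed.

(** A scaling and a translation move the line Re z = a to Re z = 1. *)
Lemma cintb_hpow_line s t (a c : R) : 0 < a -> 1 < Re (s + t) ->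
  cintb leb (fun x : RT => hpow (a +i* (x + c)) (- s) (- t))
    (vint (- s) (- t) * rpowc a (1 - s - t))
    (vnorm (- s) (- t) * normc (rpowc a (1 - s - t))).
Proof.
move=> a0 st.
have ab : Re (- s + - t) < -1 by move: st; rewrite !ReImE; lra.
have ai : 0 < a^-1 by rewrite invr_gt0.
have h := vker_cint ab; have [hi _] := h.
have fE x : hpow (a +i* x) (- s) (- t) = rpowc a (- s - t) * vker (- s) (- t) (a^-1 * x).
  rewrite -hpow_vline.
  have -> : a +i* x = a%:C * vline 1 (a^-1 * x).
    apply: complex_eqP; rewrite [RHS](ReM, ImM) ReC ImC Re_vlineE Im_vlineE mul0r.
      by rewrite mulr1 subr0.
    by rewrite mul1r addr0 mulrA divff ?mul1r// gt_eqF.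
  by apply: hpowMr => //; exact: Re_vline.
have nE x : normc (hpow (a +i* x) (- s) (- t)) =
    normc (rpowc a (- s - t)) * normc (vker (- s) (- t) (a^-1 * x)).
  by rewrite fE; exact: Normc.normcM.
have e : rpowc a (1 - s - t) = rpowc a (- s - t) * a%:C.
  by rewrite -[X in _ * X](rpowc1 a0) -rpowcD; congr rpowc; ring.
have h1 := cint_translate c (cint_scale ai h).
have h2 := cint_translate c (cint_scale ai (cint_nint hi)).
split.
  apply: cint_eqv (eq_cint _ (cintZ (rpowc a (- s - t)) h1)) _.
    by move=> x; rewrite fE.
  by rewrite e invrK; ring.
rewrite (nint_cint (v := (normc (rpowc a (1 - s - t)) * vnorm (- s) (- t))%:C)).
- by rewrite ReC mulrC.
- apply: cmeas_hpow; split; first exact: measurable_cst.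
  by apply: measurable_funD.
- apply: cint_eqv (eq_cint _ (cintZ (normc (rpowc a (- s - t)))%:C h2)) _.
    by move=> x; rewrite real_complexM nE.
  rewrite e Normc.normcM normcC (gtr0_norm a0) invrK -!real_complexM /vnorm; ring.
Qed.

Lemma gker_real (t : R[i]) (z u : R) : (normc (gker t z%:C u))%:C = gker (Re t)%:C z%:C u.
Proof.
rewrite normc_gker /gker; case: ifP => // _; rewrite -cexp_real; congr cexp.
by rewrite rmorphB !rmorphM rmorphB/=.
Qed.

Lemma nint_gker t (x : R) : 0 < Re t -> 0 < x ->
  nint leb (gker t x%:C) = (x `^ (- Re t) * Re (gint (Re t)%:C 1))%:E.
Proof.
move=> t0 x0; have R1 : 0 < Re (1 : R[i]) := ltr01.
rewrite (nint_cint (v := gint (Re t)%:C x%:C)); last 2 first.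
- exact: cmeas_gker.
- apply: eq_cint (gker_cint _ _) => // u; by rewrite gker_real.
have := gint_scale (t0 : 0 < Re (Re t)%:C) R1 x0.
by rewrite mulr1 -rmorphN rpowc_real// => ->; rewrite !ReImE mul0r subr0.
Qed.

(** The integral over r is x ^ (- a) times the beta function at (a, b). *)
Definition bker (a b : R[i]) (x r : R) : R[i] :=
  if 0 < r then rpowc r (b - 1) * rpowc (x + r) (- a - b) else 0.

Lemma cmeas_bker a b x : cmeas (bker a b x : RT -> R[i]).
Proof.
apply: cmeas_if; [exact: measurable_fun_ltr| |exact: cmeas_cst].
apply: cmeasM; apply: cmeas_rpowc; first exact: measurable_id.
by apply: measurable_funD.
Qed.

(** Both sides are computed from
    int int u ^ (a + b - 1) e ^ (- u (x + r)) r ^ (b - 1) dr du. *)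
Lemma bker_cint a b (x : R) : 0 < Re a -> 0 < Re b -> 0 < x ->
  cint leb (bker a b x) (gint a 1 * gint b 1 / gint (a + b) 1 * rpowc x (- a)).
Proof.
move=> a0 b0 x0; have R1 : 0 < Re (1 : R[i]) := ltr01.
have ab0 : 0 < Re (a + b) by rewrite ReD addr_gt0.
have rx0 : 0 < Re x%:C by [].
pose f (ur : RT * RT) := gker (a + b) x%:C ur.1 * gker b ur.1%:C ur.2.
have mf : cmeas f.
  apply: cmeasM; first exact: cmeas_comp (cmeas_gker (a + b) x%:C) measurable_fst.
  apply: cmeas_if; [| |exact: cmeas_cst].
    by apply: measurable_fun_ltr.
  apply: cmeas_cexp; apply: cmeasB; apply: cmeasM; try exact: cmeas_cst.
  - by apply: cmeasC; apply: measurableT_comp => //; exact: measurable_ln.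
  - exact: cmeasC.
  - exact: cmeasC.
have gE u : 0 < u -> gker (a + b) x%:C u * rpowc u (- b) = gker a x%:C u.
  by move=> u0; rewrite /gker u0 /rpowc -cexpD; congr cexp; ring.
have gk (z w : R[i]) u : u <= 0 -> gker z w u = 0 by move=> u0; rewrite /gker ltNge u0.
have fr u : cint leb (fun r => f (u, r)) (gint b 1 * gker a x%:C u).
  have [u0|u0] := ltP 0 u; last first.
    rewrite gk// mulr0; apply: eq_cint (cint0 _) => r.
    by rewrite /f gk// mul0r.
  have h := cintZ (gker (a + b) x%:C u) (gker_cint b0 (u0 : 0 < Re u%:C)).
  apply: cint_eqv h _.
  by rewrite -[u%:C]mulr1 gint_scale// mulrA gE// mulrC.
have [gi _] := gker_cint a0 rx0.
have fi : cintegrable (prodm leb leb) setT f.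
  pose G := Re (gint (Re b)%:C 1).
  apply: (cintegrable_prod mf (integrableZl measurableT G (integrable_normc gi))) => u.
  have [u0|u0] := ltP 0 u; last first.
    rewrite (nint_cint (v := 0)) ?lee_fin ?mulr_ge0 ?normc_ge0//.
    - by rewrite ltW// gint_gt0.
    - by have /cint_cmeas := fr u.
    - apply: eq_cint (cint0 _) => r.
      by rewrite /f gk// mul0r Normc.normc0.
  have -> : nint leb (fun r => f (u, r)) =
      ((normc (gker (a + b) x%:C u))%:E * nint leb (gker b u%:C))%E.
    exact: (nintZ leb (gker (a + b) x%:C u) (cmeas_gker b u%:C)).
  rewrite nint_gker// -EFinM lee_fin -gE// Normc.normcM normc_rpowc// ReN /G.
  by rewrite le_eqVlt; apply/orP; left; apply/eqP; ring.
have fu r : cint leb (fun u => f (u, r)) (gint (a + b) 1 * bker a b x r).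
  rewrite /bker; case: ifP => r0; last first.
    rewrite mulr0; apply: eq_cint (cint0 _) => u.
    by rewrite /f (gk _ _ r) ?mulr0// leNgt r0.
  have xr0 : 0 < x + r by rewrite addr_gt0.
  have h := cintZ (rpowc r (b - 1)) (gker_cint ab0 (xr0 : 0 < Re (x + r)%:C)).
  apply: cint_eqv (eq_cint _ h) _.
    move=> u; rewrite /f /gker /= r0; case: ifP => u0; last by rewrite mulr0 mul0r.
    by rewrite /rpowc -!cexpD; congr cexp; rewrite rmorphD/=; ring.
  by rewrite -[(x + r)%:C]mulr1 gint_scale// opprD; ring.
have H1 := cint_fubini1 (cintegrable_cint fi) fr.
have H2 := cint_fubini2 (cintegrable_cint fi) fu.
have e := cint_unique H1 (cintZ (gint b 1) (gker_cint a0 rx0)).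
have gp := gint_neq0 ab0.
rewrite e in H2.
apply: cint_eqv (eq_cint _ (cintZ (gint (a + b) 1)^-1 H2)) _.
  by move=> r; rewrite mulrA mulVf ?mul1r.
by rewrite -[x%:C]mulr1 gint_scale//; field.
Qed.

(** The beta function at (Re a, Re b). *)
Definition bconst a b : R :=
  Re (gint (Re a)%:C 1 * gint (Re b)%:C 1 / gint ((Re a)%:C + (Re b)%:C) 1).

Lemma nint_bker a b (x : R) : 0 < Re a -> 0 < Re b -> 0 < x ->
  nint leb (bker a b x) = (bconst a b * normc (rpowc x (- a)))%:E.
Proof.
move=> a0 b0 x0.
have h := bker_cint (a0 : 0 < Re (Re a)%:C) (b0 : 0 < Re (Re b)%:C) x0.
rewrite (nint_cint (cmeas_bker a b x) (eq_cint _ h)).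
  rewrite -rmorphN rpowc_real// normc_rpowc// ReN /bconst.
  by move: (_ / _) => z; rewrite ReM ReC ImC mulr0 subr0.
move=> r; rewrite /bker; case: ifP => r0; last by rewrite Normc.normc0.
have xr0 : 0 < x + r by rewrite addr_gt0.
rewrite Normc.normcM !normc_rpowc// -real_complexM -!rpowc_real//.
by congr (rpowc _ _ * rpowc _ _); rewrite !ReImE ?rmorphB ?rmorphN.
Qed.

Lemma bconst_ge0 a b : 0 < Re a -> 0 < Re b -> 0 <= bconst a b.
Proof.
move=> a0 b0; have := nint_bker a0 b0 ltr01.
have := nint_ge0 leb (bker a b 1) => + e; rewrite e lee_fin rpow1c Normc.normc1.
by rewrite mulr1.
Qed.

Lemma nint_radial d (T : measurableType d) (m : {sigma_finite_measure set T -> \bar R})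
    (Q : T -> R) (k nu : R) s : measurable_fun setT Q ->
  (forall x, 0 <= Q x) -> 0 <= k -> nu < Re s -> 0 <= nu ->
  (forall u, 0 < u -> cint m (fun x => (expR (- (u * Q x)))%:C) (k * u `^ (- nu))%:C) ->
  nint m (fun x => rpowc (1 + Q x) (- s)) =
  (k * Re (gint ((Re s)%:C - nu%:C) 1 / gint (Re s)%:C 1))%:E.
Proof.
move=> mQ Q0 k0 snu nu0 H.
have h := cint_radial mQ Q0 k0 (snu : nu < Re (Re s)%:C) nu0 H.
have x0 x : 0 < 1 + Q x by rewrite ltr_pwDl.
rewrite (nint_cint _ (eq_cint _ h)).
- by rewrite -mulrA (ReM k%:C) ReC ImC mul0r subr0.
- by apply: cmeas_rpowc; apply: measurable_funD.
- by move=> x; rewrite normc_rpowc// -rpowc_real// ReN rmorphN.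
Qed.

End one_dimensional_integrals.

(** * Measure preserving maps of coordinate spaces *)

Section tuple_maps.
Context {R : realType}.
Local Notation leb := (@lebesgue_measure R).
Local Notation RT := (measurableTypeR R).
Local Notation L := (@tuple_lebesgue R).

Lemma measurable_nth n i : measurable_fun setT (fun x : n.-tuple RT => nth (0 : R) x i : RT).
Proof.
have [ni|ni] := ltnP i n.
  have -> : (fun x : n.-tuple RT => nth (0 : R) x i : RT) = (fun x => tnth x (Ordinal ni)).
    by apply/funext => x; rewrite (tnth_nth (0 : R)).
  exact: measurable_tnth.
have -> : (fun x : n.-tuple RT => nth (0 : R) x i : RT) = cst (0 : R).
  by apply/funext => x; rewrite nth_default// size_tuple.
exact: measurable_cst.
Qed.

Lemma measurable_to_tuple d (T : measurableType d) n (f : T -> n.-tuple RT) :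
  (forall i, (i < n)%N -> measurable_fun setT (fun x => nth (0 : R) (f x) i : RT)) ->
  measurable_fun setT f.
Proof.
move=> H; apply/measurable_fun_tnthP => i.
have := H i (ltn_ord i); congr (measurable_fun _ _).
by apply/funext => x; rewrite /= (tnth_nth (0 : R)).
Qed.

(** Both m2 and m3 are images of m1, so that g can be tested on m1. *)
Lemma mpres_factor d1 d2 d3 (T1 : measurableType d1) (T2 : measurableType d2)
    (T3 : measurableType d3) (m1 : {measure set T1 -> \bar R})
    (m2 : {measure set T2 -> \bar R}) (m3 : {measure set T3 -> \bar R}) phi psi g :
  mpres m1 m2 phi -> mpres m1 m3 psi -> measurable_fun setT g ->
  (forall x, psi x = g (phi x)) -> mpres m2 m3 g.
Proof.
move=> [mphi Hphi] [mpsi Hpsi] mg E; split=> // A mA.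
rewrite -Hpsi// -Hphi; last by rewrite -[X in measurable X]setTI; exact: mg.
by congr (m1 _); apply/seteqP; split=> x /=; rewrite E.
Qed.

Lemma mpres_cons n : mpres (prodm leb (L n)) (L n.+1) (@tuple_cons R n).
Proof. by split=> //; exact: measurable_tuple_cons. Qed.

Lemma eq_mpres d1 d2 (T1 : measurableType d1) (T2 : measurableType d2)
    (m1 : {measure set T1 -> \bar R}) (m2 : {measure set T2 -> \bar R}) f g :
  (forall x, f x = g x) -> mpres m1 m2 f -> mpres m1 m2 g.
Proof. by move=> e; rewrite (_ : f = g)//; apply/funext. Qed.

Definition trcons n (p : n.-tuple RT * RT) : n.+1.-tuple RT := [tuple of rcons p.1 p.2].

Lemma measurable_trcons n : measurable_fun setT (@trcons n).
Proof.
apply: measurable_to_tuple => i; rewrite ltnS leq_eqVlt => /predU1P[->|ni].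
  have -> : (fun x : n.-tuple RT * RT => nth (0 : R) (trcons x) n : RT) = snd.
    by apply/funext => x; rewrite /= nth_rcons size_tuple ltnn eqxx.
  exact: measurable_snd.
have -> : (fun x : n.-tuple RT * RT => nth (0 : R) (trcons x) i : RT) =
    (fun y : n.-tuple RT => nth (0 : R) y i : RT) \o fst.
  by apply/funext => x; rewrite /= nth_rcons size_tuple ni.
by apply: measurableT_comp; [exact: measurable_nth|exact: measurable_fst].
Qed.

(** By induction: appending a coordinate commutes with prepending one. *)
Lemma mpres_trcons n : mpres (prodm (L n) leb) (L n.+1) (@trcons n).
Proof.
elim: n => [|n IH].
  apply: eq_mpres (mpres_comp (mpres_swap _ _) (mpres_cons 0)).
  by case=> x y; apply/val_inj; rewrite /= tuple0.
have h1 : mpres (prodm leb (prodm (L n) leb)) (prodm (L n.+1) leb)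
    (fun p => (tuple_cons (p.1, p.2.1), p.2.2)).
  apply: eq_mpres (mpres_comp (mpres_assoc _ _ _) (mpres_prod (mpres_cons n) (mpres_id leb))).
  by case=> x [y z].
have h2 := mpres_comp (mpres_prod (mpres_id leb) IH) (mpres_cons n.+1).
apply: (mpres_factor h1 h2); first exact: measurable_trcons.
by case=> x [y z]; apply/val_inj.
Qed.

Definition tcat a b (p : a.-tuple RT * b.-tuple RT) : (a + b).-tuple RT :=
  [tuple of p.1 ++ p.2].

Lemma measurable_tcat a b : measurable_fun setT (@tcat a b).
Proof.
apply: measurable_to_tuple => i _; have [ni|ni] := ltnP i a.
  have -> : (fun x : a.-tuple RT * b.-tuple RT => nth (0 : R) (tcat x) i : RT) =
      (fun y : a.-tuple RT => nth (0 : R) y i : RT) \o fst.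
    by apply/funext => x; rewrite /= nth_cat size_tuple ni.
  by apply: measurableT_comp; [exact: measurable_nth|exact: measurable_fst].
have -> : (fun x : a.-tuple RT * b.-tuple RT => nth (0 : R) (tcat x) i : RT) =
    (fun y : b.-tuple RT => nth (0 : R) y (i - a) : RT) \o snd.
  by apply/funext => x; rewrite /= nth_cat size_tuple ltnNge ni.
by apply: measurableT_comp; [exact: measurable_nth|exact: measurable_snd].
Qed.

Lemma mpres_tcat a b : mpres (prodm (L a) (L b)) (L (a + b)) (@tcat a b).
Proof.
elim: a => [|a IH].
  split=> [|A mA]; first exact: measurable_tcat.
  have -> : @tcat 0 b @^-1` A = setT `*` A.
    apply/seteqP; split=> [[x y]|[x y]] /=.
      by rewrite /tcat (tuple0 x) => h; split=> //; congr A: h; apply/val_inj.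
    by move=> [_]; congr A; rewrite /tcat (tuple0 x); apply/val_inj.
  transitivity ((L 0 setT * L b A)%E); first exact: product_measure1E.
  by rewrite /= diracE in_setT mul1e.
have h1 : mpres (prodm leb (prodm (L a) (L b))) (prodm (L a.+1) (L b))
    (fun p => (tuple_cons (p.1, p.2.1), p.2.2)).
  apply: eq_mpres (mpres_comp (mpres_assoc _ _ _) (mpres_prod (mpres_cons a) (mpres_id (L b)))).
  by case=> x [y z].
have h2 := mpres_comp (mpres_prod (mpres_id leb) IH) (mpres_cons (a + b)).
apply: (mpres_factor h1 h2); first exact: measurable_tcat.
by case=> x [y z]; apply/val_inj.
Qed.

Lemma mpres_tcast a b (e : a = b) : mpres (L a) (L b) (tcast e).
Proof. by case: b / e; exact: mpres_id. Qed.

Definition ttrans n (c : nat -> R) (x : n.-tuple RT) : n.-tuple RT :=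
  [tuple (nth (0 : R) x i + c i : RT) | i < n].

Lemma nth_ttrans n c (x : n.-tuple RT) i : (i < n)%N ->
  nth (0 : R) (ttrans c x) i = nth (0 : R) x i + c i.
Proof. by move=> ni; rewrite -(tnth_nth _ _ (Ordinal ni)) tnth_mktuple. Qed.

Lemma mpres_ttrans n c : mpres (L n) (L n) (@ttrans n c).
Proof.
elim: n c => [|n IH] c.
  apply: eq_mpres (mpres_id _) => x; rewrite (tuple0 x); exact/esym/tuple0.
have h := mpres_comp (mpres_prod (mpres_translation (c 0%N)) (IH (c \o succn))) (mpres_cons n).
apply: (mpres_factor (mpres_cons n) h).
  apply: measurable_to_tuple => i ni.
  have -> : (fun x : n.+1.-tuple RT => nth (0 : R) (ttrans c x) i : RT) =
      (fun x => nth (0 : R) x i + c i).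
    by apply/funext => x; rewrite nth_ttrans.
  by apply: measurable_funD => //; exact: measurable_nth.
case=> x y; apply/val_inj; apply: (@eq_from_nth _ (0 : R)); first by rewrite !size_tuple.
move=> i; rewrite size_tuple => ni; rewrite nth_ttrans//.
by case: i ni => [|i] // ni; exact: (nth_ttrans (c \o succn) y).
Qed.

End tuple_maps.

(** * Gaussian integrals of quadratic forms *)

Section gaussian_form.
Context {R : realType}.
Local Notation leb := (@lebesgue_measure R).
Local Notation RT := (measurableTypeR R).
Local Notation L := (@tuple_lebesgue R).

Lemma cint_tuple0 (f : 0.-tuple RT -> R[i]) : cint (L 0) f (f [tuple]).
Proof.
have h : cint (L 0) (fun=> 1%:C) (1 : R)%:C.
  apply: cint_ge0 => //.
  by rewrite integral_cst//= diracT mule1.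
apply: cint_eqv (eq_cint _ (cintZ (f [tuple]) h)) _; last by rewrite mulr1.
by move=> x; rewrite (tuple0 x) mulr1.
Qed.

(** A translation ttrans takes its shifts as a function on nat, hence the
    extension by 0. *)
Definition coordn n (w : 'cV[R]_n) (i : nat) : R := oapp (fun j => w j 0) 0 (insub i).

Lemma coordnE n (w : 'cV[R]_n) (i : 'I_n) : coordn w i = w i 0.
Proof. by rewrite /coordn valK. Qed.

Definition colv {K : Type} (x : nat -> K) k : 'cV[K]_k := \col_i x i.

Lemma qform_leadS (f : nat -> nat -> R) (x : nat -> R) k : (forall i j, f i j = f j i) ->
  lead f k \in unitmx ->
  qform (lead f k.+1) (colv x k.+1) =
  qform (lead f k) (colv x k + x k *: (invmx (lead f k) *m leadcol f k)) +
  pivot f k * x k ^+ 2.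
Proof.
move=> fC u; rewrite pivotE// -addn1 lead_block_mx//.
have -> : colv x (k + 1) = col_mx (colv x k) (x k)%:M.
  apply/colP => i; case: (split_ordP i) => i' ->.
    by rewrite col_mxEu !mxE.
  by rewrite col_mxEd !mxE (ord1 i')/= addn0 mulr1n.
rewrite qform_block ?tr_lead// mul_mx_scalar; congr (_ + _).
rewrite /qform tr_scalar_mx mul_scalar_mx mul_mx_scalar !mxE mulr1n; ring.
Qed.

Lemma measurable_qform d (T : measurableType d) n (A : 'M[R]_n) (v : T -> 'cV[R]_n) :
  (forall i, measurable_fun setT (fun x => v x i 0 : RT)) ->
  measurable_fun setT (fun x => qform A (v x) : RT).
Proof.
move=> mv.
have -> : (fun x => qform A (v x) : RT) =
    (fun x => \sum_j (\sum_i v x i 0 * A i j) * v x j 0).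
  apply/funext => x; rewrite /qform mxE; apply: eq_bigr => j _.
  by rewrite mxE; congr (_ * _); apply: eq_bigr => i _; rewrite mxE.
apply: measurable_sum => j; apply: measurable_funM; last exact: (mv j).
by apply: measurable_sum => i; apply: measurable_funM; [exact: (mv i)|exact: measurable_cst].
Qed.

(** For nonnegative functions the integral bounds the modulus. *)
Lemma cint_prod_ge0 d1 d2 (T1 : measurableType d1) (T2 : measurableType d2)
    (m1 : {sigma_finite_measure set T1 -> \bar R})
    (m2 : {sigma_finite_measure set T2 -> \bar R})
    (f : T1 * T2 -> R) (g : T1 -> R) (c v : R) :
  measurable_fun setT f -> 0 <= c -> (forall x, 0 <= f x) -> (forall x, 0 <= g x) ->
  (forall x, cint m2 (fun y => (f (x, y))%:C) (c * g x)%:C) ->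
  cint m1 (fun x => (g x)%:C) v%:C -> cint (prodm m1 m2) (fun x => (f x)%:C) (c * v)%:C.
Proof.
move=> mf c0 f0 g0 fg gv.
have mfc : cmeas (fun x => (f x)%:C) by exact: cmeasC.
have fgb x : cintb m2 (fun y => (f (x, y))%:C) (c%:C * (g x)%:C) (c * normc (g x)%:C).
  split; first by rewrite real_complexM.
  rewrite (nint_cint (v := (c * g x)%:C)).
  - by rewrite ReC normcC ger0_norm.
  - by have /cint_cmeas := fg x.
  - by apply: eq_cint (fg x) => y; rewrite normcC ger0_norm.
have gb : cintb m1 (fun x => (g x)%:C) v%:C v.
  split => //; rewrite (nint_cint (v := v%:C)) ?ReC//; first by have /cint_cmeas := gv.
  by apply: eq_cint gv => x; rewrite normcC ger0_norm.
by have [h _] := cintb_prod mfc c0 fgb gb; rewrite -real_complexM.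
Qed.

(** Integrate out the first coordinates by completing the square; the quadratic
    form left in the last coordinate is the pivot. *)
Lemma cint_gaussian (f : nat -> nat -> R) n (u : R) : (forall i j, f i j = f j i) ->
  posdefmx (lead f n) -> 0 < u ->
  cint (L n) (fun x => (expR (- (u * qform (lead f n) (colv (nth 0 x) n))))%:C)
    (Num.sqrt (pi / u) ^+ n / Num.sqrt (\det (lead f n)))%:C.
Proof.
move=> fC + u0; elim: n => [_|n IH p1].
  have -> : (Num.sqrt (pi / u) ^+ 0 / Num.sqrt (\det (lead f 0)))%:C = 1 :> R[i].
    by rewrite det_lead0 sqrtr1 divr1.
  apply: cint_eqv (cint_tuple0 _) _.
  by rewrite /qform mxE big_ord0 mulr0 oppr0 expR0.
have [p0 d0] := (posdef_leadS n fC).1 p1.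
have un := posdef_unit p0.
have {}IH := IH p0.
pose w := invmx (lead f n) *m leadcol f n.
set c := Num.sqrt (pi / u) ^+ n / _ in IH.
have c0 : 0 <= c by rewrite divr_ge0 ?exprn_ge0 ?sqrtr_ge0.
have mq : measurable_fun setT (fun x : n.+1.-tuple RT =>
    expR (- (u * qform (lead f n.+1) (colv (nth 0 x) n.+1)))).
  apply: measurableT_comp => //; apply: measurable_funN; apply: measurable_funM => //.
  apply: measurable_qform => i; have := @measurable_nth R n.+1 i.
  by congr (measurable_fun _ _); apply/funext => x; rewrite mxE.
apply: (mpres_cint (mpres_comp (mpres_swap leb (L n)) (mpres_trcons n))).
  exact: cmeasC.
pose g (r : R) := expR (- (u * pivot f n * r ^+ 2)).
have up0 : 0 < u * pivot f n by rewrite mulr_gt0.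
have gE (r : R) (q : n.-tuple RT) :
    expR (- (u * qform (lead f n.+1) (colv (nth 0 (trcons (q, r : RT))) n.+1))) =
    expR (- (u * qform (lead f n) (colv (nth 0 q) n + r *: w))) * g r.
  rewrite qform_leadS// -expRD; congr expR.
  have -> : colv (nth 0 (trcons (q, r : RT))) n = colv (nth 0 q) n.
    by apply/colP => i; rewrite !mxE nth_rcons size_tuple ltn_ord.
  have -> : nth 0 (trcons (q, r : RT)) n = r by rewrite /= nth_rcons size_tuple ltnn eqxx.
  by rewrite -/w; ring.
have -> : (Num.sqrt (pi / u) ^+ n.+1 / Num.sqrt (\det (lead f n.+1)))%:C =
    (c * Num.sqrt (pi / (u * pivot f n)))%:C.
  congr _%:C.
  have -> : \det (lead f n.+1) = \det (lead f n) * pivot f n.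
    rewrite /pivot mulrC divfK//; move: un; rewrite unitmxE unitfE //.
  have dn : 0 < \det (lead f n) by apply: posdef_det_gt0 => //; exact: tr_lead.
  have e1 : Num.sqrt (\det (lead f n) * pivot f n) =
      Num.sqrt (\det (lead f n)) * Num.sqrt (pivot f n) by rewrite sqrtrM// ltW.
  have e2 : Num.sqrt (pi / (u * pivot f n)) = Num.sqrt (pi / u) / Num.sqrt (pivot f n).
    by rewrite invfM mulrA sqrtrM ?divr_ge0 ?pi_ge0 ?ltW// sqrtrV// ltW.
  by rewrite e1 e2 /c exprSr; field; rewrite !gt_eqF// sqrtr_gt0.
apply: (@cint_prod_ge0 _ _ _ _ leb (L n) _ g).
- have [mt _] := mpres_comp (mpres_swap leb (L n)) (mpres_trcons n).
  exact: measurableT_comp mq mt.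
- exact: c0.
- by move=> x; exact: expR_ge0.
- by move=> x; exact: expR_ge0.
- move=> r; apply: (mpres_cint (mpres_ttrans n (coordn (- r *: w)))).
    apply: cmeasC; have [mt _] := mpres_comp (mpres_swap leb (L n)) (mpres_trcons n).
    have := measurableT_comp mq mt.
    by move=> /(fun h => measurableT_comp h (pair1_measurable r)).
  apply: cint_eqv (eq_cint _ (cintZ (g r)%:C IH)) _; last by rewrite real_complexM mulrC.
  move=> q; rewrite real_complexM; congr _%:C.
  transitivity (expR (- (u * qform (lead f n)
    (colv (nth 0 (ttrans (coordn (- r *: w)) q)) n + r *: w))) * g r); last by rewrite -gE.
  rewrite mulrC; congr (expR (- (u * qform _ _)) * _).
  apply/colP => i; rewrite !mxE nth_ttrans// coordnE !mxE.
  by rewrite -addrA -mulrDl addNr mul0r addr0.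
- exact: cint_gauss up0.
Qed.

End gaussian_form.

(** * Integration over the last column *)

Section complex_symmetric.
Context {R : realType}.

Lemma cplx_mxM m n k (A B : 'M[R]_(m, n)) (C D : 'M[R]_(n, k)) :
  cplx_mx A B *m cplx_mx C D = cplx_mx (A *m C - B *m D) (A *m D + B *m C).
Proof.
apply/matrixP => i j; rewrite cplx_mxE !mxE.
apply: complex_eqP.
  rewrite Re_sum -sumrB; apply: eq_bigr => l _.
  by rewrite ReM !Re_cplx_mx !Im_cplx_mx.
rewrite Im_sum -big_split; apply: eq_bigr => l _.
by rewrite ImM !Re_cplx_mx !Im_cplx_mx.
Qed.

Lemma cplx_mxD m n (A B C D : 'M[R]_(m, n)) :
  cplx_mx A B + cplx_mx C D = cplx_mx (A + C) (B + D).
Proof. by rewrite /cplx_mx !map_mxD scalerDr addrACA. Qed.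

Lemma cplx_mx1 n : cplx_mx 1%:M 0 = 1%:M :> 'M[R[i]]_n.
Proof.
apply/matrixP => i j; rewrite cplx_mxE !mxE; case: (i == j) => //.
Qed.

Lemma tr_cplx_mx m n (A B : 'M[R]_(m, n)) : (cplx_mx A B)^T = cplx_mx A^T B^T.
Proof. by apply/matrixP => i j; rewrite mxE !cplx_mxE !mxE. Qed.

Section inverse.
Variables (n : nat) (A K : 'M[R]_n).
Hypotheses (sA : A^T = A) (sK : K^T = K) (pA : posdefmx A).

(** This is Z A^-1 Z^* for Z = A + iK. *)
Definition resolvent_gram : 'M[R]_n := A + K *m invmx A *m K.
Local Notation M := resolvent_gram.
Local Notation N := (invmx resolvent_gram).

Lemma tr_gram : M^T = M.
Proof. by rewrite linearD/= !trmx_mul trmx_inv sA sK mulmxA. Qed.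

Lemma posdef_gram : posdefmx M.
Proof.
move=> x x0; rewrite mulmxDr mulmxDl mxE ltr_pwDl ?pA//.
have := posdef_ge0 (K *m x) (posdef_inv sA pA).
by rewrite /qform trmx_mul sK !mulmxA.
Qed.

Lemma gram_unit : M \in unitmx. Proof. exact: posdef_unit posdef_gram. Qed.

Lemma gram_comm : N *m K *m invmx A = invmx A *m K *m N.
Proof.
have uM := gram_unit; have uA := posdef_unit pA.
have e : K *m invmx A *m M = M *m invmx A *m K.
  by rewrite mulmxDr !mulmxDl mulmxKV// mulmxV// mul1mx !mulmxA.
have : N *m (K *m invmx A *m M) *m N = N *m (M *m invmx A *m K) *m N by rewrite e.
rewrite -[in LHS](mulmxA K) !mulmxA mulmxK// mulVmx// mul1mx => <-.
by [].
Qed.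

(** The inverse of Z = A + iK has the positive definite real part
    (A + K A^-1 K)^-1. *)
Lemma inv_cplx_mx : invmx (cplx_mx A K) = cplx_mx N (- (N *m K *m invmx A)).
Proof.
have uM := gram_unit; have uA := posdef_unit pA.
have uZ := accretive_unit (accretive_cplx sA sK pA).
have e : cplx_mx N (- (N *m K *m invmx A)) *m cplx_mx A K = 1%:M.
  rewrite cplx_mxM !mulNmx opprK mulmxKV// subrr -cplx_mx1; congr cplx_mx.
  by rewrite -(mulmxA N) -(mulmxA N) -mulmxDr mulVmx.
by rewrite -[LHS]mul1mx -e mulmxK.
Qed.

(** In the variable l' = l - K A^-1 q the real part of z^T Z^-1 z splits; here
    l stands for l'. *)
Lemma Re_form_inv (q l : 'cV[R]_n) :
  let z := cplx_mx q (l + K *m invmx A *m q) in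
  Re ((z^T *m invmx (cplx_mx A K) *m z) 0 0) = qform (invmx A) q - qform N l.
Proof.
move=> z; have uA := posdef_unit pA; have uM := gram_unit.
have uZ := accretive_unit (accretive_cplx sA sK pA).
pose y := invmx A *m q.
have zE : invmx (cplx_mx A K) *m z = cplx_mx (y + N *m K *m invmx A *m l) (N *m l).
  have -> : z = cplx_mx A K *m cplx_mx y 0 + cplx_mx 0 l.
    rewrite cplx_mxM !mulmx0 subr0 add0r mulKVmx// mulmxA.
    by rewrite cplx_mxD addr0 [X in cplx_mx _ X]addrC.
  rewrite mulmxDr mulKmx// inv_cplx_mx cplx_mxM !mulmx0 addr0 sub0r mulNmx opprK.
  by rewrite cplx_mxD add0r.
rewrite -mulmxA zE tr_cplx_mx cplx_mxM Re_cplx_mx mulmxDr [(_ + _)^T]linearD/= mulmxDl.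
have e : q^T *m (N *m K *m invmx A *m l) = (K *m invmx A *m q)^T *m (N *m l).
  by rewrite gram_comm !trmx_mul trmx_inv sA sK !mulmxA.
have mE (u v : 'M[R]_1) : (u + v) 0 0 = u 0 0 + v 0 0 by rewrite mxE.
have mN (u : 'M[R]_1) : (- u) 0 0 = - u 0 0 by rewrite !mxE.
rewrite e !mE mN mE /qform -!mulmxA -/y.
set u := (_ *m (N *m l)) 0 0; set v := (_ *m _) 0 0; ring.
Qed.

(** Take determinants in M = Z A^-1 Z^*, where Z^* = A - iK. *)
Lemma normc_det_cplx : normc (\det (cplx_mx A K)) ^+ 2 = \det A * \det M.
Proof.
have uA := posdef_unit pA.
have dA : \det A != 0 by move: uA; rewrite unitmxE unitfE.
have CJ : (\det (cplx_mx A K))^* = \det (cplx_mx A (- K)).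
  rewrite -[LHS](det_map_mx (conjc (R:=R))); congr (\det _).
  by apply/matrixP => i j; rewrite mxE !cplx_mxE [in RHS]mxE.
have CR (B : 'M[R]_n) : (\det B)%:C = \det (cplx_mx B 0).
  rewrite -(det_map_mx (real_complex R)); congr (\det _).
  by apply/matrixP => i j; rewrite cplx_mxE !mxE.
apply: (@complexI R); rewrite -mulJc CJ -real_complexM.
have -> : (\det M)%:C = \det (cplx_mx A K) * (\det A)^-1%:C * \det (cplx_mx A (- K)).
  rewrite -det_inv CR CR -!det_mulmx !cplx_mxM !mulmx0 !subr0 !add0r.
  rewrite !mulmxN opprK; congr (\det (cplx_mx _ _)).
    by rewrite mulmxV// mul1mx.
  by rewrite mulmxV// mul1mx mulmxKV// addNr.
clear CJ CR uA; move: (\det A) (\det (cplx_mx A K)) (\det (cplx_mx A (- K))) dA => d a b d0.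
have -> : d%:C * (a * (d^-1)%:C * b) = (d%:C * (d^-1)%:C) * (a * b) by ring.
by rewrite real_complexM divff// mul1r.
Qed.

End inverse.

End complex_symmetric.

Section column_integral.
Context {R : realType}.
Local Notation leb := (@lebesgue_measure R).
Local Notation RT := (measurableTypeR R).
Local Notation L := (@tuple_lebesgue R).

Lemma cintb_translate (f : RT -> R[i]) v B (c : R) : cmeas f -> cintb leb f v B ->
  cintb leb (fun x : RT => f (x + c)) v B.
Proof.
move=> mf h; apply: (mpres_cintb (mpres_translation (- c))).
  by apply: cmeas_comp mf _; apply: measurable_funD.
by apply: eq_cintb h => // x; rewrite subrK.
Qed.

Lemma cintb0 d (T : measurableType d) (m : {sigma_finite_measure set T -> \bar R}) (B : R) :
  0 <= B -> cintb m (fun=> 0) 0 B.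
Proof.
move=> B0; split; first exact: cint0.
have -> : nint m (fun=> 0 : R[i]) = (Re (0 : R[i]))%:E; last by rewrite lee_fin.
apply: nint_cint; first exact: cmeas_cst.
by apply: eq_cint (cint0 _) => x; rewrite Normc.normc0.
Qed.

Lemma cintbZ d (T : measurableType d) (m : {sigma_finite_measure set T -> \bar R})
  (f : T -> R[i]) c v B : cintb m f v B -> cintb m (fun x => c * f x) (c * v) (normc c * B).
Proof.
move=> [h b]; split; first exact: cintZ.
rewrite nintZ; last exact: cint_cmeas h.
by rewrite EFinM lee_pmul// ?nint_ge0// lee_fin normc_ge0.
Qed.

(** The diagonal entries of the last column come first: m runs over a vertical
    line, and the power of x + r - d that it leaves makes the integral over r
    a beta integral. *)
Lemma cintb_diagonal a s t (x d w : R) : 0 < x -> 0 < Re (a + 1) ->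
  0 < Re (s + t - a - 2%:R) ->
  cintb (prodm leb leb)
    (fun rm => if 0 < rm.1 - d then
      rpowc (rm.1 - d) a * hpow ((x + (rm.1 - d)) +i* (rm.2 - w)) (- s) (- t) else 0)
    (vint (- s) (- t) * (gint (s + t - a - 2%:R) 1 * gint (a + 1) 1 / gint (s + t - 1) 1) *
      rpowc x (- (s + t - a - 2%:R)))
    (vnorm (- s) (- t) * bconst (s + t - a - 2%:R) (a + 1) *
      normc (rpowc x (- (s + t - a - 2%:R)))).
Proof.
set al := s + t - a - 2%:R => x0 b0 a0.
have st : 1 < Re (s + t) by move: a0 b0; rewrite /al !ReImE; lra.
pose g (r : RT) := bker al (a + 1) x (r + - d).
have gb : cintb leb g (gint al 1 * gint (a + 1) 1 / gint (al + (a + 1)) 1 * rpowc x (- al))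
    (bconst al (a + 1) * normc (rpowc x (- al))).
  apply: cintb_translate; first exact: cmeas_bker.
  by split; [exact: bker_cint|rewrite nint_bker].
have -> : s + t - 1 = al + (a + 1) by rewrite /al; ring.
rewrite -[vint _ _ * _ * _]mulrA -[vnorm _ _ * _ * _]mulrA.
apply: cintb_prod gb.
- have m1 : measurable_fun setT (fun rm : RT * RT => rm.1 - d : RT) by apply: measurable_funB.
  apply: cmeas_if; [exact: measurable_pos| |exact: cmeas_cst].
  apply: cmeasM; first exact: cmeas_rpowc.
  apply: cmeas_hpow; split.
    by apply: measurable_funD.
  by apply: measurable_funB.
- exact: vnorm_ge0.
- move=> r; rewrite /g /bker /=; case: ifP => r0; last first.
    by rewrite mulr0; apply: cintb0; rewrite Normc.normc0 mulr0.
  have xr0 : 0 < x + (r - d) by rewrite addr_gt0.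
  have h := cintbZ (rpowc (r - d) a) (cintb_hpow_line (- w) xr0 st).
  have e : 1 - s - t = - al - (a + 1) by rewrite /al; ring.
  apply: eq_cintb h => //; rewrite addrK e; first by ring.
  by rewrite (Normc.normcM (rpowc (r - d) a)); ring.
Qed.

(** The form left in the last column once its diagonal entries are integrated,
    in the variables q and l - K A^-1 q. *)
Definition mixed_form n (P N : 'M[R]_n) (x : n.-tuple RT * n.-tuple RT) : R :=
  qform (invmx P - invmx (1%:M + P)) (colv (nth 0 x.1) n) + qform N (colv (nth 0 x.2) n).

Lemma cint_qform n (A : 'M[R]_n) (u : R) : A^T = A -> posdefmx A -> 0 < u ->
  cint (L n) (fun x => (expR (- (u * qform A (colv (nth 0 x) n))))%:C)
    (Num.sqrt (pi / u) ^+ n / Num.sqrt (\det A))%:C.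
Proof.
move=> sA pA u0.
pose f i j := oapp (fun i' : 'I_n => oapp (fun j' : 'I_n => A i' j') 0 (insub j)) 0 (insub i).
have fA : lead f n = A by apply/matrixP => i j; rewrite mxE /f !valK.
have fC i j : f i j = f j i.
  rewrite /f; case: (insub i) => [i'|]; case: (insub j) => [j'|] //=.
  by rewrite -[in LHS]sA mxE.
by rewrite -fA; apply: cint_gaussian => //; rewrite fA.
Qed.

Lemma measurable_colv_form n (A : 'M[R]_n) :
  measurable_fun setT (fun x : n.-tuple RT => qform A (colv (nth 0 x) n) : RT).
Proof.
apply: measurable_qform => i; have := @measurable_nth R n i.
by congr (measurable_fun _ _); apply/funext => x; rewrite mxE.
Qed.

Lemma measurable_mixed_form n (P N : 'M[R]_n) :
  measurable_fun setT (mixed_form P N : _ -> RT).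
Proof.
apply: measurable_funD.
  by apply: (measurableT_comp (measurable_colv_form _)); exact: measurable_fst.
by apply: (measurableT_comp (measurable_colv_form _)); exact: measurable_snd.
Qed.

(** The radial reduction, with the Gaussian integrals of the two forms. *)
Lemma cintb_offdiagonal n (P N : 'M[R]_n) (s : R[i]) : P^T = P -> posdefmx P ->
  N^T = N -> posdefmx N -> n%:R < Re s ->
  let k := pi ^+ n / (Num.sqrt (\det (invmx P - invmx (1%:M + P))) * Num.sqrt (\det N)) in
  cintb (prodm (L n) (L n)) (fun x => rpowc (1 + mixed_form P N x) (- s))
    (k%:C * gint (s - (n%:R : R)%:C) 1 / gint s 1)
    (k * Re (gint ((Re s)%:C - (n%:R : R)%:C) 1 / gint (Re s)%:C 1)).
Proof.
move=> sP pP sN pN ns k.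
have pH := posdef_inv_sub sP pP.
have sH : (invmx P - invmx (1%:M + P))^T = invmx P - invmx (1%:M + P).
  by rewrite linearB/= !trmx_inv linearD/= trmx1 sP.
have Q0 x : 0 <= mixed_form P N x by rewrite addr_ge0// posdef_ge0.
have k0 : 0 <= k by rewrite divr_ge0 ?exprn_ge0 ?pi_ge0// mulr_ge0 ?sqrtr_ge0.
have n0 : 0 <= n%:R :> R by rewrite ler0n.
have mQ := measurable_mixed_form P N.
have H u : 0 < u -> cint (prodm (L n) (L n))
    (fun x => (expR (- (u * mixed_form P N x)))%:C) (k * u `^ (- n%:R))%:C.
  move=> u0.
  have h1 := cint_qform sH pH u0; have h2 := cint_qform sN pN u0.
  set H := invmx P - _ in sH pH h1 k k0 mQ Q0 *.
  have -> : k * u `^ (- n%:R) = (Num.sqrt (pi / u) ^+ n / Num.sqrt (\det N)) *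
     (Num.sqrt (pi / u) ^+ n / Num.sqrt (\det H)).
    have e : Num.sqrt (pi / u) ^+ n * Num.sqrt (pi / u) ^+ n = pi ^+ n * u `^ (- n%:R).
      rewrite -exprMn -expr2 sqr_sqrtr ?divr_ge0 ?pi_ge0 ?ltW//.
      by rewrite powRN powR_mulrn ?ltW// exprMn exprVn.
    by rewrite /k mulrACA e invfM; ring.
  have mE : measurable_fun setT (fun x => expR (- (u * mixed_form P N x))).
    by apply: measurableT_comp => //; apply: measurable_funN; apply: measurable_funM.
  have c0 : 0 <= Num.sqrt (pi / u) ^+ n / Num.sqrt (\det N).
    by rewrite divr_ge0 ?exprn_ge0 ?sqrtr_ge0.
  apply: (cint_prod_ge0 mE c0 (fun x => expR_ge0 _) _ _ h1) => [q|q]; first exact: expR_ge0.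
  rewrite -real_complexM mulrC; apply: eq_cint (cintZ _ h2) => l.
  by rewrite real_complexM -expRD; congr (expR _)%:C; rewrite /mixed_form; ring.
split; first exact: cint_radial.
by rewrite (nint_radial mQ Q0 k0 ns n0 H).
Qed.

(** The part of the last column in the last pivot of 1 + T + iS. *)
Definition colw n (P K : 'M[R]_n) (x : n.-tuple RT * n.-tuple RT) : R[i] :=
  let z := cplx_mx (colv (nth 0 x.1) n) (colv (nth 0 x.2) n) in
  (z^T *m invmx (cplx_mx (1%:M + P) K) *m z) 0 0.

(** The factor of the integrand that belongs to the last pivots, at the point
    ((q, l), (r, m)). *)
Definition colker n (P K : 'M[R]_n) (a s t : R[i])
    (x : (n.-tuple RT * n.-tuple RT) * (RT * RT)) : R[i] :=
  if 0 < x.2.1 - qform (invmx P) (colv (nth 0 x.1.1) n) then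
    rpowc (x.2.1 - qform (invmx P) (colv (nth 0 x.1.1) n)) a *
    hpow ((1 + x.2.1) +i* x.2.2 - colw P K x.1) (- s) (- t) else 0.

Lemma cmeas_colw n (P K : 'M[R]_n) : cmeas (colw P K).
Proof.
have mn (i : 'I_n) : measurable_fun setT (fun x : n.-tuple RT => colv (nth 0 x) n i 0 : RT).
  by have := @measurable_nth R n i; congr (measurable_fun _ _); apply/funext => x; rewrite mxE.
have mz (i : 'I_n) : cmeas (fun x : n.-tuple RT * n.-tuple RT =>
    cplx_mx (colv (nth 0 x.1) n) (colv (nth 0 x.2) n) i 0).
  split.
    have h : measurable_fun setT (fun x : n.-tuple RT * n.-tuple RT =>
        colv (nth 0 x.1) n i 0 : RT).
      by apply: (measurableT_comp (mn i)); exact: measurable_fst.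
    by move: h; congr (measurable_fun _ _); apply/funext => x; rewrite Re_cplx_mx.
  have h : measurable_fun setT (fun x : n.-tuple RT * n.-tuple RT =>
      colv (nth 0 x.2) n i 0 : RT).
    by apply: (measurableT_comp (mn i)); exact: measurable_snd.
  by move: h; congr (measurable_fun _ _); apply/funext => x; rewrite Im_cplx_mx.
pose W := invmx (cplx_mx (1%:M + P) K).
apply: (@eq_cmeas _ _ _ (fun x : n.-tuple RT * n.-tuple RT => \sum_j (\sum_i
    cplx_mx (colv (nth 0 x.1) n) (colv (nth 0 x.2) n) i 0 * W i j) *
    cplx_mx (colv (nth 0 x.1) n) (colv (nth 0 x.2) n) j 0)).
  move=> x; rewrite /colw mxE; apply: eq_bigr => j _.
  by rewrite [in RHS]mxE; congr (_ * _); apply: eq_bigr => i _; rewrite [in RHS]mxE.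
apply: cmeas_sum => j; apply: cmeasM; last exact: mz.
by apply: cmeas_sum => i; apply: cmeasM; [exact: mz|exact: cmeas_cst].
Qed.

(** The Gaussian determinants combine to the square root of det P and the
    modulus of det Z. *)
Lemma column_determinants n (P K : 'M[R]_n) : P^T = P -> posdefmx P -> K^T = K ->
  (Num.sqrt (\det (invmx P - invmx (1%:M + P))) *
   Num.sqrt (\det (invmx (resolvent_gram (1%:M + P) K))))^-1 =
  Num.sqrt (\det P) * normc (\det (cplx_mx (1%:M + P) K)).
Proof.
move=> sP pP sK; set A := 1%:M + P.
have pA : posdefmx A := posdef_add1 pP.
have sA : A^T = A by rewrite linearD/= trmx1 sP.
have dP := posdef_det_gt0 sP pP; have dA := posdef_det_gt0 sA pA.
have dM := posdef_det_gt0 (tr_gram sA sK) (posdef_gram sA sK pA).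
rewrite det_inv_sub// det_inv sqrtrV ?mulr_ge0 ?ltW// sqrtrV ?ltW// -invfM invrK.
rewrite sqrtrM ?ltW// -mulrA; congr (_ * _).
rewrite -sqrtrM ?ltW// -(normc_det_cplx K pA) sqrtr_sqr ger0_norm ?normc_ge0//.
Qed.

(** The shear l |-> l + K A^-1 q preserves the measure and separates q from l
    in the form that the diagonal entries leave. *)
Lemma cintb_column n (P K : 'M[R]_n) (a s t : R[i]) : P^T = P -> posdefmx P -> K^T = K ->
  0 < Re (a + 1) -> n%:R < Re (s + t - a - 2%:R) ->
  let al := s + t - a - 2%:R in
  let D := Num.sqrt (\det P) * normc (\det (cplx_mx (1%:M + P) K)) in
  cintb (prodm (prodm (L n) (L n)) (prodm leb leb)) (colker P K a s t)
    (vint (- s) (- t) * (gint al 1 * gint (a + 1) 1 / gint (s + t - 1) 1) *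
      ((pi ^+ n * D)%:C * gint (al - (n%:R : R)%:C) 1 / gint al 1))
    (vnorm (- s) (- t) * bconst al (a + 1) *
      (pi ^+ n * D * Re (gint ((Re al)%:C - (n%:R : R)%:C) 1 / gint (Re al)%:C 1))).
Proof.
move=> sP pP sK b0 aln al D.
have al0 : 0 < Re al by apply: le_lt_trans aln; rewrite ler0n.
pose A := 1%:M + P.
have pA : posdefmx A := posdef_add1 pP.
have sA : A^T = A by rewrite linearD/= trmx1 sP.
pose N := invmx (resolvent_gram A K).
have pM := posdef_gram sA sK pA.
have pN : posdefmx N by apply: posdef_inv => //; exact: tr_gram.
have sN : N^T = N by rewrite trmx_inv tr_gram.
pose d (q : n.-tuple RT) := qform (invmx P) (colv (nth 0 q) n).
pose b x := 1 + d x.1 - Re (colw P K x).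
have mb : measurable_fun setT (b : _ -> RT).
  apply: measurable_funB; last by have [] := cmeas_colw P K.
  apply: measurable_funD => //.
  by apply: (measurableT_comp (measurable_colv_form (invmx P))); exact: measurable_fst.
pose sh (q : n.-tuple RT) := K *m invmx A *m colv (nth 0 q) n.
pose shear (x : n.-tuple RT * n.-tuple RT) := (x.1, ttrans (coordn (sh x.1)) x.2).
have bE x : b (shear x) = 1 + mixed_form P N x.
  have cE : colv (nth 0 (shear x).2) n =
      colv (nth 0 x.2) n + K *m invmx A *m colv (nth 0 x.1) n.
    by apply/colP => i; rewrite mxE nth_ttrans// coordnE [RHS]mxE [in RHS]mxE.
  have e : Re (((cplx_mx (colv (nth 0 x.1) n) (colv (nth 0 x.2) n +
        K *m invmx A *m colv (nth 0 x.1) n))^T *m invmx (cplx_mx A K) *m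
      cplx_mx (colv (nth 0 x.1) n) (colv (nth 0 x.2) n +
        K *m invmx A *m colv (nth 0 x.1) n)) 0 0) =
      qform (invmx A) (colv (nth 0 x.1) n) - qform N (colv (nth 0 x.2) n).
    exact: (Re_form_inv sA sK pA (colv (nth 0 x.1) n) (colv (nth 0 x.2) n)).
  rewrite /b /colw cE -/A e.
  rewrite /mixed_form /d -/A.
  have -> : qform (invmx P - invmx A) (colv (nth 0 x.1) n) =
      qform (invmx P) (colv (nth 0 x.1) n) - qform (invmx A) (colv (nth 0 x.1) n).
    by rewrite /qform mulmxBr mulmxBl !mxE.
  by ring.
have shK x : exists y, shear y = x.
  exists (x.1, ttrans (fun i => - coordn (sh x.1) i) x.2); case: x => q l; congr pair.
  apply: eq_from_tnth => i; rewrite !(tnth_nth 0) nth_ttrans// nth_ttrans//.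
  by rewrite /= addrK || by rewrite /= subrK.
have b_gt0 x : 0 < b x.
  have [y <-] := shK x; rewrite bE ltr_pwDl// addr_ge0// posdef_ge0//.
  exact: posdef_inv_sub.
have mshear : mpres (prodm (L n) (L n)) (prodm (L n) (L n)) shear.
  apply: (mpres_skew (g := fun q => ttrans (coordn (sh q))) (mpres_id (L n))).
    by move=> q; exact: mpres_ttrans.
  apply: measurable_to_tuple => i ni.
  have -> : (fun x : n.-tuple RT * n.-tuple RT =>
      nth (0 : R) (ttrans (coordn (sh x.1)) x.2) i : RT) =
      (fun x => nth (0 : R) x.2 i +
        \sum_j (K *m invmx A) (Ordinal ni) j * nth (0 : R) x.1 j).
    apply/funext => x; rewrite nth_ttrans//; congr (_ + _).
    rewrite -[i in LHS]/(nat_of_ord (Ordinal ni)) coordnE mxE.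
    by apply: eq_bigr => j _; rewrite [colv _ _ _ _]mxE.
  apply: measurable_funD.
    have h : measurable_fun setT ((fun y : n.-tuple RT => nth (0 : R) y i : RT) \o
        (@snd (n.-tuple RT) (n.-tuple RT))).
      by apply: measurableT_comp; [exact: measurable_nth|exact: measurable_snd].
    exact: h.
  apply: measurable_sum => j; apply: measurable_funM; first exact: measurable_cst.
  have h : measurable_fun setT ((fun y : n.-tuple RT => nth (0 : R) y j : RT) \o
      (@fst (n.-tuple RT) (n.-tuple RT))).
    by apply: measurableT_comp; [exact: measurable_nth|exact: measurable_fst].
  exact: h.
have mg : cmeas (fun x => rpowc (b x) (- al)) by exact: cmeas_rpowc.
have gb := cintb_offdiagonal sP pP sN pN aln.
cbv zeta in gb; rewrite column_determinants// -/D in gb.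
have {gb}gb := eq_cintb (fun x => congr1 (rpowc ^~ (- al)) (esym (bE x))) erefl erefl gb.
have {gb}gb := mpres_cintb mshear mg gb.
apply: cintb_prod gb.
- have m1 : measurable_fun setT (fun x : (n.-tuple RT * n.-tuple RT) * (RT * RT) =>
      x.2.1 : RT) by apply: measurableT_comp => //; exact: measurable_snd.
  have m2 : measurable_fun setT (fun x : (n.-tuple RT * n.-tuple RT) * (RT * RT) =>
      x.2.2 : RT) by apply: measurableT_comp => //; exact: measurable_snd.
  have m3 : measurable_fun setT (fun x : (n.-tuple RT * n.-tuple RT) * (RT * RT) =>
      x.2.1 - qform (invmx P) (colv (nth 0 x.1.1) n) : RT).
    apply: measurable_funB => //; apply: (measurableT_comp (measurable_colv_form _)).
    by apply: measurableT_comp => //; exact: measurable_fst.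
  apply: cmeas_if; [exact: measurable_pos| |exact: cmeas_cst].
  apply: cmeasM; first exact: cmeas_rpowc.
  apply: cmeas_hpow; apply: cmeasB.
    by split => //; apply: measurable_funD.
  exact: cmeas_comp (cmeas_colw P K) measurable_fst.
- by rewrite mulr_ge0 ?vnorm_ge0// bconst_ge0.
move=> x; apply: eq_cintb (cintb_diagonal (d x.1) (Im (colw P K x)) (b_gt0 x) b0 al0) => //.
move=> y.
have -> : (b x + (y.1 - d x.1)) +i* (y.2 - Im (colw P K x)) =
    (1 + y.1) +i* y.2 - colw P K x.
  rewrite /b; move: (colw P K x) (d x.1) (y.1) (y.2) => w e r m.
  apply: complex_eqP.
    by rewrite [RHS]ReB; transitivity (1 + e - Re w + (r - e)) => //; cbn; ring.
  by rewrite [RHS]ImB.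
by [].
Qed.

End column_integral.

(** * Coordinates of nested symmetric matrices *)

Section coordinates.
Context {R : realType}.
Local Notation leb := (@lebesgue_measure R).
Local Notation RT := (measurableTypeR R).
Local Notation L := (@tuple_lebesgue R).

(** The formula of symmx does not mention the size, so that a sequence of
    coordinates gives an infinite symmetric matrix. *)
Definition symfun (t : seq R) (i j : nat) : R := nth 0 t ('C((maxn i j).+1, 2) + minn i j).

Definition cplxfun (t s : seq R) (i j : nat) : R[i] :=
  ((i == j)%:R + symfun t i j) +i* symfun s i j.

Lemma symfunC t i j : symfun t i j = symfun t j i.
Proof. by rewrite /symfun maxnC minnC. Qed.

Lemma cplxfunC t s i j : cplxfun t s i j = cplxfun t s j i.
Proof. by rewrite /cplxfun (symfunC t) (symfunC s) eq_sym. Qed.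

Lemma lead_symfun n (t : 'C(n.+1, 2).-tuple RT) : lead (symfun t) n = symmx t.
Proof. by apply/matrixP => i j; rewrite !mxE. Qed.

Lemma lead_cplxfun (t s : seq R) n :
  lead (cplxfun t s) n = cplx_mx (1%:M + lead (symfun t) n) (lead (symfun s) n).
Proof. by apply/matrixP => i j; rewrite cplx_mxE !mxE. Qed.

Lemma one_plus_symmx n (t s : 'C(n.+1, 2).-tuple RT) :
  one_plus (symmx t) (symmx s) = lead (cplxfun t s) n.
Proof. by rewrite lead_cplxfun !lead_symfun. Qed.

Lemma binS2 n : ('C(n.+2, 2) = 'C(n.+1, 2) + n.+1)%N.
Proof. by rewrite binS bin1. Qed.

Lemma symfun_index n i j : (i < n)%N -> (j < n)%N ->
  ('C((maxn i j).+1, 2) + minn i j < 'C(n.+1, 2))%N.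
Proof.
move=> ni nj; set m := maxn i j.
have mn : (m < n)%N by rewrite gtn_max ni nj.
apply: (@leq_trans 'C(m.+2, 2)); last by apply: leq_bin2l.
by rewrite binS2 ltn_add2l ltnS (leq_trans (geq_minl i j))// leq_maxl.
Qed.

(** The last column occupies the last n + 1 positions. *)
Definition add_column n (x : 'C(n.+1, 2).-tuple RT * (n.-tuple RT * RT)) : 'C(n.+2, 2).-tuple RT :=
  tcast (esym (binS2 n)) (tcat (x.1, trcons x.2)).

Lemma nth_add_column n p q r i : nth (0 : R) (@add_column n (p, (q, r))) i =
  if (i < 'C(n.+1, 2))%N then nth (0 : R) p i else
  nth 0 (rcons q r) (i - 'C(n.+1, 2)).
Proof. by rewrite val_tcast nth_cat size_tuple. Qed.

Lemma symfun_add_column n p q r i j : (i < n)%N -> (j < n)%N ->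
  symfun (@add_column n (p, (q, r))) i j = symfun p i j.
Proof. by move=> ni nj; rewrite /symfun nth_add_column symfun_index. Qed.

Lemma symfun_add_column_last n p q r i : (i < n)%N ->
  symfun (@add_column n (p, (q, r))) i n = nth (0 : R) q i.
Proof.
move=> ni; rewrite /symfun nth_add_column (maxn_idPr (ltnW ni)) (minn_idPl (ltnW ni)).
by rewrite ltnNge leq_addr/= addKn nth_rcons size_tuple ni.
Qed.

Lemma symfun_add_column_diag n p q r : symfun (@add_column n (p, (q, r))) n n = r.
Proof.
rewrite /symfun nth_add_column maxnn minnn ltnNge leq_addr/= addKn.
by rewrite nth_rcons size_tuple ltnn eqxx.
Qed.

Lemma mpres_add_column n :
  mpres (prodm (L 'C(n.+1, 2)) (prodm (L n) leb)) (L 'C(n.+2, 2)) (@add_column n).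
Proof.
have h := mpres_comp (mpres_prod (mpres_id (L 'C(n.+1, 2))) (mpres_trcons n)) (mpres_tcat _ _).
exact: mpres_comp h (mpres_tcast (esym (binS2 n))).
Qed.

Lemma mpres_interchange d1 d2 d3 d4 (T1 : measurableType d1) (T2 : measurableType d2)
    (T3 : measurableType d3) (T4 : measurableType d4)
    (m1 : {sigma_finite_measure set T1 -> \bar R})
    (m2 : {sigma_finite_measure set T2 -> \bar R})
    (m3 : {sigma_finite_measure set T3 -> \bar R})
    (m4 : {sigma_finite_measure set T4 -> \bar R}) :
  mpres (prodm (prodm m1 m2) (prodm m3 m4)) (prodm (prodm m1 m3) (prodm m2 m4))
    (fun x => ((x.1.1, x.2.1), (x.1.2, x.2.2))).
Proof.
have inv (A B C : measure_display) (TA : measurableType A) (TB : measurableType B)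
    (TC : measurableType C) (ma : {sigma_finite_measure set TA -> \bar R})
    (mb : {sigma_finite_measure set TB -> \bar R})
    (mc : {sigma_finite_measure set TC -> \bar R}) :
    mpres (prodm (prodm ma mb) mc) (prodm ma (prodm mb mc)) (fun x => (x.1.1, (x.1.2, x.2))).
  have h := mpres_assoc ma mb mc.
  apply: (mpres_factor h (mpres_id _)); last by case=> a [b c].
  have h1 : measurable_fun setT (fst \o fst : (TA * TB) * TC -> TA).
    by apply: measurableT_comp; exact: measurable_fst.
  have h2 : measurable_fun setT (snd \o fst : (TA * TB) * TC -> TB).
    by apply: measurableT_comp; [exact: measurable_snd|exact: measurable_fst].
  apply/measurable_fun_pairP; split; first exact: h1.
  by apply/measurable_fun_pairP; split; [exact: h2|exact: measurable_snd].
have h1 := inv _ _ _ _ _ _ m1 m2 (prodm m3 m4).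
have mid : mpres (prodm m2 (prodm m3 m4)) (prodm m3 (prodm m2 m4))
    (fun x => (x.2.1, (x.1, x.2.2))).
  have g1 := mpres_assoc m2 m3 m4.
  have g2 := mpres_prod (mpres_swap m2 m3) (mpres_id m4).
  exact: mpres_comp (mpres_comp g1 g2) (inv _ _ _ _ _ _ m3 m2 m4).
have h2 := mpres_prod (mpres_id m1) mid.
exact: mpres_comp (mpres_comp h1 h2) (mpres_assoc m1 m3 (prodm m2 m4)).
Qed.

Local Notation X n := ('C(n.+1, 2).-tuple RT).

(** The new columns are grouped as the integration over them needs it:
    off-diagonal entries q, l, then diagonal entries r, m. *)
Definition add_columns n (x : (X n * X n) * ((n.-tuple RT * n.-tuple RT) * (RT * RT))) :
    X n.+1 * X n.+1 :=
  (add_column (x.1.1, (x.2.1.1, x.2.2.1)), add_column (x.1.2, (x.2.1.2, x.2.2.2))).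

Lemma mpres_add_columns n :
  mpres (prodm (prodm (L 'C(n.+1, 2)) (L 'C(n.+1, 2))) (prodm (prodm (L n) (L n)) (prodm leb leb)))
    (prodm (L 'C(n.+2, 2)) (L 'C(n.+2, 2))) (@add_columns n).
Proof.
have h1 := mpres_prod (mpres_id (prodm (L 'C(n.+1, 2)) (L 'C(n.+1, 2))))
  (mpres_interchange (L n) (L n) leb leb).
have h2 := mpres_interchange (L 'C(n.+1, 2)) (L 'C(n.+1, 2)) (prodm (L n) leb) (prodm (L n) leb).
exact: mpres_comp (mpres_comp h1 h2) (mpres_prod (mpres_add_column n) (mpres_add_column n)).
Qed.

End coordinates.

(** * The integrand as a product over the pivots *)

Section measurable_pivots.
Context {R : realType} d (T : measurableType d).

Lemma cmeas_pivot (f : T -> nat -> nat -> R[i]) k : (forall i j, cmeas (fun x => f x i j)) ->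
  cmeas (fun x => pivot (f x) k).
Proof.
move=> mf.
have md m : cmeas (fun x => \det (lead (f x) m)).
  rewrite /determinant; apply: cmeas_sum => s; apply: cmeasM; first exact: cmeas_cst.
  apply: cmeas_prod => i.
  have mj (j : 'I_m) : cmeas (fun x => lead (f x) m i j).
    by apply: (eq_cmeas _ (mf i j)) => x; rewrite mxE.
  exact: mj.
by apply: cmeasM => //; exact: cmeasV.
Qed.

Lemma measurable_pivot (f : T -> nat -> nat -> R) k :
  (forall i j, measurable_fun setT (fun x => f x i j : measurableTypeR R)) ->
  measurable_fun setT (fun x => pivot (f x) k : measurableTypeR R).
Proof.
move=> mf; have [h _] := @cmeas_pivot (fun x i j => (f x i j)%:C) k (fun i j => cmeasC (mf i j)).
have dC m x : \det (lead (fun i j => (f x i j)%:C) m) = (\det (lead (f x) m))%:C.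
  rewrite -(det_map_mx (real_complex R)); congr (\det _).
  by apply/matrixP => i j; rewrite !mxE.
move: h; congr (measurable_fun _ _); apply/funext => x.
by rewrite /pivot !dC -fmorphV real_complexM ReC.
Qed.

End measurable_pivots.

Section pivot_products.
Context {R : realType}.
Local Notation leb := (@lebesgue_measure R).
Local Notation RT := (measurableTypeR R).
Local Notation L := (@tuple_lebesgue R).
Local Notation X n := ('C(n.+1, 2).-tuple RT).
Implicit Types (a s t : nat -> R[i]).

Definition pivot_factor (x : R) (z a s t : R[i]) : R[i] :=
  if 0 < x then rpowc x a * hpow z (- s) (- t) else 0.

(** The integrand, written with the pivots of T and of 1 + T + iS; it vanishes
    unless T is positive definite. *)
Definition pivot_product n a s t (x : X n * X n) : R[i] :=
  \prod_(j < n) pivot_factor (pivot (symfun x.1) j) (pivot (cplxfun x.1 x.2) j)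
    (a j) (s j) (t j).

Lemma measurable_symfun n i j : measurable_fun setT (fun x : X n => symfun x i j : RT).
Proof. exact: measurable_nth. Qed.

Lemma cmeas_pivot_product n a s t : cmeas (@pivot_product n a s t).
Proof.
have m1 i j : measurable_fun setT (fun x : X n * X n => symfun x.1 i j : RT).
  by apply: (measurableT_comp (@measurable_symfun n i j)); exact: measurable_fst.
have m2 i j : measurable_fun setT (fun x : X n * X n => symfun x.2 i j : RT).
  by apply: (measurableT_comp (@measurable_symfun n i j)); exact: measurable_snd.
apply: cmeas_prod => j; apply: cmeas_if; last exact: cmeas_cst.
  by apply: measurable_pos; exact: measurable_pivot.
apply: cmeasM; first by apply: cmeas_rpowc; exact: measurable_pivot.
apply: cmeas_hpow; apply: cmeas_pivot => i k; split; last exact: m2.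
by apply: measurable_funD; [exact: measurable_cst|exact: m1].
Qed.

Lemma eq_lead (K : fieldType) (f g : nat -> nat -> K) n :
  (forall i j, (i < n)%N -> (j < n)%N -> f i j = g i j) -> lead f n = lead g n.
Proof. by move=> e; apply/matrixP => i j; rewrite !mxE e. Qed.

Lemma eq_pivot (K : fieldType) (f g : nat -> nat -> K) n :
  (forall i j, (i <= n)%N -> (j <= n)%N -> f i j = g i j) -> pivot f n = pivot g n.
Proof.
move=> e; rewrite /pivot (@eq_lead _ f g n.+1) 1?(@eq_lead _ f g n)// => i j ni nj.
by apply: e; exact: ltnW.
Qed.

Lemma symfun_add_columns n x i j : (i < n)%N -> (j < n)%N ->
  (symfun (@add_columns R n x).1 i j = symfun x.1.1 i j) *
  (symfun (@add_columns R n x).2 i j = symfun x.1.2 i j).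
Proof. by move=> ni nj; rewrite !symfun_add_column. Qed.

Lemma pivot_add_columns n x j : (j < n)%N ->
  (pivot (symfun (@add_columns R n x).1) j = pivot (symfun x.1.1) j) *
  (pivot (cplxfun (@add_columns R n x).1 (add_columns x).2) j =
   pivot (cplxfun x.1.1 x.1.2) j).
Proof.
move=> jn; split; apply: eq_pivot => i k ij kj.
  by rewrite symfun_add_columns// (leq_ltn_trans _ jn).
by rewrite /cplxfun !symfun_add_columns// (leq_ltn_trans _ jn).
Qed.

(** The pivots are Schur complements of the blocks of size n. *)
Lemma last_pivots n (x : (X n * X n) * ((n.-tuple RT * n.-tuple RT) * (RT * RT))) :
  let P := lead (symfun x.1.1) n in let K := lead (symfun x.1.2) n in
  posdefmx P ->
  pivot (symfun (add_columns x).1) n =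
    x.2.2.1 - qform (invmx P) (colv (nth 0 x.2.1.1) n) /\
  pivot (cplxfun (add_columns x).1 (add_columns x).2) n =
    (1 + x.2.2.1) +i* x.2.2.2 - colw P K x.2.1.
Proof.
case: x => [[p k] [[q l] [r m]]]; move=> P K pP; cbn [fst snd] in P, K; cbn [fst snd].
pose x : (X n * X n) * ((n.-tuple RT * n.-tuple RT) * (RT * RT)) :=
  ((p, k), ((q, l), (r, m))).
have lP : lead (symfun (add_columns x).1) n = P.
  by apply: eq_lead => i j ni nj; rewrite symfun_add_columns.
have lK : lead (symfun (add_columns x).2) n = K.
  by apply: eq_lead => i j ni nj; rewrite symfun_add_columns.
have lZ : lead (cplxfun (add_columns x).1 (add_columns x).2) n = cplx_mx (1%:M + P) K.
  by rewrite lead_cplxfun lP lK.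
have sP : P^T = P by apply: tr_lead => i j; exact: symfunC.
have sK : K^T = K by apply: tr_lead => i j; exact: symfunC.
have cq : leadcol (symfun (add_columns x).1) n = colv (nth 0 q) n.
  by apply/colP => i; rewrite !mxE symfun_add_column_last.
have cz : leadcol (cplxfun (add_columns x).1 (add_columns x).2) n =
    cplx_mx (colv (nth 0 q) n) (colv (nth 0 l) n).
  apply/colP => i; rewrite cplx_mxE !mxE /cplxfun !symfun_add_column_last//.
  by rewrite (ltn_eqF (ltn_ord i)) add0r.
split.
  rewrite pivotE; [|by move=> i j; exact: symfunC|by rewrite lP posdef_unit].
  by rewrite lP cq symfun_add_column_diag.
rewrite pivotE; [|by move=> i j; exact: cplxfunC|].
  by rewrite lZ cz /cplxfun !symfun_add_column_diag eqxx.
rewrite lZ; apply: accretive_unit; apply: accretive_cplx => //; last exact: posdef_add1.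
by rewrite linearD/= trmx1 sP.
Qed.

(** By Sylvester's criterion some pivot of T is not positive. *)
Lemma pivot_product_posdef n a s t (x : X n * X n) : ~ posdefmx (lead (symfun x.1) n) ->
  pivot_product a s t x = 0.
Proof.
move=> np; have : exists j : 'I_n, ~~ (0 < pivot (symfun x.1) j).
  apply: contrapT => h; apply: np; apply/posdef_leadP => [|j]; first exact: symfunC.
  by apply: contrapT => /negP hj; apply: h; exists j.
by move=> [j /negbTE jn]; rewrite /pivot_product (bigD1 j)//= /pivot_factor jn mul0r.
Qed.

(** The factor for column k, with c = n + 1 for the size n and with h the
    shift caused by the later columns. *)
Definition col_factor (h c a s t : R[i]) (k : nat) : R[i] :=
  rpowc 2 (2%:R - s - t + 2%:R * h) * (pi : R)%:C ^+ k.+1 *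
  cgamma (a + 1 + h) * cgamma (s + t - a - c - h) / (cgamma (s - h) * cgamma (t - h)).

Local Notation half := (2%:R^-1 : R[i]).

(** Moving the exponents by 1/2 absorbs the determinants left by the last
    column. *)
Lemma pivot_product_half n a s t (x : X n * X n) :
  let P := lead (symfun x.1) n in let K := lead (symfun x.2) n in
  posdefmx P ->
  pivot_product (fun j => a j + half) (fun j => s j - half) (fun j => t j - half) x =
  pivot_product a s t x *
    (Num.sqrt (\det P) * normc (\det (cplx_mx (1%:M + P) K)))%:C.
Proof.
move=> P K pP.
have fC := symfunC x.1.
have tp (j : 'I_n) : 0 < pivot (symfun x.1) j by move: j; apply/posdef_leadP.
have sP : P^T = P by apply: tr_lead => i j; exact: symfunC.
have sK : K^T = K by apply: tr_lead => i j; exact: symfunC.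
have aZ : accretive (lead (cplxfun x.1 x.2) n).
  rewrite lead_cplxfun; apply: accretive_cplx => //; last exact: posdef_add1.
  by rewrite linearD/= trmx1 sP.
have zp (j : 'I_n) : 0 < Re (pivot (cplxfun x.1 x.2) j).
  by have [] := accretive_leadP (cplxfunC x.1 x.2) aZ (ltn_ord j).
have dP : \det P = \prod_(j < n) pivot (symfun x.1) j.
  rewrite prod_pivot// => j jn; rewrite gt_eqF//.
  apply: posdef_det_gt0; first by apply: tr_lead => i k; exact: symfunC.
  apply/posdef_leadP => [|i]; first exact: symfunC.
  exact: (tp (widen_ord (ltnW jn) i)).
have dZ : \det (cplx_mx (1%:M + P) K) = \prod_(j < n) pivot (cplxfun x.1 x.2) j.
  rewrite -lead_cplxfun prod_pivot// => j jn.
  by have [h _] := accretive_leadP (cplxfunC x.1 x.2) aZ jn; exact: accretive_det_neq0.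
have -> : (Num.sqrt (\det P) * normc (\det (cplx_mx (1%:M + P) K)))%:C =
    \prod_(j < n) ((Num.sqrt (pivot (symfun x.1) j))%:C *
      (normc (pivot (cplxfun x.1 x.2) j))%:C).
  rewrite -real_complexM big_split/=; congr (_ * _).
    rewrite dP; elim/big_rec2 : _ => [|j y1 y2 _ <-]; first by rewrite sqrtr1.
    by rewrite sqrtrM ?real_complexM// ltW.
  rewrite dZ; elim/big_rec2 : _ => [|j y1 y2 _ <-]; first by rewrite Normc.normc1.
  by rewrite Normc.normcM real_complexM.
rewrite /pivot_product -big_split/=; apply: eq_bigr => j _.
rewrite /pivot_factor tp rpowcD rpowc_half// !opprB ![half - _]addrC hpowD hpow_half//.
by ring.
Qed.

End pivot_products.

(** * Induction on the size of the matrices *)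

Section induction.
Context {R : realType}.
Local Notation leb := (@lebesgue_measure R).
Local Notation RT := (measurableTypeR R).
Local Notation L := (@tuple_lebesgue R).
Local Notation X n := ('C(n.+1, 2).-tuple RT).
Local Notation half := (2%:R^-1 : R[i]).
Implicit Types (a s t : nat -> R[i]).

Lemma pivot_productS n a s t (x : X n * X n) y :
  let P := lead (symfun x.1) n in let K := lead (symfun x.2) n in
  posdefmx P ->
  pivot_product a s t (add_columns (x, y)) =
  pivot_product a s t x * colker P K (a n) (s n) (t n) y.
Proof.
move=> P K pP; have [e1 e2] := last_pivots (x := (x, y)) pP.
transitivity (pivot_product a s t x *
    pivot_factor (pivot (symfun (add_columns (x, y)).1) n)
      (pivot (cplxfun (add_columns (x, y)).1 (add_columns (x, y)).2) n) (a n) (s n) (t n)).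
  move: (pivot_add_columns (x, y)) {e1 e2}; move: (add_columns (x, y)) => w f.
  have E : pivot_product a s t x = \prod_(j < n)
      pivot_factor (pivot (symfun w.1) j) (pivot (cplxfun w.1 w.2) j) (a j) (s j) (t j).
    apply: eq_bigr => j _; have [e1 e2] := f j (ltn_ord j).
    by rewrite e1 e2.
  rewrite E {1}/pivot_product.
  exact: big_ord_recr.
by rewrite e1 e2 /pivot_factor /colker.
Qed.

Lemma pivot_productS0 n a s t (x : X n * X n) y : ~ posdefmx (lead (symfun x.1) n) ->
  pivot_product a s t (add_columns (x, y)) = 0.
Proof.
move=> np; apply: pivot_product_posdef => /(posdef_leadS _ (symfunC _))[h _].
apply: np; move: h; congr posdefmx.
by apply: eq_lead => i j ni nj; rewrite symfun_add_columns.
Qed.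

Lemma gint_real (p : R) : 0 < p -> gint p%:C 1 = (Re (gint p%:C 1))%:C.
Proof.
move=> p0; have h := gker_cint (p0 : 0 < Re p%:C) (ltr01 : 0 < Re (1 : R[i])).
have [hi _] := h.
rewrite (cint_unique h (eq_cint _ (cint_nint hi))) ?ReC// => u.
exact: (gker_real p%:C 1 u).
Qed.

(** Collecting the constants from the vertical line, the beta integral and the
    radial integral; the Gamma factors at al and at s + t - 1 cancel. *)
Lemma col_factor0 (n : nat) (a s t : R[i]) : 0 < Re (a + 1) ->
  n%:R < Re (s + t - a - 2%:R) ->
  let al := s + t - a - 2%:R in
  vint (- s) (- t) * (gint al 1 * gint (a + 1) 1 / gint (s + t - 1) 1) *
    ((pi ^+ n)%:C * gint (al - (n%:R : R)%:C) 1 / gint al 1) =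
  col_factor 0 n.+2%:R a s t n.
Proof.
move=> b0 aln al; have n0 : 0 <= n%:R :> R by rewrite ler0n.
have al0 : 0 < Re al by apply: le_lt_trans aln.
have st : 1 < Re (s + t) by move: aln b0 n0; rewrite !ReImE; lra.
have st1 : 0 < Re (s + t - 1) by move: st; rewrite !ReImE; lra.
have aln0 : 0 < Re (al - (n%:R : R)%:C) by rewrite ReB ReC subr_gt0.
rewrite vintE// -!cgamma_gint// /col_factor !(addr0, subr0, mulr0).
have -> : s + t - a - n.+2%:R = al - (n%:R : R)%:C.
  by rewrite /al rmorph_nat -addn2 natrD; ring.
have -> : rpowc 2 (2%:R - s - t) = 2%:R * rpowc 2 (1 - s - t) :> R[i].
  rewrite (_ : 2%:R - s - t = 1 + (1 - s - t)); last by ring.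
  by rewrite rpowcD rpowc1// rmorph_nat.
have g1 := cgamma_neq0 al0; have g2 := cgamma_neq0 st1.
rewrite (invfM (cgamma s)) rmorphXn exprS.
move: (cgamma s)^-1 (cgamma t)^-1 (rpowc 2 _) (cgamma (a + 1)) (cgamma (al - _)) => x y z u v.
by field; apply/andP.
Qed.

Lemma cintb_last_column n a s t (x : X n * X n) : 0 < Re (a n + 1) ->
  n%:R < Re (s n + t n - a n - 2%:R) ->
  let al := s n + t n - a n - 2%:R in
  let g := pivot_product (fun j => a j + half) (fun j => s j - half) (fun j => t j - half) x in
  cintb (prodm (prodm (L n) (L n)) (prodm leb leb))
    (fun y => pivot_product a s t (add_columns (x, y)))
    (col_factor 0 n.+2%:R (a n) (s n) (t n) n * g)
    (vnorm (- s n) (- t n) * bconst al (a n + 1) *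
      (pi ^+ n * Re (gint ((Re al)%:C - (n%:R : R)%:C) 1 / gint (Re al)%:C 1)) * normc g).
Proof.
move=> b0 aln al g.
have [pP|np] := pselect (posdefmx (lead (symfun x.1) n)); last first.
  rewrite /g pivot_product_posdef// mulr0 Normc.normc0 mulr0.
  apply: (eq_cintb _ erefl erefl (cintb0 _ (lexx 0))) => y.
  by rewrite pivot_productS0.
have sP : (lead (symfun x.1) n)^T = lead (symfun x.1) n by apply: tr_lead => i j; exact: symfunC.
have sK : (lead (symfun x.2) n)^T = lead (symfun x.2) n by apply: tr_lead => i j; exact: symfunC.
have h := cintbZ (pivot_product a s t x) (cintb_column sP pP sK b0 aln).
apply: eq_cintb h.
- by move=> y; rewrite pivot_productS.
- rewrite -col_factor0// /g pivot_product_half// -(real_complexM (pi ^+ n)) -/al; ring.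
- rewrite /g pivot_product_half// (Normc.normcM (pivot_product a s t x)) normcC ger0_norm.
    by rewrite -/al; ring.
  by rewrite mulr_ge0 ?sqrtr_ge0 ?normc_ge0.
Qed.

Lemma cint_cintb d (T : measurableType d) (m : {measure set T -> \bar R}) (f : T -> R[i]) v :
  cint m f v -> exists B, cintb m f v B.
Proof.
move=> h; exists (fine (nint m f)); split => //.
by rewrite fineK// ge0_fin_numE ?nint_ge0// nint_lty; have [] := h.
Qed.

(** Each of the n - k - 1 later columns moves the exponents of column k by
    1/2. *)
Definition hshift (n k : nat) : R[i] := (n - k.+1)%:R / 2%:R.

Lemma hshiftS n k : (k < n)%N -> hshift n.+1 k = hshift n k + half.
Proof.
by move=> kn; rewrite /hshift subSn// -natr1 mulrDl mul1r.
Qed.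

(** The last column leaves the integrand of the previous size with exponents
    moved by 1/2, and col_factor takes the same value at the moved exponents
    as at the old ones with the shift raised by 1/2. *)
Lemma pivot_integral n a s t :
  (forall k, (k < n)%N -> 0 < Re (a k + 1 + hshift n k)) ->
  (forall k, (k < n)%N -> 0 < Re (s k + t k - a k - n.+1%:R - hshift n k)) ->
  exists B, cintb (prodm (L 'C(n.+1, 2)) (L 'C(n.+1, 2))) (pivot_product a s t)
    (\prod_(k < n) col_factor (hshift n k) n.+1%:R (a k) (s k) (t k) k) B.
Proof.
elim: n a s t => [|n IH] a s t ha hst.
  have h1 : cint (L 'C(1, 2)) (fun=> (1 : R)%:C) (1 : R)%:C by exact: cint_tuple0.
  apply: cint_cintb; rewrite big_ord0.
  have h := @cint_prod_ge0 R _ _ _ _ (L 'C(1, 2)) (L 'C(1, 2)) (fun=> 1) (fun=> 1) 1 1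
    (measurable_cst _) ler01 (fun=> ler01) (fun=> ler01).
  apply: cint_eqv (eq_cint _ (h _ h1)) _; last by rewrite mulr1.
    by move=> x; rewrite /pivot_product big_ord0.
  by move=> x; rewrite mulr1.
have a' k : (k < n)%N -> 0 < Re (a k + half + 1 + hshift n k).
  move=> kn; have := ha k (ltnW kn); rewrite hshiftS//.
  by congr (0 < Re _); ring.
have st' k : (k < n)%N ->
    0 < Re (s k - half + (t k - half) - (a k + half) - n.+1%:R - hshift n k).
  move=> kn; have := hst k (ltnW kn); rewrite hshiftS//.
  by congr (0 < Re _); rewrite -[n.+2%:R]natr1; field.
have [B hB] := IH (fun j => a j + half) (fun j => s j - half) (fun j => t j - half) a' st'.
have hn : hshift n.+1 n = 0 by rewrite /hshift subnn mul0r.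
have b0 : 0 < Re (a n + 1) by have := ha n (ltnSn n); rewrite hn addr0.
have aln : n%:R < Re (s n + t n - a n - 2%:R).
  have := hst n (ltnSn n); have -> : n.+2%:R = n%:R + 2%:R :> R[i] by rewrite -addn2 natrD.
  rewrite hn subr0 !ReImE; lra.
set C := vnorm (- s n) (- t n) * bconst (s n + t n - a n - 2%:R) (a n + 1) *
      (pi ^+ n * Re (gint ((Re (s n + t n - a n - 2%:R))%:C - (n%:R : R)%:C) 1 /
        gint (Re (s n + t n - a n - 2%:R))%:C 1)).
have n0 : 0 <= n%:R :> R by rewrite ler0n.
have al0 : 0 < Re (s n + t n - a n - 2%:R) by apply: le_lt_trans aln.
have C0 : 0 <= C.
  apply: mulr_ge0; first by rewrite mulr_ge0 ?vnorm_ge0// bconst_ge0.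
  apply: mulr_ge0; first by rewrite exprn_ge0// pi_ge0.
  have aln0 : 0 < Re (s n + t n - a n - 2%:R) - n%:R by rewrite subr_gt0.
  have eB : (Re (s n + t n - a n - 2%:R))%:C - (n%:R : R)%:C =
      (Re (s n + t n - a n - 2%:R) - n%:R)%:C by rewrite rmorphB.
  by rewrite eB (gint_real al0) (gint_real aln0) -fmorphV real_complexM ReC divr_ge0// ltW// gint_gt0.
exists (C * B).
apply: (mpres_cintb (mpres_add_columns n)); first exact: cmeas_pivot_product.
rewrite big_ord_recr/= mulrC hn.
have -> : \prod_(k < n) col_factor (hshift n.+1 k) n.+2%:R (a k) (s k) (t k) k =
    \prod_(k < n) col_factor (hshift n k) n.+1%:R (a k + half) (s k - half) (t k - half) k.
  apply: eq_bigr => k _; rewrite hshiftS// /col_factor.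
  have e1 : 2%:R - (s k - half) - (t k - half) + 2%:R * hshift n k =
      2%:R - s k - t k + 2%:R * (hshift n k + half) by field.
  have e2 : a k + half + 1 + hshift n k = a k + 1 + (hshift n k + half) by ring.
  have e3 : s k - half + (t k - half) - (a k + half) - n.+1%:R - hshift n k =
      s k + t k - a k - n.+2%:R - (hshift n k + half).
    by rewrite -[n.+2%:R]natr1; field.
  have e4 (z : R[i]) : z - half - hshift n k = z - (hshift n k + half) by ring.
  by rewrite e1 e2 e3 !e4.
apply: cintb_prod hB => //.
- apply: cmeas_comp; first exact: cmeas_pivot_product.
  exact: (@mpres_add_columns R n).1.
- by move=> x; exact: cintb_last_column.
Qed.

End induction.

(** * From minors to pivots *)

Section minors.
Context {R : realType}.
Local Notation RT := (measurableTypeR R).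
Local Notation L := (@tuple_lebesgue R).
Local Notation X n := ('C(n.+1, 2).-tuple RT).

(** Abel summation: every pivot collects the exponents of all later blocks. *)
Lemma prod_telescope (K : comNzRingType) (phi : nat -> nat -> nat -> K) n :
  (forall i j k m, phi i j k * phi i k m = phi i j m) ->
  \prod_(j < n) \prod_(i < j.+1) phi i j j.+1 = \prod_(i < n) phi i i n.
Proof.
move=> H; elim: n => [|n IH]; first by rewrite !big_ord0.
rewrite [LHS]big_ord_recr [RHS]big_ord_recr/= IH [Y in _ * Y]big_ord_recr/=.
rewrite mulrA -big_split; congr (_ * _).
by apply: eq_bigr => i _; exact: H.
Qed.

Lemma rpowc_prod n (x : 'I_n -> R) c : (forall i, 0 < x i) ->
  rpowc (\prod_i x i) c = \prod_i rpowc (x i) c.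
Proof.
move=> x0; suff [_ //] : 0 < \prod_i x i /\ rpowc (\prod_i x i) c = \prod_i rpowc (x i) c.
elim/big_rec2 : _ => [|i y1 y2 _ [y0 <-]]; first by rewrite ltr01 rpow1c.
by rewrite mulr_gt0// rpowcM.
Qed.

(** Minors and powers of minors are products over the pivots. *)
Lemma integrand_pivots n (l s t : nat -> R[i]) (x : X n * X n) :
  l n = 0 -> s n = 0 -> t n = 0 -> posdefmx (symmx x.1) ->
  (\prod_(j < n)
     (rpowc (\det (lead_block (symmx x.1) j)) (l j - l j.+1) /
      detpow (lead_block (one_plus (symmx x.1) (symmx x.2)) j)
        (s j - s j.+1) (t j - t j.+1))) * (\det (symmx x.1))%:C ^- n.+1 =
  pivot_product (fun j => l j - n.+1%:R) s t x.
Proof.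
move=> l0 s0 t0 pT; rewrite -lead_symfun in pT *.
rewrite one_plus_symmx.
have tp (j : 'I_n) : 0 < pivot (symfun x.1) j.
  by move: j; apply/posdef_leadP => //; exact: symfunC.
have sP : (lead (symfun x.1) n)^T = lead (symfun x.1) n by apply: tr_lead => i j; exact: symfunC.
have sK : (lead (symfun x.2) n)^T = lead (symfun x.2) n by apply: tr_lead => i j; exact: symfunC.
have aZ : accretive (lead (cplxfun x.1 x.2) n).
  rewrite lead_cplxfun; apply: accretive_cplx => //; last exact: posdef_add1.
  by rewrite linearD/= trmx1 sP.
have dP m : (m <= n)%N -> \det (lead (symfun x.1) m) = \prod_(j < m) pivot (symfun x.1) j.
  move=> mn; rewrite prod_pivot// => j jm; rewrite gt_eqF//.
  apply: posdef_det_gt0; first by apply: tr_lead => i k; exact: symfunC.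
  apply/posdef_leadP => [|i]; first exact: symfunC.
  exact: (tp (widen_ord (leq_trans (ltnW jm) mn) i)).
pose phi i j k := rpowc (pivot (symfun x.1) i) (l j - l k) *
  hpow (pivot (cplxfun x.1 x.2) i) (- (s j - s k)) (- (t j - t k)).
have mul (y : R) (z b c d b' c' d' : R[i]) : rpowc y b * hpow z c d * (rpowc y b' * hpow z c' d') =
    rpowc y (b + b') * hpow z (c + c') (d + d').
  by rewrite rpowcD hpowD; ring.
have sub3 (u v w : R[i]) : (u - v) + (v - w) = u - w by ring.
have sub3N (u v w : R[i]) : - (u - v) + - (v - w) = - (u - w) by ring.
have phiM i j k m : phi i j k * phi i k m = phi i j m.
  by rewrite /phi mul sub3 !sub3N.
have e (j : 'I_n) : rpowc (\det (lead_block (lead (symfun x.1) n) j)) (l j - l j.+1) /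
      detpow (lead_block (lead (cplxfun x.1 x.2) n) j) (s j - s j.+1) (t j - t j.+1) =
    \prod_(i < j.+1) phi i j j.+1.
  rewrite !lead_blockE dP// rpowc_prod; last first.
    by move=> i; exact: (tp (widen_ord (ltn_ord j) i)).
  rewrite detpow_lead; [|exact: cplxfunC|]; last first.
    have [jn|jn] := ltnP j.+1 n; first by have [] := accretive_leadP (cplxfunC x.1 x.2) aZ jn.
    by have -> : j.+1 = n by apply/eqP; rewrite eqn_leq jn ltn_ord.
  rewrite -prodfV -big_split; apply: eq_bigr => i _.
  by rewrite /phi hpowN.
rewrite (eq_bigr _ (fun j _ => e j)) (prod_telescope n phiM).
have -> : (\det (lead (symfun x.1) n))%:C ^- n.+1 =
    \prod_(i < n) rpowc (pivot (symfun x.1) i) (- n.+1%:R).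
  rewrite -rpowc_prod// -dP// rpowcN rpowcn; first by rewrite rmorphXn.
  by rewrite dP//; elim/big_ind : _ => // y z y0 z0; rewrite mulr_gt0.
rewrite -big_split /pivot_product; apply: eq_bigr => i _.
by rewrite -[LHS]/(phi i i n * _) /phi l0 s0 t0 !subr0 /pivot_factor tp mulrAC -rpowcD.
Qed.

(** Sylvester's criterion makes the cone a finite intersection. *)
Lemma measurable_posdef n : measurable [set x : X n * X n | posdefmx (symmx x.1)].
Proof.
have -> : [set x : X n * X n | posdefmx (symmx x.1)] =
    \bigcap_(j in [set: 'I_n]) [set x : X n * X n | 0 < pivot (symfun x.1) j].
  apply/seteqP; split=> x /=; rewrite -lead_symfun.
    by move=> /posdef_leadP h j _; apply: h; exact: symfunC.
  by move=> h; apply/posdef_leadP => [|j]; [exact: symfunC|exact: h].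
apply: fin_bigcap_measurable => // j _.
have m1 i k : measurable_fun setT (fun x : X n * X n => symfun x.1 i k : RT).
  by apply: (measurableT_comp (@measurable_symfun R n i k)); exact: measurable_fst.
have := measurable_pos (measurable_pivot j m1).
move=> /(_ measurableT [set true]); by rewrite setTI; apply.
Qed.

End minors.

Theorem mainTheorem10 (R : realType) (n : nat) (lam sig tau : n.-tuple R[i])
    (n_ge1 : (1 <= n)%N)
    (hlam : forall k : 'I_n,
      0 < complex.Re (lam`_k - (n + k.+1)%:R / 2%:R))
    (hst : forall k : 'I_n,
      0 < complex.Re (sig`_k + tau`_k - lam`_k - (n - k.+1)%:R / 2%:R)) :
  let mu := (@tuple_lebesgue R 'C(n.+1, 2) \x @tuple_lebesgue R 'C(n.+1, 2))%E in
  let X := 'C(n.+1, 2).-tuple (measurableTypeR R) in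
  let D := [set ts : X * X | posdefmx (@symmx R n ts.1)] in
  let F (ts : X * X) :=
    let T := @symmx R n ts.1 in
    let S := @symmx R n ts.2 in
    (\prod_(j < n)
       (rpowc (\det (lead_block T j)) (lam`_j - lam`_j.+1) /
        detpow (lead_block (one_plus T S) j)
          (sig`_j - sig`_j.+1) (tau`_j - tau`_j.+1))) *
    (\det T)%:C ^- n.+1 in
  cintegrable mu D F /\
  cintegral mu D F =
  \prod_(k < n)
    (rpowc 2 (2%:R - sig`_k - tau`_k + (n - k.+1)%:R) * (pi : R)%:C ^+ k.+1 *
     cgamma (lam`_k - (n + k.+1)%:R / 2%:R) *
     cgamma (sig`_k + tau`_k - lam`_k - (n - k.+1)%:R / 2%:R) /
     (cgamma (sig`_k - (n - k.+1)%:R / 2%:R) *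
      cgamma (tau`_k - (n - k.+1)%:R / 2%:R))).
Proof.
move=> mu X D F.
have natE k : (k < n)%N -> (n - k.+1)%:R = n%:R - k.+1%:R :> R[i].
  by move=> kn; rewrite natrB.
have aE k : (k < n)%N -> lam`_k - n.+1%:R + 1 + hshift n k = lam`_k - (n + k.+1)%:R / 2%:R.
  by move=> kn; rewrite /hshift natE// natrD -[n.+1%:R]natr1; field.
have sE k : sig`_k + tau`_k - (lam`_k - n.+1%:R) - n.+1%:R - hshift n k =
    sig`_k + tau`_k - lam`_k - (n - k.+1)%:R / 2%:R.
  by rewrite /hshift; ring.
have [|k kn|B [H _]] := @pivot_integral R n (fun k => lam`_k - n.+1%:R)
    (fun k => sig`_k) (fun k => tau`_k).
- by move=> k kn; rewrite aE//; exact: (hlam (Ordinal kn)).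
- by rewrite sE; exact: (hst (Ordinal kn)).
have z (u : n.-tuple R[i]) : u`_n = 0 by rewrite nth_default// size_tuple.
(* The integrand is extended by 0 off the positive definite cone. *)
have FE x : D x -> pivot_product (fun k => lam`_k - n.+1%:R)
    (fun k => sig`_k) (fun k => tau`_k) x = F x.
  by move=> Dx; rewrite -(integrand_pivots (z lam) (z sig) (z tau) Dx).
have F0 x : ~ D x -> pivot_product (fun k => lam`_k - n.+1%:R)
    (fun k => sig`_k) (fun k => tau`_k) x = 0.
  by move=> Dx; rewrite pivot_product_posdef// lead_symfun.
have E : \prod_(k < n) col_factor (hshift n k) n.+1%:R (lam`_k - n.+1%:R) sig`_k tau`_k k =
  \prod_(k < n)
    (rpowc 2 (2%:R - sig`_k - tau`_k + (n - k.+1)%:R) * (pi : R)%:C ^+ k.+1 *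
     cgamma (lam`_k - (n + k.+1)%:R / 2%:R) *
     cgamma (sig`_k + tau`_k - lam`_k - (n - k.+1)%:R / 2%:R) /
     (cgamma (sig`_k - (n - k.+1)%:R / 2%:R) *
      cgamma (tau`_k - (n - k.+1)%:R / 2%:R))).
  apply: eq_bigr => k _; rewrite /col_factor aE// sE.
  by rewrite (_ : 2%:R * hshift n k = (n - k.+1)%:R)// /hshift mulrCA divff// mulr1.
rewrite -E.
have [h _] := @cint_mkcond _ _ _ (prodm (@tuple_lebesgue R 'C(n.+1, 2))
  (@tuple_lebesgue R 'C(n.+1, 2))) D F _
  (\prod_(k < n) col_factor (hshift n k) n.+1%:R (lam`_k - n.+1%:R) sig`_k tau`_k k)
  (@measurable_posdef R n) FE F0.
exact: (h H).
Qed.
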